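(* Let $n,m,l\in\mathbb{N}$, let $\Phi:\mathbb{M}_n\to\mathbb{M}_l$ and $\Psi:\mathbb{M}_m\to\mathbb{M}_l$ be strictly positive linear maps, and let $p,q\in\mathbb{R}$ with $(p,q)\ne(0,0)$. Assume that either $0\le p,q\le1$ or $-1\le p,q\le0$. Let $f$ be a real function on $(0,\infty)$. If $x\mapsto f(x^{p+q})$ is operator monotone (resp., operator monotone decreasing) on $(0,\infty)$, then the function $$(A,B)\in\mathbb{P}_n\times\mathbb{P}_m\longmapsto\mathrm{Tr}\, f\bigl(\Phi(A^p)^{1/2}\Psi(B^q)\Phi(A^p)^{1/2}\bigr)$$ is jointly concave (resp., jointly convex).
   Context: $\mathbb{M}_n$ denotes the $n\times n$ complex matrices, $\mathbb{P}_n$ the positive definite ones, $\mathrm{Tr}$ the usual trace. A linear map $\Phi:\mathbb{M}_n\to\mathbb{M}_l$ is positive if it maps positive semidefinite matrices to positive semidefinite matrices, and strictly positive if it maps $\mathbb{P}_n$ into $\mathbb{P}_l$. A real function $h$ on $(0,\infty)$ is operator monotone (resp. operator monotone decreasing) if $A\le B$ implies $h(A)\le h(B)$ (resp. $h(A)\ge h(B)$) for all positive definite matrices $A,B$ of any size. *)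

(* Defs.v *)
(* mathcomp 2.5 (spectral.v for the spectral theorem),
   mathcomp-real-closed (complex numbers R[i]) and mathcomp-analysis (powR). *)
From HB Require Import structures.
From mathcomp Require Import all_boot all_order all_algebra.
From mathcomp Require Import sesquilinear spectral.
From mathcomp Require Import complex.
From mathcomp Require Import reals exp.

Set Implicit Arguments.
Unset Strict Implicit.
Unset Printing Implicit Defensive.

Import Order.TTheory GRing.Theory Num.Theory.
Local Open Scope ring_scope.
Local Open Scope sesquilinear_scope.

Section Defs.
Variable R : realType.
Local Notation C := R[i].

(** embedding of reals into complex numbers *)
Definition RtoC (x : R) : C := Complex x 0.

(** Hermitian (self-adjoint) matrices *)
Definition hermitian_mx k (A : 'M[C]_k) : Prop := A ^t* = A.

(** positive semidefinite: Hermitian and <Av, v> >= 0 for all v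
    (vectors are rows, quadratic form v A v^* ) *)
Definition psdmx k (A : 'M[C]_k) : Prop :=
  hermitian_mx A /\ forall v : 'rV[C]_k, 0 <= (v *m A *m v ^t*) 0 0.

(** positive definite matrices (the set P_k) *)
Definition pdmx k (A : 'M[C]_k) : Prop :=
  hermitian_mx A /\ forall v : 'rV[C]_k, v != 0 -> 0 < (v *m A *m v ^t*) 0 0.

(** Loewner order A <= B *)
Definition loewner_le k (A B : 'M[C]_k) : Prop := psdmx (B - A).

(** functional calculus: for a Hermitian (more generally normal) A,
    A = P^-1 diag(d) P with P unitary (spectral theorem, spectral.v);
    h(A) := P^-1 diag(h(d)) P  (h applied to the real eigenvalues). *)
Definition mxfun (h : R -> R) k (A : 'M[C]_k) : 'M[C]_k :=
  invmx (spectralmx A)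
  *m diag_mx (map_mx (fun z : C => RtoC (h (complex.Re z))) (spectral_diag A))
  *m spectralmx A.

(** operator monotone (resp. decreasing) on (0, oo), for matrices of any size *)
Definition op_monotone (h : R -> R) : Prop :=
  forall k (A B : 'M[C]_k), pdmx A -> pdmx B -> loewner_le A B ->
    loewner_le (mxfun h A) (mxfun h B).

Definition op_monotone_decr (h : R -> R) : Prop :=
  forall k (A B : 'M[C]_k), pdmx A -> pdmx B -> loewner_le A B ->
    loewner_le (mxfun h B) (mxfun h A).

(** strictly positive linear maps: P_n into P_l *)
Definition strictly_positive n l (Phi : 'M[C]_n -> 'M[C]_l) : Prop :=
  forall A, pdmx A -> pdmx (Phi A).

(** joint concavity / convexity on P_n x P_m of a map with (real) values
    in C; the order on C = R[i] is: x <= y iff Im x = Im y and Re x <= Re y *)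
Definition jointly_concave n m (F : 'M[C]_n -> 'M[C]_m -> C) : Prop :=
  forall (A1 A2 : 'M[C]_n) (B1 B2 : 'M[C]_m) (t : R),
    pdmx A1 -> pdmx A2 -> pdmx B1 -> pdmx B2 -> 0 <= t <= 1 ->
    RtoC t * F A1 B1 + RtoC (1 - t) * F A2 B2
      <= F (RtoC t *: A1 + RtoC (1 - t) *: A2) (RtoC t *: B1 + RtoC (1 - t) *: B2).

Definition jointly_convex n m (F : 'M[C]_n -> 'M[C]_m -> C) : Prop :=
  forall (A1 A2 : 'M[C]_n) (B1 B2 : 'M[C]_m) (t : R),
    pdmx A1 -> pdmx A2 -> pdmx B1 -> pdmx B2 -> 0 <= t <= 1 ->
    F (RtoC t *: A1 + RtoC (1 - t) *: A2) (RtoC t *: B1 + RtoC (1 - t) *: B2)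
      <= RtoC t * F A1 B1 + RtoC (1 - t) * F A2 B2.

End Defs.

(* Main.v *)
Require Import Defs.
From HB Require Import structures.
From mathcomp Require Import all_boot all_order all_algebra.
From mathcomp Require Import sesquilinear spectral separable cyclic cyclotomic.
From mathcomp Require Import complex.
From mathcomp Require Import reals exp.
From mathcomp Require Import boolp classical_sets sequences trigo.
From mathcomp Require Import ring lra zify.

(** Epstein's method shows that
    [(A, W) |-> Re (\tr (J *m Z *m J^t* *m W ^ (1 - p)))] is jointly concave, where [Z] is
    [Phi (A ^ p)] or [(Phi (A ^ (- p)))^-1] and [0 <= p <= 1].  On the family
    [(1 + z^2) A + z H + eps], [z] in the unit disc, the powers are uniform limits of
    polynomials in [z], and on the unit circle the numerical range of the resulting matrix
    function lies in a sector; this boundary condition makes the function concave in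
    [x / (1 + x^2)], [x] real, that is, along the line [A + tau H].

    The variational formula of Carlen and Lieb, an operator Young inequality, removes [W]:
    [A |-> \tr ((J *m Z *m J^t* ) ^ (1 / p))] is concave.

    For [X = Phi (A ^ p)], [Y = Psi (B ^ q)], let [mu i] be the eigenvalues of
    [X ^ (1/2) *m Y *m X ^ (1/2)] in increasing order.  The sum of the [k] smallest
    [mu i ^ (1 / (p + q))] is the minimum, over all [k]-rowed [J] and [L] with
    [J *m L^t* = 1], of
    [(q \tr (L *m Y *m L^t* ) ^ (1 / q) + p \tr (J *m X *m J^t* ) ^ (1 / p)) / (p + q)];
    it is therefore jointly concave in [(A, B)].  This is a weak majorization, which is
    transported by the concave nondecreasing function [x |-> f (x ^ (p + q))].  Negative
    exponents are handled by passing to the inverses of [X] and [Y]. *)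

Set Implicit Arguments.
Unset Strict Implicit.
Unset Printing Implicit Defensive.

Import Order.TTheory GRing.Theory Num.Theory ComplexField.Normc.
Local Open Scope ring_scope.
Local Open Scope sesquilinear_scope.
Local Open Scope complex_scope.

(** * Spectral decompositions, functional calculus and quadratic forms *)

Section MatrixBasics.
Variable R : realType.
Local Notation C := R[i].
Local Notation Re := (@complex.Re R).
Local Notation Im := (@complex.Im R).

(** The family is shaped by two identities. If [|z| = 1], then [1 + z^2 = 2 Re z z], so
    [(1 + z^2) A + z H] is [z] times a Hermitian matrix: it is normal and its spectrum lies on the
    line through [0] and [z]. If [x] is real, it is [(1 + x^2) (A + tau H)] with
    [tau = x / (1 + x^2)], and the function to be shown concave is homogeneous of degree one. For a
    polynomial [F] with coefficients [F_i], [F x / (1 + x^2)] equals [F_0 + F_1 tau] minus the mean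
    over the circle of [F z (1 - z^-2) tau^2 / (1 - 2 tau Re z)]. The sector condition says that
    [F z (1 - z^-2)] has nonnegative real part, and the kernel is convex in [tau]; concavity
    follows. Means over roots of unity take the place of contour integrals, and being a uniform
    limit of polynomials takes the place of analyticity. Functions of that kind are stable under
    inverse square roots kept off the negative half-line, which gives dyadic exponents only; all
    other exponents, and the removal of [eps], come from a multiplicative perturbation estimate. *)

Lemma normcE2 (z : C) : normc z ^+ 2 = Re z ^+ 2 + Im z ^+ 2.
Proof. by case: z => a b /=; rewrite sqr_sqrtr // addr_ge0 ?sqr_ge0. Qed.

Lemma normc_ge0 (z : C) : 0 <= normc z.
Proof. by case: z => a b; apply: sqrtr_ge0. Qed.

Lemma mulcJ (z : C) : z * z^* = (normc z ^+ 2)%:C.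
Proof. by rewrite normcE2; case: z => a b /=; simpc; congr (_ +i* _); ring. Qed.

Lemma conjcR (a : R) : Num.conj (a%:C : C) = a%:C.
Proof. by apply/eqP; rewrite eq_complex /= oppr0 !eqxx. Qed.

Lemma ReD (x y : C) : Re (x + y) = Re x + Re y.
Proof. by case: x; case: y. Qed.

Lemma ReN (x : C) : Re (- x) = - Re x.
Proof. by case: x. Qed.

Lemma ReB (x y : C) : Re (x - y) = Re x - Re y.
Proof. by rewrite ReD ReN. Qed.

Lemma ReM (x y : C) : Re (x * y) = Re x * Re y - Im x * Im y.
Proof. by case: x; case: y. Qed.

Lemma ReZ (a : R) (x : C) : Re (a%:C * x) = a * Re x.
Proof. by rewrite ReM /= mul0r subr0. Qed.

Lemma Re_sum (I : Type) (r : seq I) (P : pred I) (F : I -> C) :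
  Re (\sum_(i <- r | P i) F i) = \sum_(i <- r | P i) Re (F i).
Proof. by apply: (big_morph Re ReD). Qed.

Lemma ReJ (z : C) : Re z^* = Re z.
Proof. by case: z. Qed.

Lemma Re_le_normc (z : C) : Re z <= normc z.
Proof.
have h := normc_ge0 z.
rewrite (le_trans (ler_norm _)) // -(ger0_norm h) -ler_sqr ?nnegrE //.
by rewrite !real_normK ?num_real // normcE2 lerDl sqr_ge0.
Qed.

Lemma ler_normcD (x y : C) : normc (x + y) <= normc x + normc y.
Proof. exact: le_normcD. Qed.

Lemma normcN' (x : C) : normc (- x) = normc x.
Proof. exact: normcN. Qed.

Lemma ler_normcB (x y : C) : normc (x - y) <= normc x + normc y.
Proof. by rewrite (le_trans (ler_normcD _ _)) // normcN'. Qed.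

Lemma normcJ' (x : C) : normc x^* = normc x.
Proof. by case: x => a b /=; rewrite sqrrN. Qed.

Lemma normcR (a : R) : normc a%:C = `|a|.
Proof. by rewrite /= expr0n addr0 sqrtr_sqr. Qed.

Lemma ler_normc_sum (I : Type) (r : seq I) (P : pred I) (F : I -> C) :
  normc (\sum_(i <- r | P i) F i) <= \sum_(i <- r | P i) normc (F i).
Proof.
elim/big_rec2: _ => [|i y x _ h]; first by rewrite normc0.
by rewrite (le_trans (ler_normcD _ _)) // lerD2l.
Qed.

Lemma adjM m n p (A : 'M[C]_(m, n)) (B : 'M[C]_(n, p)) :
  (A *m B)^t* = B^t* *m A^t*.
Proof. by rewrite trmx_mul map_mxM. Qed.

Lemma adjD m n (A B : 'M[C]_(m, n)) : (A + B)^t* = A^t* + B^t*.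
Proof. by rewrite linearD map_mxD. Qed.

Lemma adjB m n (A B : 'M[C]_(m, n)) : (A - B)^t* = A^t* - B^t*.
Proof. by rewrite linearB map_mxB. Qed.

Lemma adjZ m n (a : C) (A : 'M[C]_(m, n)) : (a *: A)^t* = a^* *: A^t*.
Proof. by apply/matrixP => i j; rewrite !mxE rmorphM. Qed.

Lemma adjE m n (A : 'M[C]_(m, n)) i j : A^t* i j = (A j i)^*.
Proof. by rewrite !mxE. Qed.

Lemma adj1 n : (1%:M : 'M[C]_n)^t* = 1%:M.
Proof. by rewrite trmx1 map_mx1. Qed.

(* the rows of [U] are the eigenvectors *)
Definition specmx n (U : 'M[C]_n) (d : 'I_n -> C) : 'M[C]_n :=
  U^t* *m diag_mx (\row_i d i) *m U.

Lemma unitary_left n (U : 'M[C]_n) : U \is unitarymx -> U^t* *m U = 1%:M.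
Proof. by move=> hU; rewrite -invmx_unitary // mulVmx // unitarymx_unit. Qed.

Lemma unitary_right n (U : 'M[C]_n) : U \is unitarymx -> U *m U^t* = 1%:M.
Proof. by move/unitarymxP. Qed.

Lemma specmxE n (U : 'M[C]_n) d i j :
  specmx U d i j = \sum_a (U a i)^* * d a * U a j.
Proof.
rewrite /specmx mxE; apply: eq_bigr => a _; rewrite mul_mx_diag.
by rewrite mxE adjE mxE.
Qed.

Lemma specmxM n (U : 'M[C]_n) d e : U \is unitarymx ->
  specmx U d *m specmx U e = specmx U (fun i => d i * e i).
Proof.
move=> hU; rewrite /specmx !mulmxA -[_ *m U *m _]mulmxA (unitary_right hU) mulmx1.
rewrite -[_ *m diag_mx _ *m diag_mx _]mulmxA mulmx_diag.
set a := \row__ _; set b := \row__ _; suff -> : a = b by [].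
by apply/rowP => i; rewrite !mxE.
Qed.

Lemma specmxD n (U : 'M[C]_n) d e :
  specmx U d + specmx U e = specmx U (fun i => d i + e i).
Proof.
apply/matrixP => i j; rewrite [LHS]mxE (specmxE U d) (specmxE U e) specmxE -big_split.
by apply: eq_bigr => a _; rewrite mulrDr mulrDl.
Qed.

Lemma specmxZ n (U : 'M[C]_n) c d :
  c *: specmx U d = specmx U (fun i => c * d i).
Proof.
apply/matrixP => i j; rewrite [LHS]mxE (specmxE U d) specmxE mulr_sumr.
by apply: eq_bigr => a _; rewrite mulrA mulrCA mulrA.
Qed.

Lemma eq_specmx n (U : 'M[C]_n) d e : (forall i, d i = e i) ->
  specmx U d = specmx U e.
Proof.
move=> h; rewrite /specmx; have -> // : \row_i d i = \row_i e i.
by apply/rowP => i; rewrite !mxE h.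
Qed.

Lemma specmx_const n (U : 'M[C]_n) c : U \is unitarymx ->
  specmx U (fun _ => c) = c%:M.
Proof.
move=> hU; rewrite /specmx; have -> : \row__ c = const_mx c :> 'rV[C]_n.
  by apply/rowP => i; rewrite !mxE.
by rewrite diag_const_mx mul_mx_scalar -scalemxAl unitary_left // scalemx1.
Qed.

Lemma adj_specmx n (U : 'M[C]_n) d : (specmx U d)^t* = specmx U (fun i => (d i)^*).
Proof.
rewrite /specmx !adjM trmxCK mulmxA; congr (_ *m _ *m _).
by apply/matrixP => i j; rewrite !mxE rmorphMn eq_sym; case: eqP => [->|].
Qed.

Lemma tr_specmx n (U : 'M[C]_n) d : U \is unitarymx -> \tr (specmx U d) = \sum_i d i.
Proof.
move=> hU; rewrite /specmx mxtrace_mulC mulmxA unitary_right // mul1mx mxtrace_diag.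
by apply: eq_bigr => i _; rewrite mxE.
Qed.

Lemma specmx_sum n (U : 'M[C]_n) d :
  specmx U d = \sum_i d i *: ((row i U)^t* *m row i U).
Proof.
apply/matrixP => i j; rewrite specmxE summxE; apply: eq_bigr => a _.
rewrite !mxE big_ord_recl big_ord0 addr0 !mxE; ring.
Qed.

(* the functional calculus does not depend on the chosen diagonalisation *)
Lemma specmx_unique n (U V : 'M[C]_n) d e (h : C -> C) :
  U \is unitarymx -> V \is unitarymx -> specmx U d = specmx V e ->
  specmx U (h \o d) = specmx V (h \o e).
Proof.
move=> hU hV eUV; pose W := U *m V^t*.
have dW : forall f g, (forall i j, f i * W i j = W i j * g j) ->
    specmx U f = specmx V g.
  move=> f g hfg.
  have : diag_mx (\row_i f i) *m W = W *m diag_mx (\row_i g i).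
    apply/matrixP => i j; rewrite mul_diag_mx mul_mx_diag !mxE.
    by have := hfg i j; rewrite /W !mxE.
  rewrite /W => E; rewrite /specmx.
  have -> : diag_mx (\row_i f i) = U *m V^t* *m diag_mx (\row_i g i) *m V *m U^t*.
    by rewrite -E -!mulmxA (mulmxA (V^t*)) (unitary_left hV) mul1mx (unitary_right hU) mulmx1.
  by rewrite !mulmxA (unitary_left hU) mul1mx -!mulmxA (unitary_left hU) mulmx1.
apply: dW => i j /=.
have E : diag_mx (\row_i d i) *m W = W *m diag_mx (\row_i e i).
  have := congr1 (fun X => U *m X *m V^t*) eUV.
  rewrite /specmx /W !mulmxA (unitary_right hU) mul1mx => ->.
  by rewrite -!mulmxA (unitary_right hV) mulmx1.
have /matrixP/(_ i j) := E; rewrite mul_diag_mx mul_mx_diag !mxE.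
rewrite -/(W i j); have -> : \sum_k U i k * V^t* k j = W i j by rewrite /W mxE.
have [->|W0] := eqVneq (W i j) 0; first by rewrite !(mul0r, mulr0).
by rewrite [RHS]mulrC => /(mulIf W0) ->; rewrite mulrC.
Qed.

Lemma normal_spec n (A : 'M[C]_n) : A \is normalmx ->
  A = specmx (spectralmx A) (fun i => spectral_diag A 0 i).
Proof.
move=> /orthomx_spectralP E; rewrite /specmx -(invmx_unitary (spectral_unitarymx A)).
rewrite [LHS]E; set d := spectral_diag A.
by have -> : \row_i d 0 i = d by apply/rowP => i; rewrite mxE.
Qed.

Lemma mxfunE (h : R -> R) n (A : 'M[C]_n) :
  mxfun h A = specmx (spectralmx A) (fun i => (h (Re (spectral_diag A 0 i)))%:C).
Proof.
rewrite /mxfun /specmx (invmx_unitary (spectral_unitarymx A)).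
set d := spectral_diag A; set e := map_mx _ d; set e' := \row__ _.
by have -> : e = e' by apply/rowP => i; rewrite !mxE.
Qed.

Lemma specmx_normal n (U : 'M[C]_n) d : U \is unitarymx -> specmx U d \is normalmx.
Proof.
move=> hU; apply/normalmxP; rewrite adj_specmx !(specmxM _ _ hU).
by apply: eq_specmx => i; rewrite mulrC.
Qed.

Lemma mxfun_specmx (h : R -> R) n (U : 'M[C]_n) (d : 'I_n -> R) :
  U \is unitarymx ->
  mxfun h (specmx U (fun i => (d i)%:C)) = specmx U (fun i => (h (d i))%:C).
Proof.
move=> hU; rewrite mxfunE; set A := specmx U _.
have E := normal_spec (specmx_normal (fun i => (d i)%:C) hU).
exact/esym/(specmx_unique (fun z => (h (Re z))%:C) hU (spectral_unitarymx A) E).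
Qed.

(** The complex value is kept because the extended matrices on the unit circle are not Hermitian:
    their numerical ranges lie in cones of the plane. *)
Definition hf n (A : 'M[C]_n) (v : 'rV[C]_n) : C := (v *m A *m v^t*) 0 0.
Definition qf n (A : 'M[C]_n) (v : 'rV[C]_n) : R := Re (hf A v).
Definition sqnorm n (v : 'rV[C]_n) : R := \sum_i normc (v 0 i) ^+ 2.

Lemma hfD n (A B : 'M[C]_n) v : hf (A + B) v = hf A v + hf B v.
Proof. by rewrite /hf mulmxDr mulmxDl mxE. Qed.

Lemma hfN n (A : 'M[C]_n) v : hf (- A) v = - hf A v.
Proof. by rewrite /hf mulmxN mulNmx mxE. Qed.

Lemma hfZ n a (A : 'M[C]_n) v : hf (a *: A) v = a * hf A v.
Proof. by rewrite /hf -scalemxAr -scalemxAl mxE. Qed.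

Lemma hf_sum n (I : Type) (r : seq I) (P : pred I) (F : I -> 'M[C]_n) v :
  hf (\sum_(i <- r | P i) F i) v = \sum_(i <- r | P i) hf (F i) v.
Proof.
apply: (big_morph (fun A => hf A v)) => [A B|]; first exact: hfD.
by rewrite /hf mulmx0 mul0mx mxE.
Qed.

Lemma qfD n (A B : 'M[C]_n) v : qf (A + B) v = qf A v + qf B v.
Proof. by rewrite /qf hfD ReD. Qed.

Lemma qfN n (A : 'M[C]_n) v : qf (- A) v = - qf A v.
Proof. by rewrite /qf hfN ReN. Qed.

Lemma qfB n (A B : 'M[C]_n) v : qf (A - B) v = qf A v - qf B v.
Proof. by rewrite qfD qfN. Qed.

Lemma qfZ n (a : R) (A : 'M[C]_n) v : qf (a%:C *: A) v = a * qf A v.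
Proof. by rewrite /qf hfZ ReZ. Qed.

Lemma hf_adj n (A : 'M[C]_n) v : hf (A^t*) v = (hf A v)^*.
Proof.
by rewrite /hf -[in RHS]adjE !adjM trmxCK mulmxA.
Qed.

Lemma hf_congr k l (J : 'M[C]_(k, l)) A v : hf (J *m A *m J^t*) v = hf A (v *m J).
Proof. by rewrite /hf adjM !mulmxA. Qed.

Lemma hf1 n v : hf (1%:M : 'M[C]_n) v = (sqnorm v)%:C.
Proof.
rewrite /hf mulmx1 mxE /sqnorm rmorph_sum; apply: eq_bigr => i _.
by rewrite adjE mulcJ.
Qed.

Lemma qf1 n v : qf (1%:M : 'M[C]_n) v = sqnorm v.
Proof. by rewrite /qf hf1. Qed.

Lemma sqnorm_ge0 n (v : 'rV[C]_n) : 0 <= sqnorm v.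
Proof. by apply: sumr_ge0 => i _; apply: sqr_ge0. Qed.

Lemma sqnorm_eq0 n (v : 'rV[C]_n) : (sqnorm v == 0) = (v == 0).
Proof.
apply/idP/eqP => [|->]; last first.
  by rewrite /sqnorm big1 // => i _; rewrite mxE normc0 expr0n.
rewrite /sqnorm psumr_eq0 => [/allP h|i _]; last exact: sqr_ge0.
apply/rowP => i; rewrite mxE; apply: eq0_normc; apply/eqP.
by have := h i (mem_index_enum _); rewrite sqrf_eq0.
Qed.

Lemma sqnorm_gt0 n (v : 'rV[C]_n) : (0 < sqnorm v) = (v != 0).
Proof. by rewrite lt0r sqnorm_eq0 sqnorm_ge0 andbT. Qed.

Lemma sqnorm_unitary n (U : 'M[C]_n) v : U \is unitarymx -> sqnorm (v *m U^t*) = sqnorm v.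
Proof.
move=> hU; rewrite -!qf1 /qf -hf_congr mulmx1 trmxCK unitary_left //.
Qed.

Lemma hf_specmx n (U : 'M[C]_n) d v :
  hf (specmx U d) v = \sum_i d i * (normc ((v *m U^t*) 0 i) ^+ 2)%:C.
Proof.
rewrite /specmx -{2}[U]trmxCK hf_congr /hf mxE; apply: eq_bigr => i _.
set w := v *m _; rewrite mul_mx_diag mxE adjE mulrAC mulcJ mulrC; congr (_ * _).
by rewrite mxE.
Qed.

Lemma qf_specmx n (U : 'M[C]_n) (d : 'I_n -> R) v :
  qf (specmx U (fun i => (d i)%:C)) v = \sum_i d i * normc ((v *m U^t*) 0 i) ^+ 2.
Proof. by rewrite /qf hf_specmx Re_sum; apply: eq_bigr => i _; rewrite ReZ. Qed.

Lemma hf_herm n (A : 'M[C]_n) v : hermitian_mx A -> hf A v = (qf A v)%:C.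
Proof.
move=> hA; have := hf_adj A v; rewrite hA /qf.
by case: (hf A v) => a b [] /= /eqP; rewrite -addr_eq0 -mulr2n mulrn_eq0 => /eqP ->.
Qed.

Lemma psdmxP n (A : 'M[C]_n) :
  psdmx A <-> hermitian_mx A /\ forall v, 0 <= qf A v.
Proof.
by split=> -[hA h]; split=> // v; have := h v; rewrite -/(hf A v) (hf_herm _ hA) ler0c.
Qed.

Lemma pdmxP n (A : 'M[C]_n) :
  pdmx A <-> hermitian_mx A /\ forall v, v != 0 -> 0 < qf A v.
Proof.
by split=> -[hA h]; split=> // v v0; have := h v v0;
  rewrite -/(hf A v) (hf_herm _ hA) (ltcR 0).
Qed.

Lemma hermD n (A B : 'M[C]_n) : hermitian_mx A -> hermitian_mx B -> hermitian_mx (A + B).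
Proof. by rewrite /hermitian_mx adjD => -> ->. Qed.

Lemma hermZ n (a : R) (A : 'M[C]_n) : hermitian_mx A -> hermitian_mx (a%:C *: A).
Proof. by rewrite /hermitian_mx adjZ => ->; rewrite conjcR. Qed.

Lemma herm_congr k l (J : 'M[C]_(k, l)) A :
  hermitian_mx A -> hermitian_mx (J *m A *m J^t*).
Proof. by rewrite /hermitian_mx !adjM trmxCK mulmxA => ->. Qed.

Lemma herm1 n : hermitian_mx (1%:M : 'M[C]_n).
Proof. exact: adj1. Qed.

Lemma herm_specmx n (U : 'M[C]_n) (d : 'I_n -> R) :
  hermitian_mx (specmx U (fun i => (d i)%:C)).
Proof.
by rewrite /hermitian_mx adj_specmx; apply: eq_specmx => i; exact: conjcR.
Qed.

Lemma herm_spec n (A : 'M[C]_n) : hermitian_mx A ->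
  exists U (d : 'I_n -> R), U \is unitarymx /\ A = specmx U (fun i => (d i)%:C).
Proof.
move=> hA; have hn : A \is hermsymmx.
  by apply/is_hermitianmxP; rewrite expr0 scale1r hA.
exists (spectralmx A), (fun i => Re (spectral_diag A 0 i)).
split; first exact: spectral_unitarymx.
rewrite {1}(normal_spec (hermitian_normalmx hn)); apply: eq_specmx => i.
by rewrite RRe_real //; apply/mxOverP/hermitian_spectral_diag_real.
Qed.

Lemma pd_psd n (A : 'M[C]_n) : pdmx A -> psdmx A.
Proof.
move=> /pdmxP[hA h]; apply/psdmxP; split=> // v.
have [->|v0] := eqVneq v 0; last exact/ltW/h.
by rewrite /qf /hf !mul0mx mxE.
Qed.

Lemma row_unitary_neq0 n (U : 'M[C]_n) i : U \is unitarymx -> row i U != 0.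
Proof.
move=> hU; apply/eqP => /(congr1 (fun v => v *m U^t*)).
rewrite -row_mul unitary_right // mul0mx => /rowP/(_ i).
by rewrite !mxE eqxx => /eqP; rewrite oner_eq0.
Qed.

Lemma qf_row_specmx n (U : 'M[C]_n) (d : 'I_n -> R) i : U \is unitarymx ->
  qf (specmx U (fun i => (d i)%:C)) (row i U) = d i.
Proof.
move=> hU; rewrite qf_specmx -row_mul unitary_right // (bigD1 i) //=.
rewrite big1 => [|j ji]; rewrite !mxE.
  by rewrite eqxx normc1 expr1n mulr1 addr0.
by rewrite eq_sym (negPf ji) normc0 expr0n mulr0.
Qed.

Lemma sqnorm_row_unitary n (U : 'M[C]_n) i : U \is unitarymx -> sqnorm (row i U) = 1.
Proof.
move=> hU; rewrite -qf1 -(qf_row_specmx (fun _ => 1) i hU).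
by rewrite specmx_const.
Qed.

Lemma pd_specmx n (U : 'M[C]_n) (d : 'I_n -> R) : U \is unitarymx ->
  (forall i, 0 < d i) -> pdmx (specmx U (fun i => (d i)%:C)).
Proof.
move=> hU d0; apply/pdmxP; split=> [|v v0]; first exact: herm_specmx.
have : 0 < sqnorm (v *m U^t*) by rewrite sqnorm_unitary // sqnorm_gt0.
rewrite qf_specmx lt0r => /andP[h _]; rewrite lt0r; apply/andP; split; last first.
  by apply: sumr_ge0 => i _; rewrite mulr_ge0 ?sqr_ge0 // ltW.
apply: contra h; rewrite /sqnorm !psumr_eq0 => [|i _|i _]; rewrite ?sqr_ge0 //.
  by move=> /allP h; apply/allP => i hi; have := h i hi;
     rewrite mulf_eq0 gt_eqF.
by rewrite mulr_ge0 ?sqr_ge0 // ltW.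
Qed.

Lemma psd_specmx n (U : 'M[C]_n) (d : 'I_n -> R) :
  (forall i, 0 <= d i) -> psdmx (specmx U (fun i => (d i)%:C)).
Proof.
move=> d0; apply/psdmxP; split=> [|v]; first exact: herm_specmx.
by rewrite qf_specmx; apply: sumr_ge0 => i _; rewrite mulr_ge0 ?sqr_ge0.
Qed.

Lemma pd_spec n (A : 'M[C]_n) : pdmx A -> exists U (d : 'I_n -> R),
  [/\ U \is unitarymx, A = specmx U (fun i => (d i)%:C) & forall i, 0 < d i].
Proof.
move=> /pdmxP[hA h]; have [U [d [hU EA]]] := herm_spec hA.
exists U, d; split=> // i; rewrite -(qf_row_specmx d i hU) -EA; apply: h.
exact: row_unitary_neq0.
Qed.

Lemma ord_min_gt0 n (d : 'I_n -> R) : (forall i, 0 < d i) ->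
  exists2 m, 0 < m & forall i, m <= d i.
Proof.
move=> d0; exists (\big[Num.min/1]_i d i).
  by elim/big_ind: _ => // x y hx hy; rewrite lt_min hx.
by move=> i; apply: bigmin_le_cond.
Qed.

Lemma pd_lower n (A : 'M[C]_n) : pdmx A ->
  exists2 m, 0 < m & forall v, m * sqnorm v <= qf A v.
Proof.
move=> /pd_spec[U [d [hU -> d0]]]; have [m m0 hm] := ord_min_gt0 d0.
exists m => // v; rewrite qf_specmx -(sqnorm_unitary v hU) /sqnorm mulr_sumr.
by apply: ler_sum => i _; rewrite ler_wpM2r ?sqr_ge0.
Qed.

Lemma herm_upper n (A : 'M[C]_n) : hermitian_mx A ->
  exists2 m, 0 < m & forall v, `|qf A v| <= m * sqnorm v.
Proof.
move=> /herm_spec[U [d [hU ->]]]; exists (1 + \sum_i `|d i|).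
  by rewrite ltr_pwDl // sumr_ge0.
move=> v; rewrite qf_specmx -(sqnorm_unitary v hU) /sqnorm mulr_sumr.
apply: (le_trans (ler_norm_sum _ _ _)); apply: ler_sum => i _.
rewrite normrM [`|_ ^+ 2|]ger0_norm ?sqr_ge0 // ler_wpM2r ?sqr_ge0 //.
by rewrite (bigD1 i) //= addrCA lerDl addr_ge0 // sumr_ge0.
Qed.

End MatrixBasics.

(** * Inverse square roots in a uniformly closed algebra of functions *)

Section UniformAlgebra.
Variable R : realType.
Local Notation C := R[i].
Local Notation Re := (@complex.Re R).

Lemma exists_half_pow (e : R) : 0 < e -> exists n, 2^-1 ^+ n <= e.
Proof.
move=> e0; exists (Num.truncn e^-1).+1.
have h : e^-1 < (Num.truncn e^-1).+1%:R by rewrite truncnS_gt.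
have := ltn_expl (Num.truncn e^-1).+1 (isT : (1 < 2)%N).
rewrite -(ltr_nat R) natrX => h2; rewrite exprVn invf_ple ?posrE //; last first.
  by rewrite exprn_gt0.
exact: ltW (lt_trans h h2).
Qed.

Lemma exists_div_le (b e : R) : 0 < e -> exists2 N, (0 < N)%N & b / N%:R <= e.
Proof.
move=> e0; exists (Num.truncn (`|b| / e)).+1 => //.
have h : `|b| / e < (Num.truncn (`|b| / e)).+1%:R by rewrite truncnS_gt.
rewrite ler_pdivrMr ?ltr0n // mulrC -ler_pdivrMr //.
rewrite (le_trans _ (ltW h)) // ler_pM2r ?invr_gt0 // ler_norm //.
Qed.

Variables (T : Type) (K : T -> Prop).

(** Instantiated twice: by the uniform limits of polynomials, and by the scalar functions whose
    functional calculus along the matrix family is such a limit. By the last clause membership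
    depends only on the values on [K]. *)
Record uniform_algebra (S : (T -> C) -> Prop) : Prop := UniformAlgebra {
  ua_const : forall c, S (fun _ => c);
  ua_add : forall f g, S f -> S g -> S (fun t => f t + g t);
  ua_mul : forall f g, S f -> S g -> S (fun t => f t * g t);
  ua_lim : forall f, (forall e : R, 0 < e ->
    exists2 g, S g & forall t, K t -> normc (f t - g t) <= e) -> S f }.

Variable S : (T -> C) -> Prop.
Hypothesis SA : uniform_algebra S.

Lemma ua_ext f g : S f -> (forall t, K t -> f t = g t) -> S g.
Proof.
move=> Sf fg; apply: (ua_lim SA) => e e0; exists f => // t Kt.
by rewrite fg // subrr normc0 ltW.
Qed.

Lemma ua_scale c f : S f -> S (fun t => c * f t).
Proof. exact/(ua_mul SA)/(ua_const SA). Qed.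

Lemma ua_exp f n : S f -> S (fun t => f t ^+ n).
Proof.
move=> Sf; elim: n => [|n IH]; first exact: (ua_const SA).
by apply: (ua_ext (ua_mul SA Sf IH)) => t _; rewrite exprS.
Qed.

Lemma normc_sub_sqr (x y : C) : normc (x - y) * normc (x + y) = normc (x ^+ 2 - y ^+ 2).
Proof. by rewrite -normcM -subr_sqr. Qed.

Lemma normcBC (x y : C) : normc (x - y) = normc (y - x).
Proof. by rewrite -normcN' opprB. Qed.

Lemma normc_nat n : normc (n%:R : C) = n%:R.
Proof. by rewrite -(rmorph_nat (real_complex R)) normcR normr_nat. Qed.

Lemma normcX2 (x : C) : normc (x ^+ 2) = normc x ^+ 2.
Proof. by rewrite expr2 normcM -expr2. Qed.

Lemma Re_ge_sub (x y : C) : Re x - normc (x - y) <= Re y.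
Proof. by rewrite lerBlDl -lerBlDr -ReB Re_le_normc. Qed.

Lemma normc_ge_sub (x y : C) : normc x - normc (x - y) <= normc y.
Proof. by rewrite lerBlDl -{1}(subrK y x) ler_normcD. Qed.

(* one step of [u <- u (3 - (1 + eta) u^2) / 2]; the defect [1 - (1 + eta) u^2] is squared *)
Definition isqrt_step (eta u : C) : C := u * (1 + (1 - (1 + eta) * u ^+ 2) / 2).

Lemma isqrt_iter (eta h : C) n :
  normc eta <= 8^-1 -> h ^+ 2 * (1 + eta) = 1 -> 0 < Re h ->
  normc (iter n (isqrt_step eta) 1 - h) <= 2^-1 ^+ n.
Proof.
move=> heta hh h0; set x := 1 + eta.
have nx : 7 / 8 <= normc x.
  have := normc_ge_sub 1 x; rewrite normc1 /x opprD addrA subrr add0r normcN'; lra.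
have nh2 : normc h ^+ 2 * normc x = 1 by rewrite -normcX2 -normcM hh normc1.
have nh : normc h ^+ 2 <= 8 / 7 by have := sqr_ge0 (normc h); nra.
have n1h : normc (1 - h) <= 7^-1.
  have E : normc (1 - h) * normc (1 + h) = normc eta * normc h ^+ 2.
    rewrite normc_sub_sqr -normcX2 -normcM; congr normc.
    by rewrite expr1n -{1}hh /x; ring.
  have h1 : 1 <= normc (1 + h).
    by apply: le_trans (Re_le_normc _); rewrite ReD /=; lra.
  have := normc_ge0 (1 - h); have := normc_ge0 eta; nra.
have Reh : 6 / 7 <= Re h by have := Re_ge_sub 1 h; rewrite /=; lra.
have nh1 : normc h <= 8 / 7.
  have := normc_ge_sub h 1; rewrite normcBC normc1; lra.
(* A small defect does not tell [h] from [- h]. The a priori bound [2^-1] does: it forces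
   [|u + h| >= 1], so the defect controls [|u - h|]. *)
have key u : normc (u - h) <= 2^-1 -> normc (u - h) <= 8 / 7 * normc (1 - x * u ^+ 2).
  move=> uh; have E : normc (u - h) * normc (u + h) = normc (1 - x * u ^+ 2) * normc h ^+ 2.
    rewrite normc_sub_sqr -normcX2 -normcM -normcN'; congr normc.
    have hh' : h ^+ 2 * x = 1 by [].
    have -> : u ^+ 2 - h ^+ 2 = u ^+ 2 * (h ^+ 2 * x) - h ^+ 2 by rewrite hh' mulr1.
    by ring.
  have h1 : 1 <= normc (u + h).
    apply: le_trans (Re_le_normc _); rewrite ReD.
    have := Re_ge_sub h u; rewrite normcBC; lra.
  have := normc_ge0 (u - h); have := normc_ge0 (1 - x * u ^+ 2); nra.
have inv : forall n, normc (iter n (isqrt_step eta) 1 - h) <= 2^-1 /\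
    normc (1 - x * (iter n (isqrt_step eta) 1) ^+ 2) <= 8^-1 * 2^-1 ^+ n.
  elim=> [|m [IH1 IH2]].
    rewrite /= expr1n mulr1 /x opprD addrA subrr add0r normcN' expr0 mulr1; split=> //.
    by apply: le_trans n1h _; lra.
  rewrite iterS; set u := iter m _ 1 in IH1 IH2 *; set e := 1 - x * u ^+ 2 in IH2.
  have p1 : 0 <= 2^-1 ^+ m :> R by rewrite exprn_ge0 ?invr_ge0.
  have p2 : 2^-1 ^+ m <= 1 :> R by rewrite exprn_ile1 //; lra.
  have e8 : normc e <= 8^-1 by lra.
  have nu := key u IH1; rewrite -/e in nu.
  have ne0 := normc_ge0 e.
  have e2 : normc (e / 2) = normc e / 2.
    by rewrite normcM normcV normc_nat.
  split.
    have -> : isqrt_step eta u - h = (u - h) + u * (e / 2).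
      by rewrite /isqrt_step -/x -/e; ring.
    apply: le_trans (ler_normcD _ _) _; rewrite normcM e2.
    have nu2 : normc u <= 3 / 2.
      by have := normc_ge_sub u h; lra.
    by have := normc_ge0 u; nra.
  have -> : 1 - x * isqrt_step eta u ^+ 2 = e * (e / 2) * (3 / 2 + e / 2).
    have E : x * u ^+ 2 = 1 - e by rewrite /e opprB addrC subrK.
    rewrite /isqrt_step -/x -/e.
    have -> : x * (u * (1 + e / 2)) ^+ 2 = x * u ^+ 2 * (1 + e / 2) ^+ 2 by ring.
    by rewrite E; field.
  rewrite !normcM exprS; have E3 : normc (3 / 2 + e / 2) <= 3 / 2 + normc e / 2.
    apply: le_trans (ler_normcD _ _) _; rewrite e2 lerD2r.
    by rewrite normcM normcV !normc_nat.
  rewrite normcV normc_nat; have w0 := normc_ge0 (3 / 2 + e / 2).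
  have w1 : normc e * (normc e * 2^-1) <= 2^-1 ^+ m * 128^-1 by nra.
  have w2 : 0 <= normc e * (normc e * 2^-1) by nra.
  have w3 : normc (3 / 2 + e / 2) <= 2 by lra.
  by nra.
have [i1 i2] := inv n; apply: le_trans (key _ i1) _.
have p1 : 0 <= 2^-1 ^+ n :> R by rewrite exprn_ge0 ?invr_ge0.
lra.
Qed.

Lemma ua_isqrt_near1 eta h : S eta ->
  (forall t, K t -> normc (eta t) <= 8^-1) ->
  (forall t, K t -> h t ^+ 2 * (1 + eta t) = 1 /\ 0 < Re (h t)) -> S h.
Proof.
move=> Seta heta hh; apply: (ua_lim SA) => e e0; have [n hn] := exists_half_pow e0.
exists (fun t => iter n (isqrt_step (eta t)) 1).
  elim: n {hn} => [|n IH]; first exact: (ua_const SA).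
  rewrite /=; apply: (ua_mul SA IH); apply: (ua_add SA (ua_const SA _)).
  apply: (ua_mul SA _ (ua_const SA _)); apply: (ua_add SA (ua_const SA _)).
  have := ua_scale (-1) (ua_mul SA (ua_add SA (ua_const SA 1) Seta) (ua_exp 2 IH)).
  by move=> h1; apply: (ua_ext h1) => t _; rewrite mulN1r.
move=> t Kt; have [h1 h2] := hh t Kt.
by rewrite normcBC (le_trans (isqrt_iter n (heta t Kt) h1 h2)).
Qed.

(** [normc x + Re x] is positive exactly off the closed negative half-line, and from here on it
    measures how far a point stays from that slit. *)
Lemma Re_sqrtc (x : C) : 0 <= Re (sqrtc x) /\ Re (sqrtc x) ^+ 2 = (normc x + Re x) / 2.
Proof.
case: x => a b; split; first exact: sqrtr_ge0.
rewrite /= sqr_sqrtr // divr_ge0 //.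
have := Re_le_normc (- a +i* b); rewrite /= sqrrN; lra.
Qed.

Lemma Re_inv_gt0 (x : C) : 0 < Re x -> 0 < Re (x^-1).
Proof.
case: x => a b /= a0; rewrite divr_gt0 //.
by rewrite ltr_pwDl ?sqr_ge0 ?exprn_gt0.
Qed.

Lemma isqrt_unique (x h k : C) : h ^+ 2 * x = 1 -> k ^+ 2 * x = 1 ->
  0 < Re h -> 0 < Re k -> h = k.
Proof.
move=> hx kx h0 k0.
have x0 : x != 0 by apply: contra_eq_neq hx => ->; rewrite mulr0 eq_sym oner_eq0.
have /eqP : h ^+ 2 = k ^+ 2 by apply: (mulIf x0); rewrite hx kx.
rewrite eqf_sqr => /orP[/eqP //|/eqP E].
by move: h0; rewrite E ReN oppr_gt0 => /(lt_trans k0); rewrite ltxx.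
Qed.

(* analytic continuation of the inverse square root along the segment from [e0] to [phi t] *)
Lemma ua_isqrt phi h (e0 c b : R) : S phi -> 0 < c ->
  (forall t, K t -> normc (phi t - e0%:C) <= b) ->
  (forall t s, K t -> 0 <= s <= 1 ->
     let x := s%:C * (phi t - e0%:C) + e0%:C in c <= normc x + Re x) ->
  (forall t, K t -> h t ^+ 2 * phi t = 1 /\ 0 < Re (h t)) -> S h.
Proof.
move=> Sphi c0 hb hc hh.
(* Every [y j t] satisfies [|y j t|^2 >= c / 2], so increments of size at most [c / 16] have
   relative size at most [8^-1], the range of [ua_isqrt_near1]. *)
have [N N0 hN] := exists_div_le b (divr_gt0 c0 (ltr0n R 16)).
pose sg (j : nat) : R := j%:R / N%:R.
pose ph j t := (sg j)%:C * (phi t - e0%:C) + e0%:C.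
pose y j t := sqrtc (ph j t).
have s01 j : (j <= N)%N -> 0 <= sg j <= 1.
  move=> jN; apply/andP; split; first exact: divr_ge0.
  by rewrite ler_pdivrMr ?ltr0n // mul1r ler_nat.
have Rey j t : (j <= N)%N -> K t -> 0 < Re (y j t) /\ c / 2 <= Re (y j t) ^+ 2.
  move=> jN Kt; have [h1 h2] := Re_sqrtc (ph j t).
  have h3 : c <= normc (ph j t) + Re (ph j t) := hc t _ Kt (s01 j jN).
  rewrite /y h2; split; last lra.
  by rewrite lt0r h1 andbT; apply: contraTneq h3 => E; move: h2; rewrite E expr0n /=; lra.
have y2 j t : y j t ^+ 2 = ph j t by rewrite sqr_sqrtc.
have y0 j t : (j <= N)%N -> K t -> y j t != 0.
  by move=> jN Kt; have [h1 _] := Rey j t jN Kt; apply: contraTneq h1 => ->; rewrite ltxx.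
have Sy j : (j <= N)%N -> S (fun t => (y j t)^-1).
  elim: j => [_|j IH jN].
    apply: (ua_ext (ua_const SA (sqrtc e0%:C)^-1)) => t _.
    by rewrite /y /ph /sg mul0r mul0r add0r.
  have {}IH := IH (ltnW jN).
  pose de t := (phi t - e0%:C) * (N%:R^-1)%:C.
  have phS t : ph j.+1 t = ph j t + de t.
    by rewrite /ph /de /sg -[j.+1]addn1 natrD mulrDl rmorphD /= mul1r; ring.
  have nde t : K t -> normc (de t) <= c / 16.
    move=> Kt; rewrite normcM normcR ger0_norm ?invr_ge0 //.
    by rewrite (le_trans _ hN) // ler_wpM2r ?invr_ge0 // hb.
  pose eta t := de t * (y j t)^-1 ^+ 2.
  have Sde : S de.
    apply: (ua_mul SA _ (ua_const SA _)).
    by apply: (ua_ext (ua_add SA Sphi (ua_const SA (- e0%:C)))).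
  have Seta : S eta by apply: (ua_mul SA Sde); exact: ua_exp.
  have ny t i : (i <= N)%N -> K t -> c / 2 <= normc (y i t) ^+ 2.
    move=> iN Kt; have [h1 h2] := Rey i t iN Kt; apply: le_trans h2 _.
    by rewrite normcE2 lerDl sqr_ge0.
  have heta t : K t -> normc (eta t) <= 8^-1.
    move=> Kt; rewrite normcM normcX2 normcV exprVn.
    rewrite ler_pdivrMr ?exprn_gt0 //; last first.
      rewrite lt0r normc_ge0 andbT; apply/eqP => /eq0_normc E.
      by have := y0 j t (ltnW jN) Kt; rewrite E eqxx.
    have := ny t j (ltnW jN) Kt; have := nde t Kt; lra.
  have Sk : S (fun t => y j t / y j.+1 t).
    apply: (ua_isqrt_near1 Seta heta) => t Kt.
    have yj := y0 j t (ltnW jN) Kt; have yj1 := y0 j.+1 t jN Kt; split.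
      have -> : 1 + eta t = y j.+1 t ^+ 2 / y j t ^+ 2.
        rewrite /eta y2 phS y2 exprVn y2 mulrDl divff //.
        by rewrite -y2 expf_neq0.
      by field; rewrite yj yj1.
    have [r1 r2] := Rey j t (ltnW jN) Kt; have [r3 r4] := Rey j.+1 t jN Kt.
    have E : normc (y j.+1 t - y j t) * normc (y j.+1 t + y j t) = normc (de t).
      by rewrite normc_sub_sqr !y2 phS addrAC subrr add0r.
    have E2 : Re (y j.+1 t) + Re (y j t) <= normc (y j.+1 t + y j t).
      by rewrite -ReD Re_le_normc.
    have n1 := normc_ge0 (y j.+1 t - y j t).
    (* Consecutive roots are close compared with the real part of either; hence their quotient has
       positive real part and is the principal branch. *)
    have le1 : normc (y j.+1 t - y j t) < Re (y j.+1 t).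
      rewrite ltNge; apply/negP => h1; have := nde t Kt; rewrite -E.
      nra.
    have -> : y j t / y j.+1 t = 1 - (y j.+1 t - y j t) / y j.+1 t by field.
    rewrite ReB /= subr_gt0 (le_lt_trans (Re_le_normc _)) // normcM normcV.
    rewrite ltr_pdivrMr ?mul1r; first exact: lt_le_trans le1 (Re_le_normc _).
    exact: lt_le_trans r3 (Re_le_normc _).
  apply: (ua_ext (ua_mul SA IH Sk)) => t Kt.
  by rewrite mulrA mulVf ?mul1r // y0 // ltnW.
apply: (ua_ext (Sy N (leqnn N))) => t Kt; have [h1 h2] := hh t Kt.
have phN : ph N t = phi t.
  by rewrite /ph /sg divff ?pnatr_eq0 -?lt0n // mul1r subrK.
apply: (isqrt_unique _ h1 _ h2).
  by rewrite exprVn y2 phN mulVf // -phN -y2 expf_neq0 // y0.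
by apply: Re_inv_gt0; have [] := Rey N t (leqnn N) Kt.
Qed.

End UniformAlgebra.

(** * Uniform limits of polynomials on the circle and its real diameter *)

Section DiscAlgebra.
Variable R : realType.
Local Notation C := R[i].
Local Notation Re := (@complex.Re R).
Local Notation Im := (@complex.Im R).

(** The circle carries the boundary sign condition, the diameter the values to be compared.
    Approximating on both at once makes a maximum principle unnecessary. *)
Definition circle_diam (z : C) : Prop := normc z = 1 \/ (Im z = 0 /\ normc z <= 1).

Definition poly_approx (f : C -> C) : Prop := forall e : R, 0 < e ->
  exists P : {poly C}, forall z, circle_diam z -> normc (f z - P.[z]) <= e.

Lemma circle_diam_le1 z : circle_diam z -> normc z <= 1.
Proof. by case=> [->|[]]. Qed.

Lemma normcX (x : C) n : normc (x ^+ n) = normc x ^+ n.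
Proof. by elim: n => [|n IH]; rewrite ?normc1 // !exprS normcM IH. Qed.

Lemma poly_bounded (P : {poly C}) : exists2 B, 0 < B &
  forall z, circle_diam z -> normc P.[z] <= B.
Proof.
exists (1 + \sum_(i < size P) normc P`_i).
  by rewrite ltr_pwDl // sumr_ge0 // => i _; exact: normc_ge0.
move=> z Ez; rewrite horner_coef (le_trans (ler_normc_sum _ _ _)) //.
rewrite (@le_trans _ _ (\sum_(i < size P) normc P`_i)) ?lerDr //.
apply: ler_sum => i _; rewrite normcM normcX ler_piMr ?normc_ge0 //.
by rewrite exprn_ile1 ?normc_ge0 // circle_diam_le1.
Qed.

Lemma poly_approx_bounded f : poly_approx f -> exists2 B, 0 < B &
  forall z, circle_diam z -> normc (f z) <= B.
Proof.
move=> /(_ 1 ltr01)[P hP]; have [B B0 hB] := poly_bounded P.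
exists (1 + B) => [|z Ez]; first by rewrite addr_gt0.
by have := normc_ge_sub (f z) P.[z]; have := hP z Ez; have := hB z Ez; lra.
Qed.

Lemma poly_approx_poly (P : {poly C}) : poly_approx (fun z => P.[z]).
Proof. by move=> e e0; exists P => z _; rewrite subrr normc0 ltW. Qed.

Lemma poly_approx_ua : uniform_algebra circle_diam poly_approx.
Proof.
split.
- by move=> c e e0; exists c%:P => z _; rewrite hornerC subrr normc0 ltW.
- move=> f g hf hg e e0; have e2 : 0 < e / 2 by rewrite divr_gt0.
  have [P hP] := hf _ e2; have [Q hQ] := hg _ e2; exists (P + Q) => z Ez.
  rewrite hornerD opprD addrACA (le_trans (ler_normcD _ _)) //.
  by have := hP z Ez; have := hQ z Ez; lra.
- move=> f g hf hg e e0.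
  have [F F0 hF] := poly_approx_bounded hf; have [G G0 hG] := poly_approx_bounded hg.
  have e2 : 0 < Num.min 1 (e / (F + G + 1)).
    by rewrite lt_min ltr01 divr_gt0 //; lra.
  have [P hP] := hf _ e2; have [Q hQ] := hg _ e2; exists (P * Q) => z Ez.
  have := hP z Ez; have := hQ z Ez; rewrite !le_min => /andP[q1 q2] /andP[p1 p2].
  have FG0 : 0 < F + G + 1 by lra.
  rewrite ler_pdivlMr // in p2; rewrite ler_pdivlMr // in q2.
  have -> : f z * g z - (P * Q).[z] = f z * (g z - Q.[z]) + Q.[z] * (f z - P.[z]).
    by rewrite hornerM; ring.
  rewrite (le_trans (ler_normcD _ _)) // !normcM.
  have h1 := normc_ge_sub Q.[z] (g z); rewrite normcBC in h1.
  have := hF z Ez; have := hG z Ez; have := normc_ge0 (f z); have := normc_ge0 Q.[z].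
  have := normc_ge0 (g z - Q.[z]); have := normc_ge0 (f z - P.[z]).
  set a := normc (f z) in h1 *; set b := normc Q.[z] in h1 *.
  set u := normc (g z - _) in q1 q2 h1 *; set v := normc (f z - _) in p1 p2 *.
  move=> v0 u0 b0 a0 hg' hf'.
  pose w := Num.max u v; have uw : u <= w by rewrite le_max lexx.
  have vw : v <= w by rewrite le_max lexx orbT.
  have we : w * (F + G + 1) <= e by rewrite /w; case: (leP u v).
  have b1 : b <= G + 1 by lra.
  have h2 : a * u <= F * w by apply: ler_pM.
  have h3 : b * v <= (G + 1) * w by apply: ler_pM.
  by lra.
- move=> f hf e e0; have e2 : 0 < e / 2 by rewrite divr_gt0.
  have [g hg fg] := hf _ e2; have [P hP] := hg _ e2; exists P => z Ez.
  have -> : f z - P.[z] = (f z - g z) + (g z - P.[z]) by rewrite addrA subrK.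
  rewrite (le_trans (ler_normcD _ _)) //.
  by have := fg z Ez; have := hP z Ez; lra.
Qed.

Definition mx_approx m n (F : C -> 'M[C]_(m, n)) := forall i j, poly_approx (fun z => F z i j).

Lemma poly_approx_ext f g : poly_approx f ->
  (forall z, circle_diam z -> f z = g z) -> poly_approx g.
Proof. exact: (ua_ext poly_approx_ua). Qed.

Lemma poly_approx_const c : poly_approx (fun _ => c).
Proof. exact: (ua_const poly_approx_ua). Qed.

Lemma poly_approx_add f g : poly_approx f -> poly_approx g ->
  poly_approx (fun z => f z + g z).
Proof. exact: (ua_add poly_approx_ua). Qed.

Lemma poly_approx_mul f g : poly_approx f -> poly_approx g ->
  poly_approx (fun z => f z * g z).
Proof. exact: (ua_mul poly_approx_ua). Qed.

Lemma poly_approx_id : poly_approx id.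
Proof.
by apply: (poly_approx_ext (@poly_approx_poly 'X)) => z _; rewrite hornerX.
Qed.

Lemma poly_approx_sum (I : Type) (r : seq I) (F : I -> C -> C) :
  (forall i, poly_approx (F i)) -> poly_approx (fun z => \sum_(i <- r) F i z).
Proof.
move=> h; elim: r => [|a r IH].
  by apply: (poly_approx_ext (@poly_approx_const 0)) => z _; rewrite big_nil.
by apply: (poly_approx_ext (poly_approx_add (h a) IH)) => z _; rewrite big_cons.
Qed.

Lemma mx_approx_ext m n (F G : C -> 'M[C]_(m, n)) : mx_approx F ->
  (forall z, circle_diam z -> F z = G z) -> mx_approx G.
Proof. by move=> h FG i j; apply: (poly_approx_ext (h i j)) => z Ez; rewrite FG. Qed.

Lemma mx_approx_const m n (A : 'M[C]_(m, n)) : mx_approx (fun _ => A).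
Proof. by move=> i j; exact: poly_approx_const. Qed.

Lemma mx_approx_add m n (F G : C -> 'M[C]_(m, n)) : mx_approx F -> mx_approx G ->
  mx_approx (fun z => F z + G z).
Proof.
move=> hF hG i j; apply: (poly_approx_ext (poly_approx_add (hF i j) (hG i j))) => z _.
by rewrite mxE.
Qed.

Lemma mx_approx_scale m n f (F : C -> 'M[C]_(m, n)) : poly_approx f -> mx_approx F ->
  mx_approx (fun z => f z *: F z).
Proof.
move=> hf hF i j; apply: (poly_approx_ext (poly_approx_mul hf (hF i j))) => z _.
by rewrite mxE.
Qed.

Lemma mx_approx_mul m n p (F : C -> 'M[C]_(m, n)) (G : C -> 'M[C]_(n, p)) :
  mx_approx F -> mx_approx G -> mx_approx (fun z => F z *m G z).
Proof.
move=> hF hG i j.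
have h := poly_approx_sum (index_enum _) (fun k => poly_approx_mul (hF i k) (hG k j)).
by apply: (poly_approx_ext h) => z _; rewrite mxE.
Qed.

Lemma mx_approx_linear m n p q (L : {linear 'M[C]_(m, n) -> 'M[C]_(p, q)})
  (F : C -> 'M[C]_(m, n)) : mx_approx F -> mx_approx (fun z => L (F z)).
Proof.
move=> hF i j.
have h := poly_approx_sum (index_enum _) (fun a : 'I_m =>
  poly_approx_sum (index_enum _) (fun b : 'I_n =>
  poly_approx_mul (hF a b) (@poly_approx_const (L (delta_mx a b) i j)))).
apply: (poly_approx_ext h) => z _; rewrite {2}(matrix_sum_delta (F z)) linear_sum summxE.
apply: eq_bigr => a _; rewrite linear_sum summxE; apply: eq_bigr => b _.
by rewrite linearZ mxE.
Qed.

Lemma mx_approx_lim m n (F : C -> 'M[C]_(m, n)) :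
  (forall e : R, 0 < e -> exists2 G, mx_approx G &
    forall z, circle_diam z -> forall i j, normc ((F z - G z) i j) <= e) ->
  mx_approx F.
Proof.
move=> h i j; apply: (ua_lim poly_approx_ua) => e e0; have [G hG FG] := h e e0.
by exists (fun z => G z i j) => // z Ez; have := FG z Ez i j; rewrite !mxE.
Qed.

Lemma mx_approx_bounded m n (F : C -> 'M[C]_(m, n)) : mx_approx F ->
  exists2 B, 0 < B & forall z, circle_diam z -> forall i j, normc (F z i j) <= B.
Proof.
move=> hF.
have h ij : {B | 0 < B & forall z, circle_diam z -> normc (F z ij.1 ij.2) <= B}.
  by apply: cid2; apply: poly_approx_bounded (hF ij.1 ij.2).
exists (1 + \sum_(ij : 'I_m * 'I_n) s2val (h ij)).
  by rewrite ltr_pwDl // sumr_ge0 // => ij _; case: (h ij) => B /= /ltW.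
move=> z Ez i j; rewrite (bigD1 (i, j)) //= addrCA.
case: (h (i, j)) => B /= B0 hB; apply: le_trans (hB z Ez) _.
rewrite lerDl addr_ge0 // sumr_ge0 // => ij _; by case: (h ij) => B' /= /ltW.
Qed.

Lemma normc_mulmx_le m n p (A : 'M[C]_(m, n)) (B : 'M[C]_(n, p)) a b :
  (forall i j, normc (A i j) <= a) -> (forall i j, normc (B i j) <= b) ->
  forall i j, normc ((A *m B) i j) <= n%:R * (a * b).
Proof.
move=> hA hB i j; rewrite mxE (le_trans (ler_normc_sum _ _ _)) //.
rewrite mulr_natl -[in X in _ <= _ *+ X](card_ord n) -sumr_const.
apply: ler_sum => k _; rewrite normcM ler_pM ?normc_ge0 //.
Qed.

Lemma Re_segment (e y : C) (s q : R) :
  Re (e * (s%:C * (y - q%:C) + q%:C)) = s * Re (e * y) + (1 - s) * q * Re e.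
Proof.
have -> : e * (s%:C * (y - q%:C) + q%:C) = s%:C * (e * y) + ((1 - s) * q)%:C * e.
  by rewrite rmorphM rmorphB /=; ring.
by rewrite ReD !ReZ.
Qed.

Lemma invmx_perturb l (A D : 'M[C]_l) : A \in unitmx -> A + D \in unitmx ->
  invmx (A + D) = invmx A - invmx (A + D) *m (D *m invmx A).
Proof.
move=> uA uAD; apply: (can_inj (mulmxK uA)).
rewrite mulmxBl (mulVmx uA) -!mulmxA (mulVmx uA) mulmx1.
by rewrite -[in RHS](mulVmx uAD) mulmxDr addrK.
Qed.

(** At a vector of the kernel the form vanishes, which coercivity allows only for the zero
    vector. *)
Lemma coercive_unit l (M : 'M[C]_l) (e : C) c : 0 < c ->
  (forall v, c * sqnorm v <= Re (e * hf M v)) -> M \in unitmx.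
Proof.
move=> c0 h; rewrite -row_free_unit -kermx_eq0; apply/eqP/row_matrixP => i.
rewrite row0; apply/eqP; rewrite -sqnorm_eq0 eq_le sqnorm_ge0 andbT.
have := h (row i (kermx M)); rewrite /hf -row_mul mulmx_ker row0 mul0mx mxE mulr0 /=.
by rewrite pmulr_rle0.
Qed.

(** For the [i]-th row [u] of the inverse, [u *m M] is a unit vector, so the form of [M] at [u] is
    the conjugate of [u 0 i]. Hence [c |u|^2 <= |u 0 i|], which bounds all entries of [u]. *)
Lemma coercive_inv_le l (M : 'M[C]_l) (e : C) c : 0 < c -> normc e <= 1 ->
  (forall v, c * sqnorm v <= Re (e * hf M v)) ->
  forall i j, normc (invmx M i j) <= c^-1.
Proof.
move=> c0 e1 h i j; pose u := row i (invmx M).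
have uj k : normc (u 0 k) ^+ 2 <= sqnorm u.
  by rewrite /sqnorm (bigD1 k) //= lerDl sumr_ge0 // => a _; apply: sqr_ge0.
have hu : c * sqnorm u <= normc (u 0 i).
  apply: le_trans (h u) _; rewrite /hf /u -row_mul mulVmx ?(coercive_unit c0 h) //.
  have -> : row i (1%:M : 'M[C]_l) = delta_mx 0 i by rewrite rowE mulmx1.
  rewrite -/u mxE (bigD1 i) //= big1 => [|k ki]; last first.
    by rewrite !mxE eqxx /= (negPf ki) mul0r.
  rewrite addr0 [delta_mx _ _ _ _]mxE !eqxx mul1r adjE (le_trans (Re_le_normc _)) //.
  by rewrite normcM normcJ' ler_piMl ?normc_ge0.
have -> : invmx M i j = u 0 j by rewrite mxE.
have n0 := normc_ge0 (u 0 i); have n1 := normc_ge0 (u 0 j).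
have hi : normc (u 0 i) * c <= 1.
  rewrite leNgt; apply/negP => h1; have := uj i; nra.
rewrite -[_^-1]mul1r ler_pdivlMr //.
have hj : (normc (u 0 j) * c) ^+ 2 <= 1.
  by rewrite exprMn; have := uj j; nra.
by rewrite leNgt; apply/negP => h1; nra.
Qed.

(* continuation of the inverse along the segment from [1] to [Y z], by Neumann series *)
Lemma mx_approx_inv l (Y : C -> 'M[C]_l) c : 0 < c -> mx_approx Y ->
  (forall z, circle_diam z -> exists e : C, [/\ normc e <= 1, c <= Re e &
     forall v, c * sqnorm v <= Re (e * hf (Y z) v)]) ->
  mx_approx (fun z => invmx (Y z)).
Proof.
move=> c0 hY hc; pose D z := Y z - 1%:M.
have hD : mx_approx D.
  by apply: mx_approx_add => //; exact: mx_approx_const.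
have [B B0 hB] := mx_approx_bounded hD.
(* With entries bounded by [B / N] and [c^-1], two matrix products cost a factor [l * l]; this [N]
   makes each Neumann step contract by [2^-1]. *)
have [N N0 hN] := exists_div_le (l%:R * l%:R * B / c) (divr_gt0 (@ltr01 R) (ltr0n R 2)).
pose sg (j : nat) : R := j%:R / N%:R.
pose Yj j z := (sg j)%:C *: D z + 1%:M.
have coer j z : (j <= N)%N -> circle_diam z -> exists e : C, normc e <= 1 /\
    forall v, c * sqnorm v <= Re (e * hf (Yj j z) v).
  move=> jN Ez; have [e [e1 e2 e3]] := hc z Ez; exists e; split; [exact: e1 | move=> v].
  have s0 : 0 <= sg j by rewrite divr_ge0.
  have s1 : sg j <= 1 by rewrite ler_pdivrMr ?ltr0n // mul1r ler_nat.
  rewrite /Yj /D hfD hfZ hfD hfN hf1.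
  rewrite Re_segment; have := e3 v; have := sqnorm_ge0 v.
  set q := sqnorm v; set r := Re _ => q0 hr.
  have h1 : sg j * (c * q) <= sg j * r by rewrite ler_wpM2l.
  have h2 : (1 - sg j) * q * c <= (1 - sg j) * q * Re e.
    by rewrite ler_wpM2l // mulr_ge0 // subr_ge0.
  by apply: le_trans (lerD h1 h2); rewrite le_eqVlt; apply/orP; left; apply/eqP; ring.
have inv j : (j <= N)%N -> mx_approx (fun z => invmx (Yj j z)).
  elim: j => [_|j IH jN].
    apply: (mx_approx_ext (mx_approx_const 1%:M)) => z _.
    by rewrite /Yj /sg mul0r scale0r add0r invmx1.
  have {}IH := IH (ltnW jN).
  pose De z := (N%:R^-1 : R)%:C *: D z.
  have hDe : mx_approx De by apply: mx_approx_scale => //; exact: poly_approx_const.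
  have YS z : Yj j.+1 z = Yj j z + De z.
    rewrite /Yj /De addrAC -scalerDl -rmorphD; congr (_%:C *: _ + _).
    by rewrite /sg -[j.+1]addn1 natrD mulrDl mul1r.
  pose G m z := iter m (fun X => invmx (Yj j z) - X *m (De z *m invmx (Yj j z))) 0.
  have hG m : mx_approx (G m).
    elim: m => [|m IHm]; first exact: mx_approx_const.
    apply: mx_approx_add => //.
    apply: (mx_approx_ext (mx_approx_scale (poly_approx_const (-1))
       (mx_approx_mul IHm (mx_approx_mul hDe IH)))) => z _.
    by rewrite scaleN1r.
  have err m z : circle_diam z -> forall a b,
      normc ((invmx (Yj j.+1 z) - G m z) a b) <= c^-1 * 2^-1 ^+ m.
    move=> Ez; have [e [e1 e2]] := coer j z (ltnW jN) Ez.
    have [e' [e1' e2']] := coer j.+1 z jN Ez.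
    have uj := coercive_unit c0 e2; have uj1 := coercive_unit c0 e2'.
    elim: m => [a b|m IHm a b].
      by rewrite subr0 mulr1; exact: coercive_inv_le e2' _ _.
    have -> : invmx (Yj j.+1 z) - G m.+1 z =
       (G m z - invmx (Yj j.+1 z)) *m (De z *m invmx (Yj j z)).
      have E : invmx (Yj j.+1 z) = invmx (Yj j z) -
          invmx (Yj j.+1 z) *m (De z *m invmx (Yj j z)).
        by rewrite YS; apply: invmx_perturb; rewrite // -YS.
      by rewrite {1}E [G m.+1 z]/= mulmxBl opprB addrC addrA subrK.
    have h1 : forall a b, normc ((De z *m invmx (Yj j z)) a b) <=
        l%:R * (B / N%:R * c^-1).
      apply: normc_mulmx_le; last exact: coercive_inv_le e2.
      move=> a' b'; rewrite mxE normcM normcR ger0_norm ?invr_ge0 // mulrC.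
      by rewrite ler_wpM2r ?invr_ge0 // hB.
    have h2 : forall a b, normc ((G m z - invmx (Yj j.+1 z)) a b) <= c^-1 * 2^-1 ^+ m.
      move=> a' b'; have := IHm a' b'; rewrite !mxE -normcN' opprD opprK addrC //.
    apply: le_trans (normc_mulmx_le h2 h1 a b) _.
    have -> : l%:R * (c^-1 * 2^-1 ^+ m * (l%:R * (B / N%:R * c^-1))) =
      c^-1 * 2^-1 ^+ m * (l%:R * l%:R * B / c / N%:R) by ring.
    rewrite exprSr mulrA ler_wpM2l //; last by rewrite -[2^-1]mul1r.
    by rewrite mulr_ge0 ?exprn_ge0 ?invr_ge0 // ltW.
  apply: mx_approx_lim => e e0.
  have [m hm] := exists_half_pow (mulr_gt0 e0 c0).
  exists (G m) => // z Ez a b; apply: le_trans (err m z Ez a b) _.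
  by rewrite mulrC ler_pdivrMr.
apply: (mx_approx_ext (inv N (leqnn N))) => z _.
by rewrite /Yj /sg divff ?pnatr_eq0 -?lt0n // scale1r subrK.
Qed.

End DiscAlgebra.

(** * Concavity from a sign condition on the unit circle *)

Section PickConcavity.
Variable R : realType.
Local Notation C := R[i].
Local Notation Re := (@complex.Re R).
Local Notation Im := (@complex.Im R).

Lemma prim_root_complex N : (0 < N)%N -> exists w : C, N.-primitive_root w.
Proof.
move=> N0; have [r Dp] := closed_field_poly_normal ('X^N - 1 : {poly C}).
move: Dp; rewrite (monicP _) ?monicXnsubC // scale1r => Dp.
have rN : all N.-unity_root r by apply/allP => z; rewrite -root_prod_XsubC -Dp.
have sr : (N < (size r).+1)%N by rewrite -(size_prod_XsubC r id) -Dp size_XnsubC.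
have ur : uniq r.
  by rewrite -separable_prod_XsubC -Dp separable_Xn_sub_1 // pnatr_eq0 -lt0n.
by have /hasP[w _ hw] := has_prim_root N0 rN ur sr; exists w.
Qed.

Lemma mean_exp N (w : C) m : (0 < N)%N -> N.-primitive_root w ->
  N%:R^-1 * \sum_(j < N) (w ^+ j) ^+ m = (N %| m)%:R.
Proof.
move=> N0 hw; have NC : N%:R != 0 :> C by rewrite pnatr_eq0 -lt0n.
have E j : (w ^+ j) ^+ m = (w ^+ m) ^+ j by rewrite -!exprM mulnC.
under eq_bigr => j _ do rewrite E.
have [dv|ndv] := boolP (N %| m)%N.
  have -> : w ^+ m = 1 by apply/eqP; rewrite -(prim_order_dvd hw).
  under eq_bigr => j _ do rewrite expr1n.
  by rewrite sumr_const card_ord mulVf.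
have wm : w ^+ m - 1 != 0 by rewrite subr_eq0 -(prim_order_dvd hw).
have : (w ^+ m - 1) * \sum_(j < N) (w ^+ m) ^+ j = 0.
  by rewrite -subrX1 -exprM mulnC exprM (prim_expr_order hw) expr1n subrr.
by move=> /eqP; rewrite mulf_eq0 (negPf wm) => /eqP ->; rewrite mulr0.
Qed.

(* the coefficients of the Poisson-type kernel [1 / |1 - x z|^2] on the [N]-th roots of unity *)
Definition kcoef N (x : R) k : R :=
  (x ^+ k + x ^+ (N - k)) / ((1 - x ^+ 2) * (1 - x ^+ N)).

Lemma kcoef_sym N x k : (k <= N)%N -> kcoef N x (N - k) = kcoef N x k.
Proof. by move=> kN; rewrite /kcoef subKn // addrC. Qed.

(** The Fourier coefficients of the kernel are [x^|j| / (1 - x^2)]. On the [N]-th roots of unity the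
    frequencies [j] congruent to [k] modulo [N] merge, and their coefficients add up to
    [kcoef N x k]. The proof stays finite, with two geometric sums. *)
Lemma kernel_expand N (x : R) (z : C) : (0 < N)%N -> `|x| < 1 -> z ^+ N = 1 ->
  ((1 - x%:C * z) * (1 - x%:C * z^-1))^-1 = \sum_(k < N) (kcoef N x k)%:C * z ^+ k.
Proof.
move=> N0 x1 zN; have z0 : z != 0.
  apply/eqP => E; move: zN; rewrite E expr0n (gtn_eqF N0) /= => /eqP.
  by rewrite eq_sym oner_eq0.
have nz : normc z = 1.
  have : normc z ^+ N = 1 by rewrite -normcX zN normc1.
  by move/eqP; rewrite -[1 in X in _ == X](expr1n R N) eqrXn2 ?normc_ge0 // => /eqP.
have nxz (y : C) : normc y = 1 -> 1 - x%:C * y != 0.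
  move=> ny; rewrite subr_eq0; apply/eqP => /(congr1 (@normc R)).
  by rewrite normc1 normcM normcR ny mulr1 => E; move: x1; rewrite -E ltxx.
have d1 := nxz z nz; have d2 : 1 - x%:C * z^-1 != 0 by rewrite nxz // normcV nz invr1.
have x2 : 1 - x ^+ 2 != 0.
  by rewrite gt_eqF // subr_gt0 -real_normK ?num_real // exprn_ilt1.
have xN : 1 - x ^+ N != 0.
  rewrite subr_eq0; apply/eqP => /(congr1 Num.norm); rewrite normrX normr1 => E.
  by have := exprn_ilt1 N (normr_ge0 x) x1; rewrite -E ltxx -lt0n N0.
have -> : \sum_(k < N) (kcoef N x k)%:C * z ^+ k =
   ((1 - x%:C ^+ 2) * (1 - x%:C ^+ N))^-1 *
   (\sum_(k < N) (x%:C * z) ^+ k + x%:C / z * \sum_(k < N) (x%:C / z) ^+ k).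
  rewrite mulr_sumr [X in _ = _ * (_ + X)](reindex_inj rev_ord_inj) /= -big_split.
  rewrite mulr_sumr; apply: eq_bigr => k _.
  rewrite /kcoef rmorphM fmorphV rmorphD /= !rmorphM /= !rmorphB /= !rmorphXn /=.
  rewrite -exprS -subSn // subSS rmorph1.
  have -> : (x%:C / z) ^+ (N - k) = x%:C ^+ (N - k) * z ^+ k.
    rewrite exprMn exprVn; congr (_ * _).
    have zk : z ^+ k * z ^+ (N - k) = 1 by rewrite -exprD subnKC // ltnW.
    by apply: (mulIf (expf_neq0 (N - k) z0)); rewrite mulVf ?zk // expf_neq0.
  by rewrite exprMn -mulrDl mulrA [X in X * _ = _]mulrC.
have geo (y : C) : 1 - y != 0 -> \sum_(k < N) y ^+ k = (1 - y ^+ N) / (1 - y).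
  move=> y1; apply: (canRL (mulfK y1)); rewrite mulrC -[1 - y]opprB mulNr -subrX1.
  by rewrite opprB.
rewrite (geo _ d1) (geo _ d2) !exprMn exprVn zN invr1 !mulr1.
have x2C : 1 - x%:C ^+ 2 != 0 :> C.
  by rewrite -rmorphXn -(rmorph1 (real_complex R)) -rmorphB fmorph_eq0.
have xNC : 1 - x%:C ^+ N != 0 :> C.
  by rewrite -rmorphXn -(rmorph1 (real_complex R)) -rmorphB fmorph_eq0.
move: x2C xNC d1 d2; set X := x%:C; set Y := X ^+ N => x2C xNC d1 d2.
have d2' : z - X != 0.
  by apply: contra d2; rewrite subr_eq0 => /eqP <-; rewrite divff // subrr.
by field; rewrite ?x2C ?xNC ?d1 ?d2' ?z0.
Qed.

Lemma kcoef_mean N (x : R) m : (0 < N)%N ->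
  \sum_(k < N) (kcoef N x k)%:C * ((N %| m + k)%:R : C) = (kcoef N x (m %% N))%:C.
Proof.
move=> N0; have rN := ltn_pmod m N0; set r := (m %% N)%N in rN *.
have dv k : (N %| m + k)%N = (N %| r + k)%N by rewrite /dvdn -modnDml.
under eq_bigr => k _ do rewrite dv.
have sN : ((N - r) %% N < N)%N by rewrite ltn_pmod.
rewrite (bigD1 (Ordinal sN)) //= big1 => [|k kr]; rewrite ?addr0.
  have [r0|r0] := posnP r; first by rewrite r0 subn0 modnn addn0 dvdn0 mulr1.
  rewrite modn_small ?subnKC ?(ltnW rN) ?dvdnn ?mulr1 ?kcoef_sym ?(ltnW rN) //.
  by rewrite ltn_subrL r0 N0.
have [/dvdnP[q hq]|] := boolP (N %| r + k)%N; last by rewrite mulr0.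
move: kr; rewrite -val_eqE /= => /eqP; case; have kN := ltn_ord k.
have [r0|r0] := posnP r; move: hq; rewrite ?r0 ?add0n => hq.
  by rewrite subn0 modnn; case: q hq => [|q]; rewrite ?mulSn; lia.
by rewrite modn_small; [|lia]; move: hq; case: q => [|[|q]]; rewrite ?mulSn; lia.
Qed.

(** This is [|n - 2|]: multiplication by [z^-2] moves the frequency [n] to [n - 2], and the kernel
    coefficients depend only on the absolute value of the frequency. *)
Definition dist2 n := (maxn n 2 - minn n 2)%N.

Lemma dist2_le n : (dist2 n <= n + 2)%N.
Proof. by rewrite /dist2; lia. Qed.

(** Averaging over the roots of unity pairs each coefficient of [P] with the kernel coefficient of
    the opposite frequency. The bound on [N] keeps the shifted frequencies from wrapping around. *)
Lemma kernel_mean N (w : C) (P : {poly C}) (x : R) : (size P + 2 <= N)%N ->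
  N.-primitive_root w -> `|x| < 1 ->
  N%:R^-1 * \sum_(j < N) P.[w ^+ j] * (1 - (w ^+ j) ^- 2) *
      ((1 - x%:C * w ^+ j) * (1 - x%:C * (w ^+ j)^-1))^-1 =
  \sum_(n < size P) P`_n * (kcoef N x n - kcoef N x (dist2 n))%:C.
Proof.
move=> sN hw x1; have N0 : (0 < N)%N by lia.
have term (z : C) : z ^+ N = 1 -> P.[z] * (1 - z ^- 2) *
      ((1 - x%:C * z) * (1 - x%:C * z^-1))^-1 =
    \sum_(n < size P) P`_n * \sum_(k < N) (kcoef N x k)%:C *
      (z ^+ (n + k) - z ^+ (n + (N - 2) + k)).
  move=> zN.
  have z2 : z ^- 2 = z ^+ (N - 2).
    have z0 : z != 0.
      apply/eqP => E; move: zN; rewrite E expr0n (gtn_eqF N0) /= => /eqP.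
      by rewrite eq_sym oner_eq0.
    apply: (mulfI (expf_neq0 2 z0)); rewrite /= divff ?expf_neq0 //.
    by rewrite -exprD subnKC ?zN //; lia.
  rewrite (kernel_expand N0 x1 zN) z2 horner_coef !mulr_suml; apply: eq_bigr => n _.
  rewrite -!mulrA; congr (_ * _); rewrite !mulr_sumr; apply: eq_bigr => k _.
  by rewrite !exprD; ring.
have wN (j : 'I_N) : (w ^+ j) ^+ N = 1.
  by rewrite -exprM mulnC exprM (prim_expr_order hw) expr1n.
under eq_bigr => j _ do rewrite (term _ (wN j)).
rewrite exchange_big mulr_sumr; apply: eq_bigr => n _ /=.
rewrite -mulr_sumr mulrCA; congr (_ * _).
rewrite exchange_big mulr_sumr /=.
transitivity (\sum_(k < N) ((kcoef N x k)%:C * ((N %| n + k)%:R : C) -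
    (kcoef N x k)%:C * ((N %| n + (N - 2) + k)%:R : C))).
  apply: eq_bigr => k _; rewrite -mulr_sumr mulrCA -mulrBr; congr (_ * _).
  by rewrite sumrB mulrBr !mean_exp.
rewrite sumrB !kcoef_mean // rmorphB /=.
move: (ltn_ord n); move: (nat_of_ord n) => {}n nP; rewrite modn_small; last lia.
congr (_ - _%:C); rewrite /dist2.
case: (ltnP n 2) => n2.
  have nN : (n + (N - 2) < N)%N by lia.
  rewrite modn_small // -kcoef_sym; last lia.
  by congr kcoef; lia.
have -> : (n + (N - 2) = (n - 2) + N)%N by lia.
by rewrite modnDr modn_small; [congr kcoef; lia|lia].
Qed.

Lemma exists_pow_le (r e : R) : 0 <= r < 1 -> 0 < e -> exists m, r ^+ m <= e.
Proof.
move=> /andP[r0 r1] e0.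
have [N N0 hN] := @exists_div_le R ((1 - r)^-1) e e0.
exists N; apply: le_trans hN.
have B k : r ^+ k * (1 + k%:R * (1 - r)) <= 1.
  elim: k => [|k IH]; first by rewrite expr0 mul0r addr0 mulr1.
  rewrite exprS; have p0 : 0 <= r ^+ k by rewrite exprn_ge0.
  have k0 : 0 <= k%:R :> R by rewrite ler0n.
  have kS : k.+1%:R = k%:R + 1 :> R by rewrite -addn1 natrD.
  apply: le_trans IH; rewrite kS.
  have : r * (1 + (k%:R + 1) * (1 - r)) <= 1 + k%:R * (1 - r).
    rewrite -subr_ge0 (_ : _ - _ = (1 + k%:R) * (1 - r) ^+ 2); last ring.
    by rewrite mulr_ge0 ?sqr_ge0 // addr_ge0.
  by move=> h; rewrite mulrAC mulrC [r * _]mulrC ler_wpM2l // mulrC.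
have N1 : 0 < N%:R :> R by rewrite ltr0n.
have h1r : 0 < 1 - r by lra.
rewrite -invfM -[_^-1]mul1r ler_pdivlMr ?mulr_gt0 //.
have := B N; have p0 : 0 <= r ^+ N by rewrite exprn_ge0.
by nra.
Qed.

Lemma kcoef_lim (x e : R) D : `|x| < 1 -> 0 < e -> exists N0, forall N n,
  (N0 <= N)%N -> (n <= D)%N -> `|kcoef N x n - x ^+ n / (1 - x ^+ 2)| <= e.
Proof.
move=> x1 e0; have a0 := normr_ge0 x.
have h2 : 0 < 1 - x ^+ 2 by rewrite subr_gt0 -real_normK ?num_real // exprn_ilt1.
have h1 : 0 < 1 - `|x| by lra.
have c0 : 0 < e * (1 - x ^+ 2) * (1 - `|x|) / 2 by rewrite !mulr_gt0 // invr_gt0.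
have x01 : 0 <= `|x| < 1 by rewrite a0.
have [m hm] := exists_pow_le x01 c0.
exists (D + m).+1 => N n hN hn.
have i1 : (m <= N - n)%N by lia.
have i2 : (m <= n + N)%N by lia.
have xN : `|x| ^+ N <= `|x|.
  by rewrite -{2}[`|x|]expr1 (ler_wiXn2l a0 (ltW x1)) //; lia.
have xN' : 1 - `|x| <= 1 - x ^+ N.
  by have := ler_norm (x ^+ N); rewrite normrX; lra.
have hN0 : 0 < 1 - x ^+ N by lra.
have -> : kcoef N x n - x ^+ n / (1 - x ^+ 2) =
    (x ^+ (N - n) + x ^+ n * x ^+ N) / ((1 - x ^+ 2) * (1 - x ^+ N)).
  by rewrite /kcoef; field; rewrite !gt_eqF.
rewrite normrM normfV [`|_ * (1 - _)|]gtr0_norm ?mulr_gt0 //.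
rewrite ler_pdivrMr ?mulr_gt0 //.
have t1 : `|x ^+ (N - n) + x ^+ n * x ^+ N| <= `|x| ^+ m + `|x| ^+ m.
  apply: le_trans (ler_normD _ _) _; rewrite -exprD !normrX.
  exact: lerD (ler_wiXn2l a0 (ltW x1) i1) (ler_wiXn2l a0 (ltW x1) i2).
apply: le_trans t1 _; apply: le_trans (_ : e * ((1 - x ^+ 2) * (1 - `|x|)) <= _).
  by lra.
by rewrite !ler_wpM2l // ltW.
Qed.

(** The limit of the discrete means of [kernel_mean] as [N] grows, that is, the mean over the circle
    of [P z (1 - z^-2) / |1 - x z|^2]. *)
Definition Lam (P : {poly C}) (x : R) : C :=
  \sum_(n < size P) P`_n * (x ^+ n / (1 - x ^+ 2) - x ^+ dist2 n / (1 - x ^+ 2))%:C.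

(** For [n >= 2] the coefficient [x^2 (x^n - x^(n - 2)) / (1 - x^2)] collapses to [- x^n]. Only
    [n = 0] and [n = 1] leave other terms, and these become affine in [tau] after division by
    [1 + x^2]. *)
Lemma LamE (P : {poly C}) (x : R) : `|x| < 1 ->
  (x ^+ 2)%:C * Lam P x = (1 + x ^+ 2)%:C * P`_0 + x%:C * P`_1 - P.[x%:C].
Proof.
move=> x1; have h2 : 1 - x ^+ 2 != 0.
  by rewrite gt_eqF // subr_gt0 -real_normK ?num_real // exprn_ilt1.
have [M sP] : exists M, (size P <= M.+2)%N by exists (size P); lia.
have ext (f : nat -> C) : \sum_(n < size P) P`_n * f n = \sum_(n < M.+2) P`_n * f n.
  rewrite (big_ord_widen _ (fun n => P`_n * f n) sP) big_mkcond; apply: eq_bigr => i _.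
  by case: ltnP => // h; rewrite nth_default ?mul0r.
rewrite /Lam (ext (fun n => (x ^+ n / (1 - x ^+ 2) - x ^+ dist2 n / (1 - x ^+ 2))%:C)).
rewrite horner_coef (ext (fun n => x%:C ^+ n)).
have key n : x ^+ 2 * (x ^+ n / (1 - x ^+ 2) - x ^+ dist2 n / (1 - x ^+ 2)) =
    ((n == 0%N)%:R * (1 + x ^+ 2) + (n == 1%N)%:R * x) - x ^+ n.
  case: n => [|[|n]]; rewrite /dist2 /=; try by field.
  have -> : (maxn n.+2 2 - minn n.+2 2 = n)%N by lia.
  by rewrite !mulr0n !mul0r !(exprS x n.+1) !(exprS x n); field.
pose del n : R := (n == 0%N)%:R * (1 + x ^+ 2) + (n == 1%N)%:R * x.
transitivity (\sum_(n < M.+2) P`_n * (del n)%:C - \sum_(n < M.+2) P`_n * x%:C ^+ n).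
  rewrite mulr_sumr -sumrB; apply: eq_bigr => n _.
  by rewrite mulrCA -rmorphM /= key -/(del n) -mulrBr rmorphB rmorphXn.
congr (_ - _); rewrite !big_ord_recl big1 /= => [|i _]; last first.
  by rewrite /del /= !mul0r addr0 mulr0.
by rewrite /del /= !mul0r !mul1r add0r !addr0 [RHS]addrC addrC ![P`__ * _]mulrC addrC.
Qed.

Lemma kernel_normc (x : R) (z : C) : normc z = 1 ->
  ((1 - x%:C * z) * (1 - x%:C * z^-1))^-1 = (normc (1 - x%:C * z) ^- 2)%:C.
Proof.
move=> nz; have z0 : z != 0.
  by apply/eqP => E; move: nz; rewrite E normc0 => /eqP; rewrite eq_sym oner_eq0.
have -> : z^-1 = Num.conj z.
  by apply: (mulfI z0); rewrite divff // mulcJ nz expr1n.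
have E : (1 - x%:C * z) * (1 - x%:C * Num.conj z) = (normc (1 - x%:C * z) ^+ 2)%:C.
  rewrite -mulcJ rmorphB rmorphM rmorph1 /=; congr (_ * (1 - _ * _)).
  exact/esym/conjcR.
by rewrite E fmorphV.
Qed.

Lemma sqrnormc_1B (x : R) (z : C) : normc z = 1 ->
  normc (1 - x%:C * z) ^+ 2 = 1 + x ^+ 2 - 2 * x * Re z.
Proof.
move=> nz; have h := normcE2 z; rewrite nz expr1n in h.
rewrite normcE2 ReB ReZ.
have -> : Im (1 - x%:C * z) = - (x * Im z) by case: {nz h} z => a b /=; ring.
have -> : (Re 1 - x * Re z) ^+ 2 + (- (x * Im z)) ^+ 2 =
  1 + x ^+ 2 * (Re z ^+ 2 + Im z ^+ 2) - 2 * x * Re z by rewrite /=; ring.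
by rewrite -h mulr1.
Qed.

Lemma kernel_bounds (x : R) (z : C) : `|x| < 1 -> normc z = 1 ->
  0 < normc (1 - x%:C * z) /\ normc (1 - x%:C * z) ^- 2 <= (1 - `|x|) ^- 2.
Proof.
move=> x1 nz; have h : 1 - `|x| <= normc (1 - x%:C * z).
  have := normc_ge_sub 1 (1 - x%:C * z).
  by rewrite normc1 subKr normcM normcR nz mulr1.
have h0 : 0 < 1 - `|x| by lra.
split; first exact: lt_le_trans h.
rewrite lef_pV2 ?posrE ?exprn_gt0 //; last exact: lt_le_trans h.
by rewrite lerXn2r ?nnegrE ?normc_ge0 // ltW.
Qed.

Lemma quad_over_linear (c1 c2 a1 a2 u1 u2 : R) : 0 <= c1 -> 0 <= c2 -> 0 < c1 + c2 ->
  0 < u1 -> 0 < u2 ->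
  (c1 * a1 + c2 * a2) ^+ 2 / (c1 * u1 + c2 * u2) <=
  c1 * (a1 ^+ 2 / u1) + c2 * (a2 ^+ 2 / u2).
Proof.
move=> h1 h2 h12 p1 p2.
have U : 0 < c1 * u1 + c2 * u2.
  have m1 : 0 <= c1 * u1 by rewrite mulr_ge0 // ltW.
  have m2 : 0 <= c2 * u2 by rewrite mulr_ge0 // ltW.
  have [c10|c10] := ltP 0 c1; first by rewrite ltr_pwDl // mulr_gt0.
  by rewrite ltr_wpDl // mulr_gt0 //; lra.
rewrite ler_pdivrMr // -subr_ge0.
have -> : (c1 * (a1 ^+ 2 / u1) + c2 * (a2 ^+ 2 / u2)) * (c1 * u1 + c2 * u2) -
   (c1 * a1 + c2 * a2) ^+ 2 = c1 * c2 * ((a1 * u2 - a2 * u1) ^+ 2 / (u1 * u2)).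
  by field; rewrite !gt_eqF.
apply: mulr_ge0; first exact: mulr_ge0.
by apply: divr_ge0; [exact: sqr_ge0 | apply/ltW/mulr_gt0].
Qed.

(* In the variable [tau = x / (1 + x^2)] the kernel [x^2 / ((1 + x^2) |1 - x z|^2)] is the
   convex function [tau^2 / (1 - 2 tau Re z)]. *)
Lemma kernel_convex (x1 x2 x3 c1 c2 : R) (z : C) : normc z = 1 ->
  `|x1| < 1 -> `|x2| < 1 -> `|x3| < 1 -> 0 <= c1 -> 0 <= c2 -> c1 + c2 = 1 ->
  c1 * (x1 / (1 + x1 ^+ 2)) + c2 * (x2 / (1 + x2 ^+ 2)) = x3 / (1 + x3 ^+ 2) ->
  x3 ^+ 2 / (1 + x3 ^+ 2) * normc (1 - x3%:C * z) ^- 2 <=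
  c1 * (x1 ^+ 2 / (1 + x1 ^+ 2) * normc (1 - x1%:C * z) ^- 2) +
  c2 * (x2 ^+ 2 / (1 + x2 ^+ 2) * normc (1 - x2%:C * z) ^- 2).
Proof.
move=> nz h1 h2 h3 c10 c20 c12 E.
have pos (x : R) : 0 < 1 + x ^+ 2 by rewrite ltr_pwDl // sqr_ge0.
pose u x := normc (1 - x%:C * z) ^+ 2 / (1 + x ^+ 2).
have u0 x : `|x| < 1 -> 0 < u x.
  by move=> hx; have [n0 _] := kernel_bounds hx nz; rewrite divr_gt0 ?exprn_gt0.
have uE x : u x = 1 - 2 * Re z * (x / (1 + x ^+ 2)).
  by rewrite /u sqrnormc_1B //; field; rewrite gt_eqF.
have kE x : `|x| < 1 -> x ^+ 2 / (1 + x ^+ 2) * normc (1 - x%:C * z) ^- 2 =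
    (x / (1 + x ^+ 2)) ^+ 2 / u x.
  move=> hx; have [n0 _] := kernel_bounds hx nz.
  by rewrite /u; field; rewrite !gt_eqF.
rewrite !kE // -E; have -> : u x3 = c1 * u x1 + c2 * u x2.
  have c2E : c2 = 1 - c1 by lra.
  by rewrite !uE -E c2E; ring.
by apply: quad_over_linear; rewrite ?u0 ?c12.
Qed.

Lemma Re_normc_le (x y : C) : `|Re x - Re y| <= normc (x - y).
Proof.
rewrite ler_norml -ReB Re_le_normc andbT lerNl -ReN.
by rewrite (le_trans (Re_le_normc _)) // normcN'.
Qed.

Lemma le_of_small (a b M : R) : 0 <= M -> (forall e, 0 < e -> a <= b + M * e) -> a <= b.
Proof.
move=> M0 h; apply/ler_addgt0Pr => e e0.
have M1 : 0 < M + 1 by rewrite ltr_wpDl.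
apply: le_trans (h (e / (M + 1)) (divr_gt0 e0 M1)) _.
by rewrite lerD2l mulrA ler_pdivrMr // mulrC ler_pM2l // lerDl.
Qed.

(* A real-variable form of "a Pick function is concave": the boundary sign condition plays the
   role of positivity of the imaginary part on the upper half plane. *)
Lemma pick_concave (F : C -> C) (x1 x2 x3 c1 c2 : R) : poly_approx F ->
  (forall z, normc z = 1 -> 0 <= Re (F z * (1 - z ^- 2))) ->
  `|x1| < 1 -> `|x2| < 1 -> `|x3| < 1 -> 0 <= c1 -> 0 <= c2 -> c1 + c2 = 1 ->
  c1 * (x1 / (1 + x1 ^+ 2)) + c2 * (x2 / (1 + x2 ^+ 2)) = x3 / (1 + x3 ^+ 2) ->
  c1 * (Re (F x1%:C) / (1 + x1 ^+ 2)) + c2 * (Re (F x2%:C) / (1 + x2 ^+ 2)) <=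
  Re (F x3%:C) / (1 + x3 ^+ 2).
Proof.
move=> hF posF h1 h2 h3 c10 c20 c12 Etau.
have pos (x : R) : 0 < 1 + x ^+ 2 by rewrite ltr_pwDl // sqr_ge0.
pose wt (x : R) : R := x ^+ 2 / (1 + x ^+ 2).
have wt0 x : 0 <= wt x by rewrite divr_ge0 ?sqr_ge0 // ltW.
pose kb (x : R) : R := wt x * (1 - `|x|) ^- 2.
have kb0 x : 0 <= kb x by rewrite mulr_ge0 // invr_ge0 sqr_ge0.
pose km := c1 * kb x1 + c2 * kb x2.
have km0 : 0 <= km by rewrite addr_ge0 // mulr_ge0.
pose M := 2 * km + (c1 * wt x1 + c2 * wt x2 + wt x3) + 2.
apply: (@le_of_small _ _ M) => [|e e0].
  have := mulr_ge0 c10 (wt0 x1); have := mulr_ge0 c20 (wt0 x2); have := wt0 x3.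
  by rewrite /M; lra.
have [P hP] := hF e e0.
pose B := \sum_(n < size P) normc P`_n.
have B0 : 0 <= B by apply: sumr_ge0 => n _; exact: normc_ge0.
have d0 : 0 < e / (2 * B + 1) by rewrite divr_gt0 //; lra.
pose D := (size P + 2)%N.
have [N1 hN1] := kcoef_lim D h1 d0.
have [N2 hN2] := kcoef_lim D h2 d0.
have [N3 hN3] := kcoef_lim D h3 d0.
pose N := (D + N1 + N2 + N3)%N.
have N0 : (0 < N)%N by rewrite /N /D addn2.
have sPN : (size P + 2 <= N)%N.
  exact: leq_trans (leq_trans (leq_addr N1 D) (leq_addr N2 _)) (leq_addr N3 _).
have NN1 : (N1 <= N)%N.
  exact: leq_trans (leq_trans (leq_addl D N1) (leq_addr N2 _)) (leq_addr N3 _).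
have NN2 : (N2 <= N)%N by exact: leq_trans (leq_addl _ N2) (leq_addr N3 _).
have NN3 : (N3 <= N)%N by exact: leq_addl.
have [w hw] := prim_root_complex N0.
pose q (x : R) : C := N%:R^-1 * \sum_(j < N) P.[w ^+ j] * (1 - (w ^+ j) ^- 2) *
      ((1 - x%:C * w ^+ j) * (1 - x%:C * (w ^+ j)^-1))^-1.
have nw (j : nat) : normc (w ^+ j) = 1.
  have nw1 : normc w = 1.
    have : normc w ^+ N = 1 by rewrite -normcX (prim_expr_order hw) normc1.
    by move/eqP; rewrite -[1 in X in _ == X](expr1n R N) eqrXn2 ?normc_ge0 // => /eqP.
  by rewrite normcX nw1 expr1n.
have qLam x Nx : `|x| < 1 -> (Nx <= N)%N ->
    (forall N n, (Nx <= N)%N -> (n <= D)%N ->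
       `|kcoef N x n - x ^+ n / (1 - x ^+ 2)| <= e / (2 * B + 1)) ->
    `|Re (q x) - Re (Lam P x)| <= e.
  move=> hx hNx hlim; apply: le_trans (Re_normc_le _ _) _.
  rewrite /q (kernel_mean sPN hw hx).
  rewrite /Lam -sumrB; apply: le_trans (ler_normc_sum _ _ _) _.
  apply: (@le_trans _ _ (\sum_(n < size P) normc P`_n * (2 * (e / (2 * B + 1))))).
    apply: ler_sum => n _; rewrite -mulrBr -rmorphB /= normcM normcR.
    apply: ler_wpM2l; first exact: normc_ge0.
    have nD : (n <= D)%N by exact: leq_trans (ltnW (ltn_ord n)) (leq_addr 2 _).
    have nD' : (dist2 n <= D)%N.
      by apply: leq_trans (dist2_le n) _; rewrite leq_add2r ltnW.
    have := hlim N n hNx nD; have := hlim N _ hNx nD'; rewrite !ler_norml.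
    by move=> /andP[a1 a2] /andP[a3 a4]; clear -a1 a2 a3 a4; apply/andP; split; lra.
  rewrite -mulr_suml -/B.
  have -> : B * (2 * (e / (2 * B + 1))) = 2 * B * e / (2 * B + 1) by ring.
  by rewrite ler_pdivrMr; nra.
pose ker (x : R) (z : C) : R := normc (1 - x%:C * z) ^- 2.
have Req x : Re (q x) = N%:R^-1 * \sum_(j < N)
    Re (P.[w ^+ j] * (1 - (w ^+ j) ^- 2)) * ker x (w ^+ j).
  rewrite /q -(rmorph_nat (real_complex R)) -fmorphV ReZ Re_sum; congr (_ * _).
  by apply: eq_bigr => j _; rewrite kernel_normc // [_ * _%:C]mulrC ReZ mulrC.
(* Termwise, a boundary value of [P], nonnegative up to [2 e] because [|1 - z^-2| <= 2], multiplies
   the convexity defect of the kernel, which lies between [0] and [km]. *)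
have lower : - (2 * km * e) <=
    c1 * (wt x1 * Re (q x1)) + c2 * (wt x2 * Re (q x2)) - wt x3 * Re (q x3).
  have -> : c1 * (wt x1 * Re (q x1)) + c2 * (wt x2 * Re (q x2)) - wt x3 * Re (q x3) =
     N%:R^-1 * \sum_(j < N) Re (P.[w ^+ j] * (1 - (w ^+ j) ^- 2)) *
      (c1 * (wt x1 * ker x1 (w ^+ j)) + c2 * (wt x2 * ker x2 (w ^+ j)) -
       wt x3 * ker x3 (w ^+ j)).
    transitivity (N%:R^-1 * (c1 * wt x1 * \sum_(j < N)
       Re (P.[w ^+ j] * (1 - (w ^+ j) ^- 2)) * ker x1 (w ^+ j) + c2 * wt x2 * \sum_(j < N)
       Re (P.[w ^+ j] * (1 - (w ^+ j) ^- 2)) * ker x2 (w ^+ j) - wt x3 * \sum_(j < N)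
       Re (P.[w ^+ j] * (1 - (w ^+ j) ^- 2)) * ker x3 (w ^+ j))).
      by rewrite !Req; ring.
    congr (_ * _); rewrite !mulr_sumr -big_split -sumrB /=.
    by apply: eq_bigr => j _; ring.
  have NR : 0 < N%:R :> R by rewrite ltr0n.
  rewrite [leRHS]mulrC ler_pdivlMr // [leLHS]mulrC.
  have -> : N%:R * - (2 * km * e) = \sum_(j < N) - (2 * km * e).
    by rewrite sumr_const card_ord mulr_natl.
  apply: ler_sum => j _; set z := w ^+ j; have nz : normc z = 1 by rewrite nw.
  have p1 : - (2 * e) <= Re (P.[z] * (1 - z ^- 2)).
    have := Re_normc_le (F z * (1 - z ^- 2)) (P.[z] * (1 - z ^- 2)).
    rewrite -mulrBl normcM ler_norml => /andP[_].
    have Ez : circle_diam z by left.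
    have := hP z Ez; have := posF z nz.
    have : normc (1 - z ^- 2) <= 2.
      by rewrite (le_trans (ler_normcB _ _)) // normc1 normcV normcX nz expr1n invr1; lra.
    have := normc_ge0 (F z - P.[z]); have := normc_ge0 (1 - z ^- 2).
    by nra.
  have k0 := kernel_convex nz h1 h2 h3 c10 c20 c12 Etau.
  rewrite -/(wt x1) -/(wt x2) -/(wt x3) -/(ker x1 z) -/(ker x2 z) -/(ker x3 z) in k0.
  have [_ b1] := kernel_bounds h1 nz; have [_ b2] := kernel_bounds h2 nz.
  have [n3 _] := kernel_bounds h3 nz.
  rewrite -/(ker x1 z) in b1; rewrite -/(ker x2 z) in b2.
  have k3 : 0 <= wt x3 * ker x3 z by rewrite mulr_ge0 // invr_ge0 sqr_ge0.
  have m1 : c1 * (wt x1 * ker x1 z) <= c1 * kb x1 by rewrite !ler_wpM2l.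
  have m2 : c2 * (wt x2 * ker x2 z) <= c2 * kb x2 by rewrite !ler_wpM2l.
  have : c1 * (wt x1 * ker x1 z) + c2 * (wt x2 * ker x2 z) - wt x3 * ker x3 z <= km.
    by rewrite /km; lra.
  have : 0 <= c1 * (wt x1 * ker x1 z) + c2 * (wt x2 * ker x2 z) - wt x3 * ker x3 z.
    by lra.
  set K := _ - _ => K0 Kk; move: p1; set r := Re _ => p1.
  by nra.
have ReLam x : `|x| < 1 -> wt x * Re (Lam P x) =
   Re P`_0 + Re P`_1 * (x / (1 + x ^+ 2)) - Re P.[x%:C] / (1 + x ^+ 2).
  move=> hx; have := congr1 Re (LamE P hx); rewrite ReB ReD !ReZ => E.
  rewrite /wt mulrAC E; field; rewrite gt_eqF //.
have RP x : `|x| < 1 -> `|Re (F x%:C) / (1 + x ^+ 2) - Re P.[x%:C] / (1 + x ^+ 2)| <= e.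
  move=> hx; rewrite -mulrBl normrM normfV (gtr0_norm (pos x)) ler_pdivrMr //.
  have Ex : circle_diam x%:C by right; rewrite normcR ltW.
  apply: le_trans (Re_normc_le _ _) _; apply: le_trans (hP _ Ex) _.
  by rewrite mulrDr mulr1 lerDl mulr_ge0 ?sqr_ge0 // ltW.
have l1 := qLam x1 N1 h1 NN1 hN1.
have l2 := qLam x2 N2 h2 NN2 hN2.
have l3 := qLam x3 N3 h3 NN3 hN3.
have r1 := ReLam x1 h1; have r2 := ReLam x2 h2; have r3 := ReLam x3 h3.
have f1 := RP x1 h1; have f2 := RP x2 h2; have f3 := RP x3 h3.
have wl x : 0 <= wt x -> `|Re (q x) - Re (Lam P x)| <= e ->
    `|wt x * Re (q x) - wt x * Re (Lam P x)| <= wt x * e.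
  by move=> w0 h; rewrite -mulrBr normrM ger0_norm // ler_wpM2l.
have {}l1 := wl x1 (wt0 x1) l1; have {}l2 := wl x2 (wt0 x2) l2.
have {wl}l3 := wl x3 (wt0 x3) l3.
move: l1 l2 l3 f1 f2 f3 r1 r2 r3 lower; rewrite !ler_norml -Etau.
set W1 := wt x1 * Re (q x1); set W2 := wt x2 * Re (q x2); set W3 := wt x3 * Re (q x3).
set G1 := Re (F x1%:C) / _; set G2 := Re (F x2%:C) / _; set G3 := Re (F x3%:C) / _.
set H1 := Re P.[x1%:C] / _; set H2 := Re P.[x2%:C] / _; set H3 := Re P.[x3%:C] / _.
set L1 := wt x1 * Re (Lam P x1); set L2 := wt x2 * Re (Lam P x2).
set L3 := wt x3 * Re (Lam P x3).
set t1 := x1 / _; set t2 := x2 / _; set b0 := Re P`_0; set b1 := Re P`_1.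
move=> /andP[l1 l1'] /andP[l2 l2'] /andP[l3 l3'] /andP[f1 f1'] /andP[f2 f2'] /andP[f3 f3'].
move=> r1 r2 r3 lower.
have k1 : c1 * W1 <= c1 * L1 + c1 * (wt x1 * e) by rewrite -mulrDr ler_wpM2l // -lerBlDl.
have k2 : c2 * W2 <= c2 * L2 + c2 * (wt x2 * e) by rewrite -mulrDr ler_wpM2l // -lerBlDl.
have g1 : c1 * G1 <= c1 * H1 + c1 * e by rewrite -mulrDr ler_wpM2l // -lerBlDl.
have g2 : c2 * G2 <= c2 * H2 + c2 * e by rewrite -mulrDr ler_wpM2l // -lerBlDl.
have E1 : c1 * L1 = c1 * b0 + b1 * (c1 * t1) - c1 * H1 by rewrite r1; ring.
have E2 : c2 * L2 = c2 * b0 + b1 * (c2 * t2) - c2 * H2 by rewrite r2; ring.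
have E3 : L3 = b0 + b1 * (c1 * t1) + b1 * (c2 * t2) - H3 by rewrite r3; ring.
have E4 : c1 * b0 + c2 * b0 = b0 by rewrite -mulrDl c12 mul1r.
have E5 : c1 * e + c2 * e = e by rewrite -mulrDl c12 mul1r.
rewrite /M; lra.
Qed.

End PickConcavity.

(** * Principal powers and the cones of their arguments *)

Section ComplexPower.
Variable R : realType.
Local Notation C := R[i].
Local Notation Re := (@complex.Re R).
Local Notation Im := (@complex.Im R).

Definition cis (a : R) : C := cos a +i* sin a.

Lemma cisD a b : cis (a + b) = cis a * cis b.
Proof. by rewrite /cis cosD sinD; simpc; congr (_ +i* _); ring. Qed.

Lemma cis0 : cis 0 = 1.
Proof. by rewrite /cis cos0 sin0. Qed.

Lemma normc_cis a : normc (cis a) = 1.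
Proof. by rewrite /cis /= cos2Dsin2 sqrtr1. Qed.

Lemma conj_cis a : Num.conj (cis a) = cis (- a).
Proof. by rewrite /cis cosN sinN. Qed.

Definition carg (x : C) : R :=
  if 0 <= Im x then acos (Re x / normc x) else - acos (Re x / normc x).

Lemma cos_ratio (x : C) : -1 <= Re x / normc x <= 1.
Proof.
have [->|x0] := eqVneq x 0; first by rewrite /= mul0r; apply/andP; split; lra.
have n0 : 0 < normc x.
  by rewrite lt0r normc_ge0 andbT; apply: contra x0 => /eqP/eq0_normc ->.
rewrite ler_pdivlMr // ler_pdivrMr // mul1r Re_le_normc andbT mulN1r lerNl -ReN.
by rewrite (le_trans (Re_le_normc _)) // normcN'.
Qed.

Lemma normc_gt0 (x : C) : (0 < normc x) = (x != 0).
Proof.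
rewrite lt0r normc_ge0 andbT; congr (~~ _); apply/eqP/eqP => [/eq0_normc //|->].
exact: normc0.
Qed.

Lemma carg_bound x : - pi <= carg x <= pi.
Proof.
have h := cos_ratio x; have := acos_ge0 h; have := acos_lepi h; have := @pi_ge0 R.
by rewrite /carg; case: ifP => _ *; apply/andP; split; lra.
Qed.

Lemma polar x : x != 0 -> x = (normc x)%:C * cis (carg x).
Proof.
move=> x0; have n0 : 0 < normc x by rewrite normc_gt0.
have h := cos_ratio x; have hh : Re x / normc x \in `[(-1), 1]%R by rewrite in_itv.
have c : cos (carg x) = Re x / normc x.
  by rewrite /carg; case: ifP => _; rewrite ?cosN acosK.
have s2 : sin (acos (Re x / normc x)) = `|Im x| / normc x.
  rewrite sin_acos //; have -> : 1 - (Re x / normc x) ^+ 2 = (Im x / normc x) ^+ 2.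
    have I2 : Im x ^+ 2 = normc x ^+ 2 - Re x ^+ 2 by rewrite normcE2 addrAC subrr add0r.
    by rewrite !exprMn I2 exprVn; field; rewrite gt_eqF.
  by rewrite sqrtr_sqr normrM normfV (gtr0_norm n0).
have s : sin (carg x) = Im x / normc x.
  rewrite /carg; case: ifP => [i0|/negbT]; rewrite ?sinN s2; first by rewrite ger0_norm.
  by rewrite -ltNge => i0; rewrite ltr0_norm // mulNr opprK.
rewrite /cis c s; case: x {c s s2 hh h} x0 n0 => a b x0 n0; simpc => /=.
by congr (_ +i* _); rewrite mulrC divfK // gt_eqF.
Qed.

Lemma carg_slit x : 0 < normc x + Re x -> - pi < carg x < pi.
Proof.
move=> hx; have x0 : x != 0 by apply: contraTneq hx => ->; rewrite normc0 /= addr0 ltxx.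
have n0 : 0 < normc x by rewrite normc_gt0.
have h : -1 < Re x / normc x <= 1.
  by have /andP[_ ->] := cos_ratio x; rewrite ltr_pdivlMr // andbT; lra.
have h' := cos_ratio x; have := acos_ge0 h'; have := acos_ltpi h; have := @pi_gt0 R.
by rewrite /carg; case: ifP => _ *; apply/andP; split; lra.
Qed.

Lemma carg_pos (a : R) : 0 < a -> carg a%:C = 0.
Proof.
by move=> a0; rewrite /carg lexx normcR /= gtr0_norm // divff ?gt_eqF // acos1.
Qed.

Definition cpow (e : R) (x : C) : C := (normc x `^ e)%:C * cis (e * carg x).

Lemma cpowD a b x : x != 0 -> cpow (a + b) x = cpow a x * cpow b x.
Proof.
move=> x0; have n0 : normc x != 0 by rewrite gt_eqF // normc_gt0.
rewrite /cpow powRD ?n0 ?implybT // mulrDl cisD rmorphM /=; ring.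
Qed.

Lemma cpow1 x : x != 0 -> cpow 1 x = x.
Proof. by move=> x0; rewrite /cpow powRr1 ?normc_ge0 // mul1r -polar. Qed.

Lemma cpow0 x : cpow 0 x = 1.
Proof. by rewrite /cpow powRr0 mul0r cis0 mulr1. Qed.

Lemma cpow_mulrn (e : R) n x : x != 0 -> cpow (n%:R * e) x = cpow e x ^+ n.
Proof.
move=> x0; elim: n => [|n IH]; first by rewrite mul0r cpow0.
by rewrite -addn1 natrD mulrDl mul1r cpowD // IH addn1 exprSr.
Qed.

Lemma cpowR (e a : R) : 0 < a -> cpow e a%:C = (a `^ e)%:C.
Proof.
by move=> a0; rewrite /cpow carg_pos // mulr0 cis0 mulr1 normcR gtr0_norm.
Qed.

Lemma normc_cpow e x : normc (cpow e x) = normc x `^ e.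
Proof. by rewrite /cpow normcM normc_cis mulr1 normcR ger0_norm // powR_ge0. Qed.

Lemma Re_cpow_gt0 e x : 0 < normc x + Re x -> `|e| <= 2^-1 -> 0 < Re (cpow e x).
Proof.
move=> hx he; have x0 : x != 0.
  by apply: contraTneq hx => ->; rewrite normc0 /= addr0 ltxx.
rewrite /cpow ReZ mulr_gt0 ?powR_gt0 ?normc_gt0 //= cos_gt0_pihalf //.
have /andP[h1 h2] := carg_slit hx; have p0 := @pi_gt0 R.
have : `|e * carg x| < pi / 2.
  rewrite normrM (@le_lt_trans _ _ (2^-1 * `|carg x|)) ?ler_wpM2r //.
  have : `|carg x| < pi by rewrite ltr_norml h1.
  by lra.
by rewrite ltr_norml.
Qed.

Lemma Re_sqrt_bound (x y : C) : y ^+ 2 = x -> Re y ^+ 2 = (normc x + Re x) / 2.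
Proof.
by move=> <-; rewrite normcX2 normcE2 [y ^+ 2]expr2 ReM; field.
Qed.

Lemma sqrtr_le (a y : R) : 0 <= y -> a <= y ^+ 2 -> Num.sqrt a <= y.
Proof. by move=> y0 h; rewrite -[leRHS](ger0_norm y0) -sqrtr_sqr ler_wsqrtr. Qed.

Section DyadicPowers.
Variables (K : C -> Prop) (S : (C -> C) -> Prop) (e0 c b : R).
Hypotheses (SA : uniform_algebra K S) (Sid : S id) (e0_gt0 : 0 < e0) (c0 : 0 < c).
Hypothesis Kb : forall x, K x -> normc (x - e0%:C) <= b.
Hypothesis Kc : forall x s, K x -> 0 <= s <= 1 ->
  let y := s%:C * (x - e0%:C) + e0%:C in c <= normc y + Re y.

Let slit x : K x -> 0 < normc x + Re x.
Proof.
move=> Kx; have s1 : 0 <= (1 : R) <= 1 by apply/andP; split; lra.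
by have := Kc Kx s1; rewrite /= mul1r subrK; exact: lt_le_trans.
Qed.

Let neq0 x : K x -> x != 0.
Proof. by move=> /slit; apply: contraTneq => ->; rewrite normc0 /= addr0 ltxx. Qed.

(** [ua_isqrt] gives the inverse root, and multiplying it by the previous power gives the root. The
    lower bound on the real part belongs to the induction: it keeps the segment from [1] to the next
    power off the slit. Only the first root is continued from [e0]. *)
Lemma dyadic_root k : S (cpow (2^-1 ^+ k.+1)) /\ S (cpow (- 2^-1 ^+ k.+1)) /\
  (exists m, 0 < m /\ forall x, K x -> m <= Re (cpow (2^-1 ^+ k.+1) x)).
Proof.
have small j : `|2^-1 ^+ j.+1 : R| <= 2^-1.
  rewrite ger0_norm ?exprn_ge0 ?invr_ge0 // exprS ler_piMr ?invr_ge0 //.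
  by rewrite exprn_ile1 ?invr_ge0 //; lra.
have half j x : K x -> cpow (2^-1 ^+ j.+1) x ^+ 2 = cpow (2^-1 ^+ j) x.
  move=> Kx; rewrite -cpow_mulrn ?neq0 //; congr (cpow _ x).
  by rewrite exprS; field.
have halfN j x : K x -> cpow (- 2^-1 ^+ j.+1) x ^+ 2 * cpow (2^-1 ^+ j) x = 1.
  move=> Kx; rewrite -(half j) // -exprMn -cpowD ?neq0 // addNr cpow0 expr1n //.
have sq j x : K x -> Re (cpow (2^-1 ^+ j.+1) x) ^+ 2 =
    (normc (cpow (2^-1 ^+ j) x) + Re (cpow (2^-1 ^+ j) x)) / 2.
  by move=> Kx; apply: Re_sqrt_bound; rewrite half.
have Rep j x : K x -> 0 < Re (cpow (2^-1 ^+ j.+1) x).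
  by move=> Kx; apply: Re_cpow_gt0; rewrite ?slit.
have step j : S (cpow (2^-1 ^+ j)) -> S (cpow (- 2^-1 ^+ j.+1)) ->
    S (cpow (2^-1 ^+ j.+1)).
  move=> S1 S2; apply: (ua_ext SA (ua_mul SA S1 S2)) => x Kx.
  by rewrite -cpowD ?neq0 //; congr (cpow _ x); rewrite exprS; lra.
elim: k => [|k IH].
  have S1 : S (cpow (2^-1 ^+ 0)).
    by apply: (ua_ext SA Sid) => x Kx; rewrite expr0 cpow1 ?neq0.
  have S2 : S (cpow (- 2^-1 ^+ 1)).
    apply: (ua_isqrt SA Sid c0 Kb Kc) => x Kx; split.
      by have := halfN 0 x Kx; rewrite expr0 cpow1 ?neq0.
    by apply: Re_cpow_gt0; rewrite ?slit ?normrN.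
  split; first exact: step.
  split=> //; exists (Num.sqrt (c / 2)); split; first by rewrite sqrtr_gt0 divr_gt0.
  move=> x Kx; have s1 : 0 <= (1 : R) <= 1 by apply/andP; split; lra.
  have := Kc Kx s1; rewrite /= mul1r subrK => h.
  apply: sqrtr_le; first exact/ltW/Rep.
  by rewrite sq // expr0 cpow1 ?neq0 //; lra.
case: IH => IH1 [IH2 [m [m0 hm]]].
have nb x : K x -> normc (cpow (2^-1 ^+ k.+1) x) <= 1 + (b + e0).
  move=> Kx; rewrite normc_cpow.
  have bx : normc x <= b + e0.
    have := normc_ge_sub x e0%:C; have := Kb Kx.
    by rewrite normcR (gtr0_norm e0_gt0); lra.
  have p0 : 0 <= 2^-1 ^+ k.+1 :> R by rewrite exprn_ge0 ?invr_ge0.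
  have p1 : 2^-1 ^+ k.+1 <= 1 :> R by rewrite exprn_ile1 ?invr_ge0 //; lra.
  have n0 := normc_ge0 x.
  have [n1|n1] := leP (normc x) 1.
    rewrite (@le_trans _ _ 1) //; last lra.
    rewrite -[leRHS](@powRr0 _ (normc x)) ger_powR // n1 andbT normc_gt0.
    exact: neq0.
  rewrite (@le_trans _ _ (normc x)) //; last lra.
  by rewrite -[leRHS](powRr1 n0) ler_powR // ltW.
have S2 : S (cpow (- 2^-1 ^+ k.+2)).
  apply: (@ua_isqrt _ _ _ _ SA _ _ 1 (Num.min m 1) (1 + (b + e0) + 1) IH1).
  - by rewrite lt_min m0 ltr01.
  - move=> x Kx; rewrite (le_trans (ler_normcB _ _)) // normc1 lerD2r; exact: nb.
  - move=> x s Kx /andP[s0 s1]; pose y := s%:C * (cpow (2^-1 ^+ k.+1) x - 1%:C) + 1%:C.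
    change (Num.min m 1 <= normc y + Re y).
    apply: (@le_trans _ _ (Re y)); last by rewrite lerDr normc_ge0.
    rewrite /y ReD ReZ ReB -[Re 1%:C]/(1 : R).
    have := hm x Kx; move: (Re (cpow _ x)) => r hr.
    have h1 : Num.min m 1 <= r by rewrite ge_min hr.
    have h2 : Num.min m 1 <= 1 by rewrite ge_min lexx orbT.
    move: (Num.min m 1) h1 h2 => mu h1 h2.
    have h3 : s * mu <= s * r by rewrite ler_wpM2l.
    have h4 : (1 - s) * mu <= (1 - s) * 1 by rewrite ler_wpM2l // subr_ge0.
    by lra.
  - move=> x Kx; split; first exact: halfN.
    by apply: Re_cpow_gt0; rewrite ?slit ?normrN.
split; first exact: step.
split=> //; exists (Num.sqrt (m / 2)); split; first by rewrite sqrtr_gt0 divr_gt0.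
move=> x Kx; apply: sqrtr_le; first exact/ltW/Rep.
rewrite sq //; have := hm x Kx; have := normc_ge0 (cpow (2^-1 ^+ k.+1) x); lra.
Qed.

Lemma dyadic_power (j k : nat) :
  S (cpow (j%:R * 2^-1 ^+ k.+1)) /\ S (cpow (- (j%:R * 2^-1 ^+ k.+1))).
Proof.
have [h1 [h2 _]] := dyadic_root k; split.
  by apply: (ua_ext SA (ua_exp SA j h1)) => x Kx; rewrite cpow_mulrn ?neq0.
by apply: (ua_ext SA (ua_exp SA j h2)) => x Kx; rewrite -mulrN cpow_mulrn ?neq0.
Qed.

End DyadicPowers.

(* For [|z| = 1] the eigenvalues [eps + s z] ([s] real) have their argument in
   [[arg_lo z, arg_hi z]], an interval of length [pi] containing [0] and having [arg z] as an
   end point. *)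
Definition arg_lo (z : C) : R :=
  if normc z == 1 then (if 0 <= carg z then carg z - pi else carg z) else 0.
Definition arg_hi (z : C) : R :=
  if normc z == 1 then (if 0 <= carg z then carg z else carg z + pi) else 0.

Lemma arg_lohi z : [/\ arg_lo z <= 0, 0 <= arg_hi z, arg_hi z - arg_lo z <= pi &
  `|arg_lo z + arg_hi z| <= pi].
Proof.
rewrite /arg_lo /arg_hi; have := @pi_ge0 R; case: eqP => _ p0; last first.
  by rewrite addr0 normr0 subr0; split.
have /andP[h1 h2] := carg_bound z; rewrite ler_norml.
by have [h|h] := leP 0 (carg z); (split; [lra|lra|lra|apply/andP; split; lra]).
Qed.

(** Multiplied by the conjugate of [z], the point [eps + s z] has imaginary part
    [- eps sin (arg z)], whatever [s] is. So it lies on the same side of the line through [0] and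
    [z] as the positive half-axis. *)
Lemma arg_cone (eps s : R) (z x : C) : 0 < eps -> normc z = 1 ->
  x = eps%:C + s%:C * z -> 0 < normc x + Re x -> arg_lo z <= carg x <= arg_hi z.
Proof.
move=> e0 nz xE hx; have x0 : x != 0.
  by apply: contraTneq hx => ->; rewrite normc0 /= addr0 ltxx.
have z0 : z != 0 by rewrite -normc_gt0 nz ltr01.
have n0 : 0 < normc x by rewrite normc_gt0.
rewrite /arg_lo /arg_hi nz eqxx.
have zE : z = cis (carg z) by rewrite {1}(polar z0) nz mul1r.
have /andP[t1 t2] := carg_bound z; have /andP[f1 f2] := carg_slit hx.
set th := carg z in zE t1 t2 *; set ph := carg x in f1 f2 *.
have E : normc x * sin (ph - th) = - eps * sin th.
  have : (normc x)%:C * cis (ph - th) = eps%:C * cis (- th) + s%:C.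
    rewrite cisD mulrA -(polar x0) -conj_cis -zE {1}xE mulrDl -mulrA mulcJ nz.
    by rewrite expr1n mulr1.
  by move=> /(congr1 Im) /=; rewrite sinN !mul0r !addr0 => ->; ring.
have sp a : 0 < a < pi -> 0 < sin a := @sin_gt0_pi R a.
have p0 := @pi_gt0 R.
have [th0|th0] := leP 0 th.
  have st : 0 <= sin th by rewrite sin_ge0_pi // th0.
  have sle : sin (ph - th) <= 0 by rewrite -(pmulr_rle0 _ n0) E; nra.
  apply/andP; split; rewrite leNgt; apply/negP => h; have : 0 < sin (ph - th).
  - rewrite -(sinD2pi (ph - th)) sp // mulr2n; apply/andP; split; lra.
  - by rewrite ltNge sle.
  - by apply: sp; apply/andP; split; lra.
  - by rewrite ltNge sle.
have st : sin th <= 0.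
  by rewrite -oppr_ge0 -sinN sin_ge0_pi //; apply/andP; split; lra.
have sge : 0 <= sin (ph - th) by rewrite -(pmulr_rge0 _ n0) E; nra.
apply/andP; split; rewrite leNgt; apply/negP => h.
- have : 0 < sin (- (ph - th)) by apply: sp; apply/andP; split; lra.
  by rewrite sinN oppr_gt0 ltNge sge.
- have : 0 < sin (ph - th - pi) by apply: sp; apply/andP; split; lra.
  by have := sinDpi (ph - th - pi); rewrite subrK => E2; move: sge; rewrite E2; lra.
Qed.

(** Since [1 - z^-2 = z^-1 (z - z^-1)], the real part is [- 2 rho sin th sin (psi - th)] with
    [th = arg z], and the two sines have opposite signs on the cone. *)
Lemma cone_sign (z : C) (rho psi : R) : normc z = 1 -> 0 <= rho ->
  arg_lo z <= psi <= arg_hi z -> 0 <= Re (rho%:C * cis psi * (1 - z ^- 2)).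
Proof.
move=> nz r0; rewrite /arg_lo /arg_hi nz eqxx.
have z0 : z != 0 by rewrite -normc_gt0 nz ltr01.
have zE : z = cis (carg z) by rewrite {1}(polar z0) nz mul1r.
have /andP[t1 t2] := carg_bound z; set th := carg z in zE t1 t2 *.
have zi : z^-1 = cis (- th).
  by apply: (mulfI z0); rewrite divff // zE -cisD subrr cis0.
have -> : rho%:C * cis psi * (1 - z ^- 2) = rho%:C * (cis (psi - th) * (cis th - cis (- th))).
  have E1 : 1 = cis (- th) * cis th by rewrite -cisD addNr cis0.
  by rewrite -exprVn zi {1}E1 (cisD psi); ring.
rewrite ReZ => hpsi; apply: mulr_ge0 => //.
have -> : Re (cis (psi - th) * (cis th - cis (- th))) = - (2 * (sin th * sin (psi - th))).
  by rewrite /cis cosN sinN /=; ring.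
rewrite oppr_ge0 pmulr_rle0 //; move: hpsi; have [h|h] := leP 0 th => /andP[a1 a2].
  have s1 : 0 <= sin th by rewrite sin_ge0_pi // h.
  have s2 : 0 <= sin (- (psi - th)) by rewrite sin_ge0_pi //; apply/andP; split; lra.
  by rewrite sinN in s2; nra.
have s1 : 0 <= sin (- th) by rewrite sin_ge0_pi //; apply/andP; split; lra.
have s2 : 0 <= sin (psi - th) by rewrite sin_ge0_pi //; apply/andP; split; lra.
by rewrite sinN in s1; nra.
Qed.

End ComplexPower.

(** * Diagonalisation and dyadic powers of the matrix family *)

Section SpectralFamily.
Variable R : realType.
Local Notation C := R[i].
Local Notation Re := (@complex.Re R).
Local Notation Im := (@complex.Im R).

Definition slit_bound (eps del B : R) : R :=
  Num.min (eps / 2) ((del * (eps / 2)) ^+ 2 / (2 * (B + eps))).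

Lemma slit_bound_gt0 eps del B : 0 < eps -> 0 < del -> 0 <= B -> 0 < slit_bound eps del B.
Proof.
move=> e0 d0 B0; rewrite /slit_bound lt_min; apply/andP; split; first lra.
by apply: divr_gt0; [apply: exprn_gt0; apply: mulr_gt0; lra | lra].
Qed.

(** Either the real part is at least [eps / 2], or [|s| > eps / 2] and [|Im w| >= del]. In the
    second case [(|x| + Re x) (|x| - Re x) = (Im x)^2] bounds the first factor from below, the
    second being at most [2 (B + eps)]. *)
Lemma slit_lower (eps del B s : R) (w : C) : 0 < eps -> 0 < del -> normc w = 1 ->
  `|s| <= B -> del <= `|Im w| \/ 0 <= s * Re w ->
  slit_bound eps del B <= normc (eps%:C + s%:C * w) + Re (eps%:C + s%:C * w).
Proof.
move=> e0 d0 nw sB h; set x : C := eps%:C + s%:C * w.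
have Rx : Re x = eps + s * Re w by rewrite ReD ReZ.
have Ix : Im x = s * Im w by rewrite /x; case: (w) => a b /=; ring.
have n0 := normc_ge0 x.
case: h => h; last first.
  by apply: (@le_trans _ _ (eps / 2)); [rewrite /slit_bound ge_min lexx | rewrite Rx; lra].
have [se|se] := leP `|s| (eps / 2).
  apply: (@le_trans _ _ (eps / 2)); first by rewrite /slit_bound ge_min lexx.
  have : `|s * Re w| <= eps / 2.
    rewrite normrM; apply: le_trans se; rewrite ler_piMr //.
    have := Re_le_normc w; have := Re_le_normc (- w); rewrite ReN normcN' nw.
    by rewrite ler_norml; move=> *; apply/andP; split; lra.
  by rewrite ler_norml => /andP[a1 a2]; rewrite Rx; lra.
rewrite (@le_trans _ _ ((del * (eps / 2)) ^+ 2 / (2 * (B + eps)))) //.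
  by rewrite /slit_bound ge_min lexx orbT.
have B0 : 0 <= B by apply: le_trans sB.
have BE : 0 < B + eps by rewrite ltr_wpDl.
have I2 : (del * (eps / 2)) ^+ 2 <= Im x ^+ 2.
  rewrite -[leRHS]real_normK ?num_real // Ix normrM [_ * `|_|]mulrC.
  have e2 : 0 <= eps / 2 by lra.
  have mm : del * (eps / 2) <= `|Im w| * `|s| by apply: ler_pM; lra.
  have m0 : 0 <= del * (eps / 2) by apply: mulr_ge0 => //; exact: ltW.
  by rewrite lerXn2r ?nnegrE // (le_trans m0).
have nx : normc x <= B + eps.
  rewrite (le_trans (ler_normcD _ _)) // normcM !normcR nw mulr1 (gtr0_norm e0); lra.
have Rle := Re_le_normc (- x); rewrite ReN normcN' in Rle.
have E : (normc x + Re x) * (normc x - Re x) = Im x ^+ 2.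
  by rewrite mulrC -subr_sqr normcE2; ring.
rewrite ler_pdivrMr ?mulr_gt0 //; apply: le_trans I2 _; rewrite -E.
by apply: ler_wpM2l; lra.
Qed.

Variables (n : nat) (A H : 'M[C]_n) (eps : R).
Hypotheses (hA : hermitian_mx A) (hH : hermitian_mx H).
Hypotheses (pdP : pdmx ((2 : R)%:C *: A + H)) (pdN : pdmx ((2 : R)%:C *: A - H)).
Hypothesis eps_gt0 : 0 < eps.

Definition Gam (z : C) : 'M[C]_n := (1 + z ^+ 2) *: A + z *: H + (eps%:C)%:M.

Lemma specmx_affine (U : 'M[C]_n) (s : 'I_n -> R) (w : C) : U \is unitarymx ->
  w *: specmx U (fun i => (s i)%:C) + (eps%:C)%:M =
  specmx U (fun i => eps%:C + (s i)%:C * w).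
Proof.
move=> hU; rewrite -(specmx_const eps%:C hU) specmxZ specmxD.
by apply: eq_specmx => i; rewrite addrC mulrC.
Qed.

Lemma segment_ge0 (x qa qh : R) : 0 <= 2 * qa + qh -> 0 <= 2 * qa - qh ->
  0 <= (1 + x ^+ 2) * qa + x * qh.
Proof.
move=> h1 h2; have -> : (1 + x ^+ 2) * qa + x * qh =
  ((1 + x) ^+ 2 * (2 * qa + qh) + (1 - x) ^+ 2 * (2 * qa - qh)) / 4 by field.
by rewrite divr_ge0 // addr_ge0 // mulr_ge0 ?sqr_ge0.
Qed.

(** On the circle [w = z] and the [s i] are the eigenvalues of [2 Re z A + H]. The point [eps + s z]
    can approach the slit only for [z] near [1] or [-1]; there the definiteness of [2 A + H] and
    [2 A - H] gives [s] the sign of [Re z]. Inside the diameter the same hypotheses make the matrix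
    semidefinite, and [w = 1]. *)
Lemma Gam_diag : exists B del, [/\ 0 <= B, 0 < del & forall z, circle_diam z ->
  exists U (s : 'I_n -> R) (w : C),
  [/\ U \is unitarymx, Gam z = specmx U (fun i => eps%:C + (s i)%:C * w), normc w = 1,
      forall i, `|s i| <= B /\ (del <= `|Im w| \/ 0 <= s i * Re w) &
      (normc z = 1 -> w = z) /\ (normc z != 1 -> w = 1 /\ forall i, 0 <= s i)]].
Proof.
have [a a0 ha] := herm_upper hA; have [h h0 hh] := herm_upper hH.
have [m1 m10 hm1] := pd_lower pdP; have [m2 m20 hm2] := pd_lower pdN.
pose m := Num.min m1 m2; have m0 : 0 < m by rewrite lt_min m10.
have mP v : m * sqnorm v <= 2 * qf A v + qf H v.
  rewrite -qfZ -qfD (le_trans _ (hm1 v)) // ler_wpM2r ?sqnorm_ge0 //.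
  by rewrite ge_min lexx.
have mN v : m * sqnorm v <= 2 * qf A v - qf H v.
  rewrite -qfZ -qfB (le_trans _ (hm2 v)) // ler_wpM2r ?sqnorm_ge0 //.
  by rewrite ge_min lexx orbT.
(* If [|Im z| < del], then [1 - |Re z| <= del]; replacing [Re z] by its sign then changes the form
   of [2 Re z A] on unit vectors by at most [2 a del <= m]. *)
pose del := Num.min 1 (m / (2 * a)).
have del0 : 0 < del by rewrite lt_min ltr01 divr_gt0 // mulr_gt0.
have del1 : del <= 1 by rewrite ge_min lexx.
have delm : del * (2 * a) <= m.
  by rewrite -ler_pdivlMr ?mulr_gt0 // ge_min lexx orbT.
exists (2 * a + h), del; split=> //; first by rewrite addr_ge0 ?mulr_ge0 // ltW.
move=> z Ez; have [nz|nz] := eqVneq (normc z) 1.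
  pose S := (2 * Re z)%:C *: A + H.
  have hS : hermitian_mx S by apply: hermD => //; exact: hermZ.
  have [U [s [hU ES]]] := herm_spec hS.
  have sE i : s i = 2 * Re z * qf A (row i U) + qf H (row i U).
    by rewrite -(qf_row_specmx s i hU) -ES qfD qfZ.
  have r2 := normcE2 z; rewrite nz expr1n in r2.
  have Rz1 : `|Re z| <= 1.
    by rewrite -(@expr_le1 _ 2) // real_normK ?num_real //; have := sqr_ge0 (Im z); lra.
  exists U, s, z; split; [exact: hU | | exact: nz | | by split=> //; rewrite nz eqxx].
  - rewrite -specmx_affine // -ES /S /Gam scalerDr scalerA; congr (_ *: _ + _ + _).
    case: (z) r2 => x y /= r2; simpc; congr (_ +i* _); last ring.
    by move: r2; lra.
  - move=> i; have n1 := sqnorm_row_unitary i hU; split.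
      have := ha (row i U); have := hh (row i U); rewrite n1 !mulr1 sE => h1 h2.
      rewrite (le_trans (ler_normD _ _)) // lerD // !normrM ger0_norm //.
      rewrite -mulrA ler_pM2l //; have := normr_ge0 (qf A (row i U)).
      by have := normr_ge0 (Re z); nra.
    have [dz|dz] := leP del `|Im z|; [by left | right].
    have I2 : Im z ^+ 2 <= del.
      rewrite -real_normK ?num_real //; have := normr_ge0 (Im z); nra.
    have := mP (row i U); have := mN (row i U); rewrite n1 mulr1 sE.
    have := ha (row i U); rewrite n1 mulr1 ler_norml => /andP[_].
    have := mP (row i U); have := mN (row i U); rewrite n1 mulr1.
    move: (qf A _) (qf H _) => qa qh b1 b2 b3 b4 b5; clear sE ES hS n1 ha hh mP mN.
    have qa0 : 0 <= 2 * qa by lra.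
    have qaa : 2 * qa <= 2 * a by lra.
    move: Rz1; rewrite ler_norml => /andP[z1 z2].
    have [r0|r0] := leP 0 (Re z).
      rewrite mulr_ge0 //; have d1 : 1 - Re z <= del by nra.
      have : (1 - Re z) * (2 * qa) <= del * (2 * a) by apply: ler_pM => //; rewrite subr_ge0.
      by lra.
    rewrite nmulr_lge0 //; have d1 : 1 + Re z <= del by nra.
    have z3 : 0 <= 1 + Re z by lra.
    have : (1 + Re z) * (2 * qa) <= del * (2 * a) by apply: ler_pM.
    by lra.
case: Ez => [E|[Iz Nz]]; first by rewrite E eqxx in nz.
pose x := Re z; have zx : z = x%:C by case: (z) Iz @x => u v /= ->.
have x1 : `|x| <= 1 by rewrite -normcR -zx.
pose S := (1 + x ^+ 2)%:C *: A + x%:C *: H.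
have hS : hermitian_mx S by apply: hermD; exact: hermZ.
have [U [s [hU ES]]] := herm_spec hS.
have sE i : s i = (1 + x ^+ 2) * qf A (row i U) + x * qf H (row i U).
  by rewrite -(qf_row_specmx s i hU) -ES qfD !qfZ.
have x2 : x ^+ 2 <= 1 by rewrite -real_normK ?num_real // exprn_ile1.
have s0 i : 0 <= s i.
  have := mP (row i U); have := mN (row i U).
  rewrite sE (sqnorm_row_unitary i hU) mulr1.
  by move=> b1 b2; apply: segment_ge0; exact: le_trans (ltW m0) _.
exists U, s, 1; split; first exact: hU.
- rewrite -(specmx_affine s 1 hU) -ES scale1r.
  by rewrite /Gam /S rmorphD rmorph1 rmorphXn /= -zx.
- by rewrite normc1.
- move=> i; have n1 := sqnorm_row_unitary i hU; split; last first.
    by right; rewrite mulr1.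
  have := ha (row i U); have := hh (row i U); rewrite n1 !mulr1 sE => h1 h2.
  rewrite (le_trans (ler_normD _ _)) // lerD // !normrM.
    have -> : `|1 + x ^+ 2| = 1 + x ^+ 2 by rewrite ger0_norm // addr_ge0 ?sqr_ge0.
    by apply: ler_pM => //; [rewrite addr_ge0 ?sqr_ge0 | lra].
  rewrite -[leRHS]mul1r; exact: ler_pM.
by split=> // E; rewrite E eqxx in nz.
Qed.

Lemma normc_unitary_le1 (U : 'M[C]_n) i j : U \is unitarymx -> normc (U i j) <= 1.
Proof.
move=> hU; have := sqnorm_row_unitary i hU; rewrite /sqnorm (bigD1 j) //= mxE => E.
rewrite -(@expr_le1 _ 2) ?normc_ge0 // -E lerDl sumr_ge0 // => k _; exact: sqr_ge0.
Qed.

Lemma subrmxE m p (X Y : 'M[C]_(m, p)) i j : (X - Y) i j = X i j - Y i j.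
Proof. by rewrite !mxE. Qed.

(** The eigenvectors [U z] are chosen pointwise, without any continuity in [z]; only the assembled
    matrix has to be a limit of polynomials. This reduces matrix powers to the scalar statement on
    the set [K] of eigenvalues. *)
Lemma specmx_calculus_ua (U : C -> 'M[C]_n) (d : C -> 'I_n -> C) (K : C -> Prop) :
  (forall z, circle_diam z -> U z \is unitarymx) ->
  (forall z i, circle_diam z -> K (d z i)) ->
  uniform_algebra K (fun phi => mx_approx (fun z => specmx (U z) (fun i => phi (d z i)))).
Proof.
move=> hU hK; split.
- move=> c; apply: (mx_approx_ext (mx_approx_const c%:M)) => z Ez.
  by rewrite specmx_const // hU.
- move=> f g hf hg; apply: (mx_approx_ext (mx_approx_add hf hg)) => z _.
  by rewrite specmxD.
- move=> f g hf hg; apply: (mx_approx_ext (mx_approx_mul hf hg)) => z Ez.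
  by rewrite (specmxM _ _ (hU z Ez)).
- move=> f hf; apply: mx_approx_lim => e e0.
  have e1 : 0 < e / (n%:R + 1) by rewrite divr_gt0 // ltr_wpDl.
  have [g hg fg] := hf _ e1.
  exists (fun z => specmx (U z) (fun i => g (d z i))) => // z Ez i j.
  rewrite subrmxE.
  have -> : specmx (U z) (fun i => f (d z i)) i j - specmx (U z) (fun i => g (d z i)) i j =
     \sum_a (U z a i)^* * (f (d z a) - g (d z a)) * U z a j.
    by rewrite !specmxE -sumrB; apply: eq_bigr => a _; rewrite mulrBr mulrBl.
  apply: le_trans (ler_normc_sum _ _ _) _.
  apply: (@le_trans _ _ (\sum_(a < n) e / (n%:R + 1))).
    apply: ler_sum => a _; rewrite !normcM normcJ'.
    have u1 := normc_unitary_le1 a i (hU z Ez); have u2 := normc_unitary_le1 a j (hU z Ez).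
    apply: le_trans (fg _ (hK z a Ez)).
    apply: (@le_trans _ _ (normc (U z a i) * normc (f (d z a) - g (d z a)))).
      by rewrite ler_piMr // mulr_ge0 ?normc_ge0.
    by rewrite ler_piMl ?normc_ge0.
  rewrite sumr_const card_ord -[_ *+ n]mulr_natl mulrA ler_pdivrMr ?ltr_wpDl //.
  by rewrite mulrC ler_pM2l // lerDl.
Qed.

Lemma Gam_approx : mx_approx Gam.
Proof.
apply: mx_approx_add (mx_approx_const _); apply: mx_approx_add.
  apply: mx_approx_scale (mx_approx_const _).
  by apply: poly_approx_add (poly_approx_const 1) (poly_approx_mul _ _); exact: poly_approx_id.
by apply: mx_approx_scale (mx_approx_const _); exact: poly_approx_id.
Qed.

Lemma pow_family : exists (U : C -> 'M[C]_n) (d : C -> 'I_n -> C),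
  [/\ forall z, circle_diam z -> U z \is unitarymx,
   forall j k, mx_approx (fun z => specmx (U z) (fun i => cpow (j%:R * 2^-1 ^+ k.+1) (d z i))) /\
      mx_approx (fun z => specmx (U z) (fun i => cpow (- (j%:R * 2^-1 ^+ k.+1)) (d z i))),
   exists m M, 0 < m /\ forall z i, circle_diam z -> m <= normc (d z i) <= M,
   forall z i, circle_diam z -> arg_lo z <= carg (d z i) <= arg_hi z &
   forall (x e : R), `|x| < 1 -> specmx (U x%:C) (fun i => cpow e (d x%:C i)) =
      mxfun (fun y => y `^ e) (Gam x%:C)].
Proof.
have [B [del [B0 del0 hdiag]]] := Gam_diag.
have /choice[f hf] : forall z, exists t : 'M[C]_n * ('I_n -> R) * C, circle_diam z ->
  [/\ t.1.1 \is unitarymx, Gam z = specmx t.1.1 (fun i => eps%:C + (t.1.2 i)%:C * t.2),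
      normc t.2 = 1,
      forall i, `|t.1.2 i| <= B /\ (del <= `|Im t.2| \/ 0 <= t.1.2 i * Re t.2) &
      (normc z = 1 -> t.2 = z) /\ (normc z != 1 -> t.2 = 1 /\ forall i, 0 <= t.1.2 i)].
  move=> z; have [Ez|nE] := pselect (circle_diam z); last first.
    by exists (0, (fun _ => 0), 0).
  by have [U [s [w hw]]] := hdiag z Ez; exists (U, s, w).
pose U z := (f z).1.1; pose s z i := (f z).1.2 i; pose w z := (f z).2.
pose d z i := eps%:C + (s z i)%:C * w z.
(* Shrinking [t] keeps a point in [K], so [K] is star-shaped about [eps], and the slit bound on [K]
   holds along all segments to [eps]. *)
pose K (x : C) := exists (t : R) (v : C), [/\ normc v = 1, `|t| <= B, x = eps%:C + t%:C * v &
   del <= `|Im v| \/ 0 <= t * Re v].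
have hU z : circle_diam z -> U z \is unitarymx by move=> Ez; have [] := hf z Ez.
have dK z i : circle_diam z -> K (d z i).
  move=> Ez; have [_ _ h3 h4 _] := hf z Ez; have [h5 h6] := h4 i.
  by exists (s z i), (w z).
have SA := specmx_calculus_ua hU dK.
have Sid : mx_approx (fun z => specmx (U z) (fun i => id (d z i))).
  by apply: (mx_approx_ext Gam_approx) => z Ez; have [_ -> _ _ _] := hf z Ez.
have c0 := slit_bound_gt0 eps_gt0 del0 B0.
have Kb x : K x -> normc (x - eps%:C) <= B.
  move=> [t [v [nv tB -> _]]]; rewrite addrAC subrr add0r normcM normcR nv mulr1 //.
have Kslit x : K x -> slit_bound eps del B <= normc x + Re x.
  by move=> [t [v [nv tB -> ht]]]; exact: slit_lower.
have Kc x t : K x -> 0 <= t <= 1 ->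
   let y := t%:C * (x - eps%:C) + eps%:C in slit_bound eps del B <= normc y + Re y.
  move=> [t' [v [nv tB -> ht]]] /andP[t0 t1]; apply: Kslit; exists (t * t'), v; split=> //.
  - rewrite normrM ger0_norm // (le_trans _ tB) // ler_piMl //.
  - by rewrite rmorphM /=; ring.
  - by case: ht => ht; [left | right; rewrite -mulrA mulr_ge0].
exists U, d; split; first exact: hU.
- by move=> j k; exact: (dyadic_power SA Sid eps_gt0 c0 Kb Kc).
- exists (slit_bound eps del B / 2), (B + eps); split; first by rewrite divr_gt0.
  move=> z i Ez; have Kd := dK z i Ez; apply/andP; split.
    have := Kslit _ Kd; have := Re_le_normc (d z i); lra.
  have := Kb _ Kd; have := normc_ge_sub (d z i) eps%:C; rewrite normcR gtr0_norm //; lra.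
- move=> z i Ez; have [_ _ h3 _ [h5 h6]] := hf z Ez.
  have [nz|nz] := eqVneq (normc z) 1.
    apply: (arg_cone (s := s z i) eps_gt0 nz); first by rewrite /d /w h5.
    by apply: lt_le_trans c0 (Kslit _ (dK z i Ez)).
  rewrite /arg_lo /arg_hi (negPf nz); have [w1 s0] := h6 nz.
  rewrite /d /w w1 mulr1 -rmorphD carg_pos ?lexx //.
  by rewrite ltr_pwDl // s0.
- move=> x e x1; have Ex : circle_diam x%:C by right; rewrite normcR ltW.
  have nx : normc x%:C != 1 by rewrite normcR lt_eqF.
  have [h1 h2 h3 h4 [h5 h6]] := hf _ Ex; have [w1 s0] := h6 nx.
  have dE i : d x%:C i = (eps + s x%:C i)%:C by rewrite /d /w w1 mulr1 rmorphD.
  have -> : Gam x%:C = specmx (U x%:C) (fun i => (eps + s x%:C i)%:C).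
    by rewrite h2; apply: eq_specmx => i; rewrite -dE.
  rewrite (mxfun_specmx _ _ h1); apply: eq_specmx => i.
  by rewrite dE cpowR // ltr_pwDl // s0.
Qed.

End SpectralFamily.

(** * Positive maps and the extension of the Lieb function to the circle *)

Section Lieb.
Variable R : realType.
Local Notation C := R[i].
Local Notation Re := (@complex.Re R).

Definition mpow (e : R) n (A : 'M[C]_n) : 'M[C]_n := mxfun (fun y => y `^ e) A.

Lemma mpow_specmx e n (U : 'M[C]_n) (d : 'I_n -> R) : U \is unitarymx ->
  mpow e (specmx U (fun i => (d i)%:C)) = specmx U (fun i => (d i `^ e)%:C).
Proof. exact: mxfun_specmx. Qed.

Lemma mpow_pd e n (A : 'M[C]_n) : pdmx A -> pdmx (mpow e A).
Proof.
move=> /pd_spec[U [d [hU -> d0]]]; rewrite (mpow_specmx _ _ hU).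
by apply: pd_specmx => // i; exact: powR_gt0.
Qed.

Lemma mpow_scale e n (A : 'M[C]_n) (c : R) : pdmx A -> 0 < c ->
  mpow e (c%:C *: A) = (c `^ e)%:C *: mpow e A.
Proof.
move=> /pd_spec[U [d [hU -> d0]]] c0; rewrite (mpow_specmx _ _ hU) !specmxZ.
have -> : specmx U (fun i => c%:C * (d i)%:C) = specmx U (fun i => (c * d i)%:C).
  by apply: eq_specmx => i; rewrite rmorphM.
rewrite (mpow_specmx _ _ hU); apply: eq_specmx => i.
by rewrite powRM ?ltW // rmorphM.
Qed.

Lemma pdD n (A B : 'M[C]_n) : pdmx A -> psdmx B -> pdmx (A + B).
Proof.
move=> /pdmxP[hA h1] /psdmxP[hB h2]; apply/pdmxP; split=> [|v v0]; first exact: hermD.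
by rewrite qfD ltr_pwDl // h1.
Qed.

Lemma pdZ n (A : 'M[C]_n) (c : R) : 0 < c -> pdmx A -> pdmx (c%:C *: A).
Proof.
move=> c0 /pdmxP[hA h]; apply/pdmxP; split=> [|v v0]; first exact: hermZ.
by rewrite qfZ mulr_gt0 // h.
Qed.

Lemma psdZ n (A : 'M[C]_n) (c : R) : 0 <= c -> psdmx A -> psdmx (c%:C *: A).
Proof.
move=> c0 /psdmxP[hA h]; apply/psdmxP; split=> [|v]; first exact: hermZ.
by rewrite qfZ mulr_ge0.
Qed.

Lemma pd1 n : pdmx (1%:M : 'M[C]_n).
Proof.
by apply/pdmxP; split=> [|v v0]; [exact: herm1 | rewrite qf1 sqnorm_gt0].
Qed.

Lemma psd_scalar n (c : R) : 0 <= c -> psdmx (c%:C%:M : 'M[C]_n).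
Proof. by move=> c0; rewrite -scalemx1; apply: psdZ c0 _; exact/pd_psd/pd1. Qed.

Lemma pd_convex n (A B : 'M[C]_n) (t : R) : pdmx A -> pdmx B -> 0 <= t <= 1 ->
  pdmx (t%:C *: A + (1 - t)%:C *: B).
Proof.
move=> hA hB /andP[t0 t1]; have [->|tn] := eqVneq t 0.
  by rewrite scale0r add0r subr0 scale1r.
by apply: pdD; [apply: pdZ => //; rewrite lt0r tn | apply: psdZ; [lra | exact: pd_psd]].
Qed.

Lemma pd_unit n (A : 'M[C]_n) : pdmx A -> A \in unitmx.
Proof.
move=> /pd_lower[m m0 h]; apply: (coercive_unit (e := 1) m0) => v.
by rewrite mul1r; exact: h.
Qed.

Lemma conj_mxE m n (M : 'M[C]_(m, n)) i j : Num.conj (M i j) = M^t* j i.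
Proof. by rewrite !mxE. Qed.

(** Inversion conjugates the values of the form. So inverting [Phi (A ^ (- p))], whose arguments
    have the opposite sign, leads back to the cone of [A ^ p]. *)
Lemma hf_invmx n (Y : 'M[C]_n) v : Y \in unitmx ->
  hf (invmx Y) v = Num.conj (hf Y (v *m invmx Y)).
Proof.
move=> uY; rewrite /hf conj_mxE adjM trmxCK.
by rewrite -[v *m invmx Y *m Y]mulmxA (mulVmx uY) mulmx1.
Qed.

Lemma invmx_herm n (Y : 'M[C]_n) : Y \in unitmx -> hermitian_mx Y -> hermitian_mx (invmx Y).
Proof.
move=> uY hY; rewrite /hermitian_mx; apply: (can_inj (mulmxK uY)); rewrite (mulVmx uY).
by rewrite -{2}hY -adjM (mulmxV uY) adj1.
Qed.

Lemma invmx_pd n (Y : 'M[C]_n) : pdmx Y -> pdmx (invmx Y).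
Proof.
move=> hY; have uY := pd_unit hY; have /pdmxP[hh hp] := hY; apply/pdmxP.
split=> [|v v0]; first exact: invmx_herm.
rewrite /qf (hf_invmx _ uY) ReJ; apply: hp; apply: contra v0 => /eqP E.
by rewrite -[v]mulmx1 -(mulVmx uY) mulmxA E mul0mx.
Qed.

Lemma hfB_vec n (X : 'M[C]_n) u w : hf X (u - w) =
  hf X u - (u *m X *m w^t*) 0 0 - (w *m X *m u^t*) 0 0 + (w *m X *m w^t*) 0 0.
Proof.
rewrite /hf adjB mulmxBr !mulmxBl.
move: (u *m X *m u^t*) (u *m X *m w^t*) (w *m X *m u^t*) (w *m X *m w^t*) => a b c d.
by rewrite !mxE; ring.
Qed.

Lemma Re_form_sym n (u v : 'rV[C]_n) : Re ((v *m u^t*) 0 0) = Re ((u *m v^t*) 0 0).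
Proof. by rewrite -[LHS]ReJ -[LHS]/(Re (Num.conj ((v *m u^t*) 0 0))) conj_mxE adjM trmxCK. Qed.

(** Expand [0 <= qf X (u - w)] with [u = v Y^-1] and [w = v X^-1]. Each cross term has real part
    [qf (invmx Y) v], the last term gives [qf (invmx X) v], and
    [qf X u <= qf Y u = qf (invmx Y) v]. *)
Lemma invmx_qf_le n (X Y : 'M[C]_n) : pdmx X -> pdmx Y ->
  (forall v, qf X v <= qf Y v) -> forall v, qf (invmx Y) v <= qf (invmx X) v.
Proof.
move=> hX hY h v; have uX := pd_unit hX; have uY := pd_unit hY.
have /pd_psd/psdmxP[_ pX] := hX; have [hhX _] := hX; have [hhY _] := hY.
pose u := v *m invmx Y; pose w := v *m invmx X.
have E1 : qf (invmx Y) v = Re ((u *m v^t*) 0 0) := erefl _.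
have E2 : qf (invmx X) v = Re ((w *m v^t*) 0 0) := erefl _.
have E3 : qf Y u = qf (invmx Y) v by rewrite /qf (hf_invmx _ uY) ReJ.
have wX : w *m X = v by rewrite /w -mulmxA (mulVmx uX) mulmx1.
have Xw : X *m w^t* = v^t* by rewrite -{1}hhX -adjM wX.
have P : 0 <= qf X u - Re ((u *m v^t*) 0 0) - Re ((v *m u^t*) 0 0) +
    Re ((v *m w^t*) 0 0).
  have := pX (u - w); rewrite {1}/qf hfB_vec wX -(mulmxA u X (w^t*)) Xw.
  by rewrite ReD !ReB.
have fin (a s t s' t' : R) : 0 <= a - s - s' + t' -> s' = s -> t' = t -> a <= s -> s <= t.
  by move=> h1 e1 e2 h2; rewrite e1 e2 in h1; clear -h1 h2; lra.
have hu : qf X u <= Re ((u *m v^t*) 0 0) by have := h u; rewrite E3 E1.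
rewrite E1 E2; exact: (fin _ _ _ _ _ P (Re_form_sym u v) (Re_form_sym w v) hu).
Qed.

Lemma hf_specmx_rows k (V : 'M[C]_k) (y : 'I_k -> C) (M : 'M[C]_k) :
  \tr (M *m specmx V y) = \sum_j y j * hf M (row j V).
Proof.
rewrite specmx_sum mulmx_sumr raddf_sum /=; apply: eq_bigr => j _.
rewrite -scalemxAr mxtraceZ; congr (_ * _); rewrite mulmxA mxtrace_mulC mulmxA /hf.
by rewrite /mxtrace big_ord1.
Qed.

Section PositiveMap.
Variables (n l : nat) (Phi : {linear 'M[C]_n -> 'M[C]_l}).
Hypothesis sp : strictly_positive Phi.

(** Strict positivity applies to [X + e 1]; then [e] tends to [0]. Hermitian symmetry is read off
    from a difference of two definite images. *)
Lemma posmap_psd X : psdmx X -> psdmx (Phi X).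
Proof.
move=> hX; have h1 := sp (pd1 n).
have hE (e : R) : 0 < e -> pdmx (Phi X + e%:C *: Phi 1%:M).
  move=> e0; rewrite -linearZ -linearD addrC; apply: sp; apply: pdD hX.
  exact: pdZ (pd1 n).
have /pdmxP[H1 _] := h1; apply/psdmxP; split.
  have [H2 _] := hE 1 ltr01; rewrite rmorph1 scale1r in H2.
  by have := hermD H2 (hermZ (-1) H1); rewrite rmorphN rmorph1 scaleN1r addrK.
move=> v; apply: (@le_of_small R _ _ (qf (Phi 1%:M) v)) => [|e e0].
  by have /pd_psd/psdmxP[] := h1.
have /pd_psd/psdmxP[_ /(_ v)] := hE e e0.
by rewrite qfD qfZ mulrC.
Qed.

Lemma posmap_le X Y : psdmx (Y - X) -> forall v, qf (Phi X) v <= qf (Phi Y) v.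
Proof. by move=> /posmap_psd/psdmxP[_ h] v; rewrite -subr_ge0 -qfB -linearB. Qed.

Lemma rank1_psd k (v : 'rV[C]_k) : psdmx (v^t* *m v).
Proof.
apply/psdmxP; split=> [|w]; first by rewrite /hermitian_mx adjM trmxCK.
have -> : v^t* *m v = v^t* *m 1%:M *m v^t*^t* by rewrite trmxCK mulmx1.
by rewrite /qf hf_congr -/(qf _ _) qf1 sqnorm_ge0.
Qed.

Lemma hf_posmap_specmx (U : 'M[C]_n) (x : 'I_n -> C) v :
  hf (Phi (specmx U x)) v = \sum_i x i * (qf (Phi ((row i U)^t* *m row i U)) v)%:C.
Proof.
rewrite specmx_sum linear_sum hf_sum; apply: eq_bigr => i _.
have [h _] := posmap_psd (rank1_psd (row i U)).
by rewrite linearZ hfZ (hf_herm _ h).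
Qed.

(** Both branches are homogeneous of degree [p]; the second is what an exponent [- p] becomes after
    inversion of the image. *)
Definition Zmap (b : bool) (p : R) (A : 'M[C]_n) : 'M[C]_l :=
  if b then Phi (mpow p A) else invmx (Phi (mpow (- p) A)).

Lemma Zmap_pd b p A : pdmx A -> pdmx (Zmap b p A).
Proof.
by move=> hA; rewrite /Zmap; case: b; [|apply: invmx_pd]; apply/sp/mpow_pd.
Qed.

Variables (k : nat) (J : 'M[C]_(k, l)).

Definition lieb_fun (b : bool) (p : R) (A : 'M[C]_n) (W : 'M[C]_k) : R :=
  Re (\tr (J *m Zmap b p A *m J^t* *m mpow (1 - p) W)).

Lemma lieb_funE b p A (V : 'M[C]_k) (w : 'I_k -> R) : pdmx A -> V \is unitarymx ->
  lieb_fun b p A (specmx V (fun i => (w i)%:C)) =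
  \sum_j w j `^ (1 - p) * qf (Zmap b p A) (row j V *m J).
Proof.
move=> hA hV; rewrite /lieb_fun (mpow_specmx _ _ hV) hf_specmx_rows ?Re_sum.
by apply: eq_bigr => j _; rewrite hf_congr ReZ.
Qed.

Lemma Zmap_scale b p A (c : R) : pdmx A -> 0 < c ->
  Zmap b p (c%:C *: A) = (c `^ p)%:C *: Zmap b p A.
Proof.
move=> hA c0; rewrite /Zmap; case: b; rewrite (mpow_scale _ hA c0) linearZ //=.
have uY := pd_unit (sp (mpow_pd (- p) hA)); have c1 := powR_gt0 p c0.
have cn : (c `^ p)%:C != 0 :> C by rewrite fmorph_eq0 gt_eqF.
rewrite powRN fmorphV invmxZ ?invrK //.
by rewrite unitmxZ // unitfE invr_eq0.
Qed.

Lemma lieb_fun_scale b p A W (c : R) : pdmx A -> pdmx W -> 0 < c ->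
  lieb_fun b p (c%:C *: A) (c%:C *: W) = c * lieb_fun b p A W.
Proof.
move=> hA hW c0; rewrite /lieb_fun (mpow_scale _ hW c0) (Zmap_scale _ _ hA c0).
rewrite -[J *m (_ *: _)]scalemxAr -!scalemxAl -scalemxAr !mxtraceZ mulrA -rmorphM ReZ.
congr (_ * _); rewrite -powRD; last by rewrite (gt_eqF c0) implybT.
by rewrite [X in _ `^ X](_ : _ = 1) ?powRr1 ?ltW //; ring.
Qed.

(* the numerical range of the analytic extension of [Zmap] lies in the cone of [cis (p phi)],
   [phi] running over the arguments of the eigenvalues *)
Lemma Zext_cone (b : bool) (p : R) (U : 'M[C]_n) (d : 'I_n -> C) v :
  (~~ b -> Phi (specmx U (fun i => cpow (- p) (d i))) \in unitmx) ->
  exists2 rho : 'I_n -> R, (forall i, 0 <= rho i) &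
  hf (if b then Phi (specmx U (fun i => cpow p (d i)))
      else invmx (Phi (specmx U (fun i => cpow (- p) (d i))))) v =
  \sum_i (rho i)%:C * cis (p * carg (d i)).
Proof.
have q0 i w : 0 <= qf (Phi ((row i U)^t* *m row i U)) w.
  by have /psdmxP[_] := posmap_psd (rank1_psd (row i U)); exact.
case: b => hu.
  exists (fun i => normc (d i) `^ p * qf (Phi ((row i U)^t* *m row i U)) v).
    by move=> i; rewrite mulr_ge0 ?powR_ge0.
  by rewrite hf_posmap_specmx; apply: eq_bigr => i _; rewrite /cpow rmorphM /=; ring.
have {}hu := hu isT; rewrite (hf_invmx _ hu); set u := v *m _.
exists (fun i => normc (d i) `^ (- p) * qf (Phi ((row i U)^t* *m row i U)) u).
  by move=> i; rewrite mulr_ge0 ?powR_ge0.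
rewrite hf_posmap_specmx rmorph_sum; apply: eq_bigr => i _.
by rewrite /cpow !rmorphM /= !conjcR conj_cis mulNr opprK; ring.
Qed.

Lemma cos_ge (t s : R) : 0 <= s <= pi -> `|t| <= s -> cos s <= cos t.
Proof.
move=> /andP[s0 s1] ts; rewrite -[cos t]cos_norm leNgt; apply/negP.
by rewrite ltr_cos ?in_itv /= ?normr_ge0 ?s0 ?s1 ?(le_trans ts) // ltNge ts.
Qed.

Lemma Re_mulCr (e a : C) (q : R) : Re (e * (a * q%:C)) = q * Re (e * a).
Proof. by rewrite mulrA mulrC ReZ. Qed.

(** The inverse needs a uniform coercivity constant. Rotating by [p] times the middle of
    [[arg_lo z, arg_hi z]] brings all arguments of the [- p]-th powers within [p pi / 2], and
    [cos (p pi / 2) > 0] because [p < 1]. The middle is itself at most [pi / 2] in absolute value,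
    which bounds [Re e] from below. *)
Lemma Zext_approx (b : bool) (p : R) (U : C -> 'M[C]_n) (d : C -> 'I_n -> C) (m M : R) :
  0 <= p < 1 -> (forall z, circle_diam z -> U z \is unitarymx) ->
  mx_approx (fun z => specmx (U z) (fun i => cpow p (d z i))) ->
  mx_approx (fun z => specmx (U z) (fun i => cpow (- p) (d z i))) ->
  0 < m -> (forall z i, circle_diam z -> m <= normc (d z i) <= M) ->
  (forall z i, circle_diam z -> arg_lo z <= carg (d z i) <= arg_hi z) ->
  mx_approx (fun z => if b then Phi (specmx (U z) (fun i => cpow p (d z i)))
      else invmx (Phi (specmx (U z) (fun i => cpow (- p) (d z i))))) /\
  (forall z, circle_diam z -> Phi (specmx (U z) (fun i => cpow (- p) (d z i))) \in unitmx).
Proof.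
move=> /andP[p0 p1] hU h1 h2 m0 hd hc.
have [m1 m10 hm1] := pd_lower (sp (pd1 n)).
have pi0 := @pi_gt0 R.
have cs : 0 < cos (p * (pi / 2)).
  by apply: cos_gt0_pihalf; apply/andP; split; nra.
pose K := Num.max M 1; have K0 : 0 < K by rewrite lt_max ltr01 orbT.
pose c := Num.min (cos (p * (pi / 2))) (K `^ (- p) * cos (p * (pi / 2)) * m1).
have c0 : 0 < c by rewrite lt_min cs !mulr_gt0 // powR_gt0.
have coer z : circle_diam z -> exists e : C, [/\ normc e <= 1, c <= Re e & forall v,
     c * sqnorm v <= Re (e * hf (Phi (specmx (U z) (fun i => cpow (- p) (d z i)))) v)].
  move=> Ez; have [l1 l2 l3 l4] := arg_lohi z.
  pose mid := (arg_lo z + arg_hi z) / 2; exists (cis (p * mid)).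
  have sp0 : 0 <= p * (pi / 2) <= pi by apply/andP; split; nra.
  split; first by rewrite normc_cis.
    apply: (@le_trans _ _ (cos (p * (pi / 2)))); first by rewrite /c ge_min lexx.
    apply: cos_ge => //; rewrite normrM ger0_norm // ler_wpM2l // /mid normrM.
    by rewrite [`|2^-1|]ger0_norm ?invr_ge0 // ler_wpM2r ?invr_ge0.
  move=> v; rewrite hf_posmap_specmx mulr_sumr Re_sum.
  have q0 i : 0 <= qf (Phi ((row i (U z))^t* *m row i (U z))) v.
    by have /psdmxP[_] := posmap_psd (rank1_psd (row i (U z))); exact.
  apply: (@le_trans _ _ (K `^ (- p) * cos (p * (pi / 2)) * m1 * sqnorm v)).
    by rewrite ler_wpM2r ?sqnorm_ge0 // /c ge_min lexx orbT.
  apply: (@le_trans _ _ (K `^ (- p) * cos (p * (pi / 2)) * qf (Phi 1%:M) v)).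
    rewrite -[leLHS]mulrA; apply: ler_wpM2l; last exact: hm1.
    by rewrite ltW // mulr_gt0 // powR_gt0.
  have -> : qf (Phi 1%:M) v = \sum_i qf (Phi ((row i (U z))^t* *m row i (U z))) v.
    rewrite -(specmx_const 1 (hU z Ez)) /qf hf_posmap_specmx Re_sum.
    by apply: eq_bigr => i _; rewrite mul1r.
  rewrite mulr_sumr; apply: ler_sum => i _.
  rewrite [leLHS]mulrC Re_mulCr; apply: ler_wpM2l => //.
  rewrite /cpow [_ * (_%:C * _)]mulrCA -cisD ReZ; have /andP[d1 d2] := hd z i Ez.
  have n0 : 0 < normc (d z i) by apply: lt_le_trans m0 d1.
  have nK : normc (d z i) <= K by rewrite le_max d2.
  apply: ler_pM; [exact: powR_ge0|exact: ltW| |].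
    rewrite !powRN lef_pV2 ?posrE ?powR_gt0 //.
    by apply: ge0_ler_powR => //; rewrite nnegrE ltW.
  have /andP[a1 a2] := hc z i Ez.
  apply: cos_ge => //; rewrite mulNr -mulrBr normrM ger0_norm // ler_wpM2l //.
  by rewrite ler_norml /mid; apply/andP; split; lra.
split; last first.
  by move=> z Ez; have [e [_ _ he]] := coer z Ez; exact: coercive_unit c0 he.
case: b; first exact: mx_approx_linear h1.
exact: mx_approx_inv c0 (mx_approx_linear Phi h2) coer.
Qed.

End PositiveMap.

End Lieb.

(** * Joint concavity of the Lieb function for all exponents in the unit interval *)

Section LiebConcavity.
Variable R : realType.
Local Notation C := R[i].
Local Notation Re := (@complex.Re R).

Lemma poly_approx_tr k (F : C -> 'M[C]_k) : mx_approx F -> poly_approx (fun z => \tr (F z)).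
Proof.
move=> hF; apply: (poly_approx_ext (poly_approx_sum (index_enum _) (fun i => hF i i))).
by move=> z _; rewrite /mxtrace.
Qed.

Lemma Gam_scale n (A H : 'M[C]_n) (eps x : R) :
  Gam A H eps x%:C = (1 + x ^+ 2)%:C *:
    (A + (x / (1 + x ^+ 2))%:C *: H + (eps / (1 + x ^+ 2))%:C%:M).
Proof.
have p0 : 1 + x ^+ 2 != 0 by rewrite gt_eqF // ltr_pwDl // sqr_ge0.
have p0C : 1 + x%:C ^+ 2 != 0 :> C.
  by rewrite -rmorphXn -(rmorph1 (real_complex R)) -rmorphD fmorph_eq0.
apply/matrixP => i j; rewrite /Gam !mxE !rmorphM !fmorphV !rmorphD /= !rmorph1 !rmorphXn /=.
by case: (i == j); rewrite ?mulr1n ?mulr0n; field.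
Qed.

Section Dyadic.
Variables (n l : nat) (Phi : {linear 'M[C]_n -> 'M[C]_l}).
Hypothesis sp : strictly_positive Phi.
Variables (k : nat) (J : 'M[C]_(k, l)).

(** The trace is a sum of terms with nonnegative modulus and argument [(1 - p) a + p a'], where [a]
    and [a'] are arguments of eigenvalues of the two families. Both lie in the interval
    [[arg_lo z, arg_hi z]], which depends on [z] only, and so does their convex combination: this is
    why the exponents add up to [1]. *)
Lemma lieb_dyadic b (j K : nat) (A H : 'M[C]_n) (B D : 'M[C]_k) (eps x1 x2 x3 c1 c2 : R) :
  let p := j%:R * 2^-1 ^+ K.+1 in
  let F x := lieb_fun Phi J b p (Gam A H eps x%:C) (Gam B D eps x%:C) / (1 + x ^+ 2) in
  (j < 2 ^ K.+1)%N -> hermitian_mx A -> hermitian_mx H -> hermitian_mx B -> hermitian_mx D ->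
  pdmx ((2 : R)%:C *: A + H) -> pdmx ((2 : R)%:C *: A - H) ->
  pdmx ((2 : R)%:C *: B + D) -> pdmx ((2 : R)%:C *: B - D) -> 0 < eps ->
  `|x1| < 1 -> `|x2| < 1 -> `|x3| < 1 -> 0 <= c1 -> 0 <= c2 -> c1 + c2 = 1 ->
  c1 * (x1 / (1 + x1 ^+ 2)) + c2 * (x2 / (1 + x2 ^+ 2)) = x3 / (1 + x3 ^+ 2) ->
  c1 * F x1 + c2 * F x2 <= F x3.
Proof.
move=> p F jK hA hH hB hD pA1 pA2 pB1 pB2 e0 h1 h2 h3 c10 c20 c12 Et.
have [U [d [U1 U2 [m [M [m0 U3]]] U4 U5]]] := pow_family hA hH pA1 pA2 e0.
have [V [y [V1 V2 _ V4 V5]]] := pow_family hB hD pB1 pB2 e0.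
have p1E : 1 - p = (2 ^ K.+1 - j)%:R * 2^-1 ^+ K.+1.
  by rewrite natrB ?(ltnW jK) // natrX mulrBl -exprMn divff ?expr1n // pnatr_eq0.
have t0 : 0 < 2^-1 ^+ K.+1 :> R by rewrite exprn_gt0 // invr_gt0.
have p0 : 0 <= p by rewrite /p mulr_ge0 // ltW.
have q0 : 0 < 1 - p by rewrite p1E mulr_gt0 // ltr0n subn_gt0.
have p01 : 0 <= p < 1 by rewrite p0 -subr_gt0.
have [U2a U2b] := U2 j K.
have [Za Zu] := Zext_approx sp b p01 U1 U2a U2b m0 U3 U4.
have [Va _] := V2 (2 ^ K.+1 - j)%N K; rewrite -p1E in Va.
pose G z := \tr (J *m (if b then Phi (specmx (U z) (fun i => cpow p (d z i)))
      else invmx (Phi (specmx (U z) (fun i => cpow (- p) (d z i))))) *m J^t* *m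
      specmx (V z) (fun i => cpow (1 - p) (y z i))).
have Ga : poly_approx G.
  apply: poly_approx_tr; apply: mx_approx_mul Va.
  apply: mx_approx_mul (mx_approx_const _).
  exact: mx_approx_mul (mx_approx_const _) Za.
have GE x : `|x| < 1 -> Re (G x%:C) / (1 + x ^+ 2) = F x.
  by move=> hx; rewrite /G (V5 _ _ hx) !(U5 _ _ hx).
rewrite -!GE //; apply: (pick_concave Ga) => // z nz.
have Ez : circle_diam z by left.
rewrite /G hf_specmx_rows mulr_suml Re_sum sumr_ge0 // => a _.
rewrite hf_congr.
have [rho rho0 ->] := @Zext_cone R n l Phi sp b p (U z) (d z) (row a (V z) *m J)
   (fun _ => Zu z Ez).
rewrite mulr_sumr mulr_suml Re_sum sumr_ge0 // => i _.
have -> : cpow (1 - p) (y z a) * ((rho i)%:C * cis (p * carg (d z i))) =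
   (normc (y z a) `^ (1 - p) * rho i)%:C *
   cis ((1 - p) * carg (y z a) + p * carg (d z i)).
  by rewrite /cpow cisD rmorphM /=; ring.
apply: cone_sign => //; first by rewrite mulr_ge0 // powR_ge0.
have /andP[a1 a2] := U4 z i Ez; have /andP[b1 b2] := V4 z a Ez.
have e1 : (1 - p) * arg_lo z <= (1 - p) * carg (y z a) by rewrite ler_wpM2l // ltW.
have e2 : (1 - p) * carg (y z a) <= (1 - p) * arg_hi z by rewrite ler_wpM2l // ltW.
have e3 : p * arg_lo z <= p * carg (d z i) by rewrite ler_wpM2l.
have e4 : p * carg (d z i) <= p * arg_hi z by rewrite ler_wpM2l.
clear -e1 e2 e3 e4; apply/andP; split; lra.
Qed.

End Dyadic.

(** Two-sided bounds by a ratio [kap] survive positive linear maps, and inversion merely exchanges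
    the two sides, so the estimate carries over to [Zmap] without matrix norms. *)
Lemma powR_perturb (a p kap : R) : 0 < a -> 1 < kap -> exists2 eta, 0 < eta &
  forall p' e, 0 <= p' <= 1 -> `|p' - p| <= eta -> 0 <= e <= eta ->
  kap^-1 * a `^ p <= (a + e) `^ p' <= kap * a `^ p.
Proof.
move=> a0 k1; pose s := Num.sqrt kap.
have k0 : 0 < kap by lra.
have s2 : s ^+ 2 = kap by rewrite sqr_sqrtr // ltW.
have s0 : 0 < s by rewrite sqrtr_gt0.
have s1 : 1 < s by nra.
have L0 : 0 < ln s by rewrite ln_gt0.
have la : 0 < `|ln a| + 1 by rewrite ltr_wpDl.
exists (Num.min (a * (s - 1)) (ln s / (`|ln a| + 1))).
  by rewrite lt_min mulr_gt0 ?subr_gt0 //= divr_gt0.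
move=> p' e /andP[p0 p1]; rewrite le_min => /andP[_ h1] /andP[e0].
rewrite le_min => /andP[h2 _].
have E : a `^ p' = a `^ p * a `^ (p' - p).
  by rewrite -powRD ?(gt_eqF a0) ?implybT // addrC subrK.
have ex : a `^ (p' - p) = expR ((p' - p) * ln a) by rewrite /powR gt_eqF.
have hl : `|(p' - p) * ln a| <= ln s.
  rewrite normrM; move: h1; rewrite ler_pdivlMr // => h1.
  by have := normr_ge0 (p' - p); have := normr_ge0 (ln a); nra.
move: hl; rewrite ler_norml => /andP[l1 l2].
have u1 : a `^ (p' - p) <= s by rewrite ex -[leRHS]lnK ?posrE // ler_expR.
have u2 : s^-1 <= a `^ (p' - p) by rewrite ex -[s]lnK ?posrE // -expRN ler_expR.
have ap := powR_gt0 p a0; have ap' := powR_gt0 p' a0.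
have k3 : a `^ p' <= s * a `^ p by rewrite E mulrC ler_wpM2r // ltW.
have k4 : s^-1 * a `^ p <= a `^ p' by rewrite E mulrC ler_wpM2l // ltW.
have ae : a + e <= s * a by lra.
have lo : a `^ p' <= (a + e) `^ p'.
  by apply: ge0_ler_powR => //; rewrite ?nnegrE; lra.
have hi : (a + e) `^ p' <= s * a `^ p'.
  apply: (@le_trans _ _ ((s * a) `^ p')).
    apply: ge0_ler_powR => //; rewrite ?nnegrE; first lra.
    by rewrite mulr_ge0 ?ltW.
  rewrite (powRM _ (ltW s0) (ltW a0)); apply: ler_wpM2r; first exact: ltW.
  by rewrite -[leRHS](powRr1 (ltW s0)) ler_powR // ltW.
apply/andP; split.
  apply: le_trans lo; apply: le_trans k4; apply: ler_wpM2r; first exact: ltW.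
  by rewrite lef_pV2 ?posrE // -s2; nra.
by apply: le_trans hi _; rewrite -s2 expr2 -mulrA ler_wpM2l // ltW.
Qed.

Lemma common_eta n (P : 'I_n -> R -> Prop) :
  (forall i, exists2 eta, 0 < eta & forall e', 0 < e' -> e' <= eta -> P i e') ->
  exists2 eta, 0 < eta & forall i e', 0 < e' -> e' <= eta -> P i e'.
Proof.
move=> h; have h' i : {eta | 0 < eta & forall e', 0 < e' -> e' <= eta -> P i e'}.
  by apply: cid2; exact: h.
have [m m0 hm] := @ord_min_gt0 R n (fun i => s2val (h' i)) (fun i => s2valP (h' i)).
exists m => // i e' e0 em; have := s2valP' (h' i); apply=> //.
exact: le_trans em (hm i).
Qed.

Lemma powR_perturb_ord n (a : 'I_n -> R) (p kap : R) : (forall i, 0 < a i) -> 1 < kap ->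
  exists2 eta, 0 < eta &
  forall i p' e, 0 <= p' <= 1 -> `|p' - p| <= eta -> 0 <= e <= eta ->
  kap^-1 * a i `^ p <= (a i + e) `^ p' <= kap * a i `^ p.
Proof.
move=> a0 k1; have [|eta e0 h] := @common_eta n (fun i eta => forall p' e,
   0 <= p' <= 1 -> `|p' - p| <= eta -> 0 <= e <= eta ->
   kap^-1 * a i `^ p <= (a i + e) `^ p' <= kap * a i `^ p).
  move=> i; have [eta e0 h] := powR_perturb p (a0 i) k1; exists eta => // e' e'0 ee p' e.
  move=> h1 h2 /andP[h3 h4]; apply: h => //; first exact: le_trans h2 ee.
  by rewrite h3 (le_trans h4).
by exists eta => // i; apply: h.
Qed.

Lemma addscalar_specmx n (U : 'M[C]_n) (a : 'I_n -> R) (e : R) : U \is unitarymx ->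
  specmx U (fun i => (a i)%:C) + e%:C%:M = specmx U (fun i => (a i + e)%:C).
Proof.
move=> hU; rewrite -(specmx_const e%:C hU) specmxD.
by apply: eq_specmx => i; rewrite rmorphD.
Qed.

Lemma specmx_sub_psd n (U : 'M[C]_n) (x y : 'I_n -> R) (c : R) :
  (forall i, x i <= c * y i) ->
  psdmx (c%:C *: specmx U (fun i => (y i)%:C) - specmx U (fun i => (x i)%:C)).
Proof.
move=> h; have -> : c%:C *: specmx U (fun i => (y i)%:C) - specmx U (fun i => (x i)%:C) =
  specmx U (fun i => (c * y i - x i)%:C).
  rewrite -scaleN1r !specmxZ specmxD; apply: eq_specmx => i.
  by rewrite rmorphB rmorphM mulN1r.
by apply: psd_specmx => i; rewrite subr_ge0.
Qed.

Section Perturb.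
Variables (n l : nat) (Phi : {linear 'M[C]_n -> 'M[C]_l}).
Hypothesis sp : strictly_positive Phi.

Lemma Zmap_perturb b (p kap : R) (A : 'M[C]_n) : pdmx A -> 1 < kap ->
  exists2 eta, 0 < eta &
  forall p' e, 0 <= p' <= 1 -> `|p' - p| <= eta -> 0 <= e <= eta ->
  forall v, kap^-1 * qf (Zmap Phi b p A) v <= qf (Zmap Phi b p' (A + e%:C%:M)) v <=
    kap * qf (Zmap Phi b p A) v.
Proof.
move=> hA k1; have [U [a [hU EA a0]]] := pd_spec hA.
have [eta e0 h] := powR_perturb_ord p a0 k1; exists eta => // p' e hp' hp he v.
have k0 : 0 < kap by lra.
have ae i : 0 < a i + e by have /andP[h1 _] := he; rewrite ltr_pwDl.
have hA' : pdmx (A + e%:C%:M) by rewrite EA (addscalar_specmx _ _ hU); exact: (pd_specmx hU ae).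
have mA q : mpow q A = specmx U (fun i => (a i `^ q)%:C).
  by rewrite EA; exact: mpow_specmx.
have mA' q : mpow q (A + e%:C%:M) = specmx U (fun i => ((a i + e) `^ q)%:C).
  by rewrite EA (addscalar_specmx _ _ hU); exact: mpow_specmx.
have sw (x y : R) : kap^-1 * x <= y -> x <= kap * y by rewrite ler_pdivrMl.
case: b; rewrite /Zmap.
  apply/andP; split.
    rewrite ler_pdivrMl // -qfZ -linearZ; apply: (posmap_le sp).
    rewrite mA mA'; apply: specmx_sub_psd => i; have /andP[h1 _] := h i p' e hp' hp he.
    exact: sw.
  rewrite -qfZ -linearZ; apply: (posmap_le sp).
  by rewrite mA mA'; apply: specmx_sub_psd => i; have /andP[] := h i p' e hp' hp he.
pose Y := Phi (mpow (- p) A); pose Y' := Phi (mpow (- p') (A + e%:C%:M)).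
have hY : pdmx Y by apply/sp/mpow_pd.
have hY' : pdmx Y' by apply/sp/mpow_pd.
have invZ (X : 'M[C]_l) v' : pdmx X -> qf (invmx (kap%:C *: X)) v' = kap^-1 * qf (invmx X) v'.
  move=> hX; have kn : kap%:C != 0 :> C by rewrite fmorph_eq0 gt_eqF.
  rewrite invmxZ -?fmorphV ?qfZ //.
  by rewrite unitmxZ ?pd_unit // unitfE.
have i1 v' : qf Y v' <= qf (kap%:C *: Y') v'.
  rewrite /Y' -linearZ; apply: (posmap_le sp); rewrite mA mA'.
  apply: specmx_sub_psd => i; have /andP[_ h2] := h i p' e hp' hp he.
  rewrite !powRN -ler_pdivrMl // -invfM lef_pV2 ?posrE ?mulr_gt0 ?powR_gt0 //.
have i2 v' : qf Y' v' <= qf (kap%:C *: Y) v'.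
  rewrite /Y -linearZ; apply: (posmap_le sp); rewrite mA mA'.
  apply: specmx_sub_psd => i; have /andP[h2 _] := h i p' e hp' hp he.
  rewrite !powRN -ler_pdivrMl // -invfM lef_pV2 ?posrE ?mulr_gt0 ?powR_gt0 //.
  exact: sw.
have j1 := invmx_qf_le hY (pdZ k0 hY') i1 v; rewrite invZ // in j1.
have j2 := invmx_qf_le hY' (pdZ k0 hY) i2 v; rewrite invZ // in j2.
by apply/andP; split; [exact: j2 | exact: sw j1].
Qed.

Variables (k : nat) (J : 'M[C]_(k, l)).

Lemma lieb_fun_ge0 b p A W : pdmx A -> pdmx W -> 0 <= lieb_fun Phi J b p A W.
Proof.
move=> hA /pd_spec[V [w [hV -> w0]]]; rewrite (lieb_funE Phi J _ _ _ hA hV).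
apply: sumr_ge0 => j _; rewrite mulr_ge0 ?powR_ge0 //.
by have /pd_psd/psdmxP[_] := Zmap_pd sp b p hA; exact.
Qed.

Lemma lieb_fun_perturb b (p kap : R) A W : pdmx A -> pdmx W -> 0 <= p <= 1 -> 1 < kap ->
  exists2 eta, 0 < eta &
  forall p' e, 0 <= p' <= 1 -> `|p' - p| <= eta -> 0 <= e <= eta ->
  kap^-1 ^+ 2 * lieb_fun Phi J b p A W <=
   lieb_fun Phi J b p' (A + e%:C%:M) (W + e%:C%:M) <= kap ^+ 2 * lieb_fun Phi J b p A W.
Proof.
move=> hA hW hp k1; have [V [w [hV EW w0]]] := pd_spec hW.
have [e1 e10 h1] := Zmap_perturb b p hA k1.
have [e2 e20 h2] := powR_perturb_ord (1 - p) w0 k1.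
exists (Num.min e1 e2); first by rewrite lt_min e10.
move=> p' e hp' hpp /andP[e0]; rewrite le_min => /andP[ee1 ee2].
move: hpp; rewrite le_min => /andP[q1 q2].
have hA' : pdmx (A + e%:C%:M) by apply: pdD => //; exact: psd_scalar.
have k0 : 0 < kap by lra.
rewrite EW (addscalar_specmx _ _ hV) !(lieb_funE Phi J _ _ _ _ hV) // !mulr_sumr.
have hp1 : 0 <= 1 - p' <= 1 by have /andP[a1 a2] := hp'; apply/andP; split; lra.
have hq : `|1 - p' - (1 - p)| <= e2.
  have E : 1 - p' - (1 - p) = - (p' - p) by ring.
  by rewrite E normrN.
have he1 : 0 <= e <= e1 by rewrite e0.
have he2 : 0 <= e <= e2 by rewrite e0.
have Z0 q B v : pdmx B -> 0 <= qf (Zmap Phi b q B) v.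
  by move=> hB; have /pd_psd/psdmxP[_] := Zmap_pd sp b q hB; exact.
apply/andP; split; apply: ler_sum => j _; set v := row j V *m J;
  have /andP[a1 a2] := h2 j (1 - p') e hp1 hq he2;
  have /andP[b1 b2] := h1 p' e hp' q1 he1 v.
  rewrite expr2 mulrACA; apply: ler_pM => //; rewrite mulr_ge0 ?powR_ge0 ?Z0 //;
    by rewrite invr_ge0 ltW.
rewrite expr2 mulrACA; apply: ler_pM => //; first exact: powR_ge0.
exact: Z0.
Qed.

End Perturb.

(** Prolongs the segment beyond [A]. The data points then correspond to [|tau| < 1/2], strictly
    inside the range reached by [|x| < 1]. *)
Lemma pd_extrapolate n (A B : 'M[C]_n) : pdmx A -> pdmx B -> exists2 d0 : R, 0 < d0 &
  forall d, 0 < d -> d <= d0 -> pdmx ((2 + d)%:C *: A - d%:C *: B).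
Proof.
move=> hA hB; have [m m0 hm] := pd_lower hA; have [hhA _] := hA; have [hhB _] := hB.
have [M M0 hM] := herm_upper hhB.
exists (m / M); first by rewrite divr_gt0.
move=> d d0; rewrite (ler_pdivlMr _ _ M0) => dM; apply/pdmxP; split.
  apply: hermD; first exact: hermZ.
  by rewrite -scaleNr -rmorphN; exact: hermZ.
move=> v v0; rewrite qfB !qfZ; have := hm v; have := hM v; rewrite -sqnorm_gt0 in v0.
rewrite ler_norml => /andP[_ h1] h2.
move: (qf A v) (qf B v) (sqnorm v) v0 h1 h2 => a b s s0 h1 h2.
have h3 : d * b <= d * (M * s) by rewrite ler_wpM2l // ltW.
have h4 : d * M * s <= m * s by rewrite ler_wpM2r // ltW.
have h5 : 0 < m * s by rewrite mulr_gt0.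
have h6 : 0 <= d * a by rewrite mulr_ge0 // ltW // (lt_le_trans h5).
clear -h2 h3 h4 h5 h6; lra.
Qed.

(** [x] is the root of [tau x^2 - x + tau] inside the disc, written so that [tau = 0] needs no
    separate case. *)
Lemma exists_tau (tau : R) : `|tau| < 2^-1 ->
  exists2 x : R, `|x| < 1 & x / (1 + x ^+ 2) = tau.
Proof.
move=> ht; pose s := Num.sqrt (1 - 4 * tau ^+ 2).
have t2 : tau ^+ 2 < 4^-1.
  rewrite -real_normK ?num_real //; have := normr_ge0 tau; nra.
have s2 : s ^+ 2 = 1 - 4 * tau ^+ 2 by rewrite sqr_sqrtr //; lra.
have s0 : 0 < s by rewrite sqrtr_gt0; lra.
have s1 : 1 + s != 0 by rewrite gt_eqF //; lra.
have x2 : (2 * tau / (1 + s)) ^+ 2 = (1 - s) / (1 + s).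
  have t4 : tau ^+ 2 = (1 - s ^+ 2) / 4 by lra.
  by rewrite !exprMn exprVn t4; field.
exists (2 * tau / (1 + s)).
  rewrite -(@expr_lt1 _ 2) // real_normK ?num_real // x2 ltr_pdivrMr; lra.
rewrite x2; have -> : 1 + (1 - s) / (1 + s) = 2 / (1 + s) by field.
by field.
Qed.

Lemma dyadic_01 j K : (j < 2 ^ K.+1)%N -> 0 <= (j%:R * 2^-1 ^+ K.+1 : R) <= 1.
Proof.
move=> jK; have T0 : 0 < 2 ^+ K.+1 :> R by rewrite exprn_gt0.
rewrite exprVn; apply/andP; split; first by rewrite divr_ge0 // ltW.
by rewrite ler_pdivrMr // mul1r -natrX ler_nat ltnW.
Qed.

Lemma dyadic_dense (p eta : R) : 0 <= p <= 1 -> 0 < eta -> exists j K,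
  (j < 2 ^ K.+1)%N /\ `|j%:R * 2^-1 ^+ K.+1 - p| <= eta.
Proof.
(* The cap [(2 ^ K.+1).-1] keeps the dyadic exponent below [1] even for [p = 1], as [Zext_approx]
   demands. *)
move=> /andP[p0 p1] e0; have [K hK] := exists_half_pow e0; exists (minn (Num.truncn (p * 2 ^+ K.+1)) (2 ^ K.+1).-1), K.
have N0 : (0 < 2 ^ K.+1)%N by rewrite expn_gt0.
split; first by apply: leq_ltn_trans (geq_minr _ _) _; rewrite prednK.
have T0 : 0 < 2 ^+ K.+1 :> R by rewrite exprn_gt0.
have tE : (2^-1 : R) ^+ K.+1 = (2 ^+ K.+1)^-1 by rewrite exprVn.
have t1 : (2^-1 : R) ^+ K.+1 <= eta.
  apply: le_trans hK; rewrite exprS ler_piMl ?exprn_ge0 ?invr_ge0 //; lra.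
apply: le_trans t1; rewrite tE.
have q0 : 0 <= p * 2 ^+ K.+1 by rewrite mulr_ge0 // ltW.
set j := minn _ _; suff : `|j%:R - p * 2 ^+ K.+1| <= 1.
  move=> h; have -> : j%:R / 2 ^+ K.+1 - p = (j%:R - p * 2 ^+ K.+1) / 2 ^+ K.+1.
    by rewrite mulrBl mulfK // gt_eqF.
  by rewrite normrM normfV (gtr0_norm T0) ler_pdivrMr // mulVf // gt_eqF.
have /andP[tr1 tr2] := truncn_itv q0.
have jl : j%:R <= p * 2 ^+ K.+1.
  by apply: le_trans tr1; rewrite ler_nat geq_minl.
rewrite distrC ger0_norm ?subr_ge0 //; rewrite /j /minn; case: ifP => _.
  by move: tr2; rewrite -addn1 natrD; lra.
have -> : (2 ^ K.+1).-1%:R = 2 ^+ K.+1 - 1 :> R.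
  by rewrite -subn1 natrB // natrX.
have : p * 2 ^+ K.+1 <= 1 * 2 ^+ K.+1 by rewrite ler_wpM2r // ltW.
by lra.
Qed.

Section Lieb.
Variables (n l : nat) (Phi : {linear 'M[C]_n -> 'M[C]_l}).
Hypothesis sp : strictly_positive Phi.
Variables (k : nat) (J : 'M[C]_(k, l)).

(** [tau = 0] is the midpoint, and [tau = 1/2], [tau = -1/2] are the ends of the prolonged segment;
    the stretching factor [1 + d] brings the given points inside. *)
Lemma segment_path m (X1 X2 : 'M[C]_m) (d t : R) :
  let A := 2^-1%:C *: X1 + 2^-1%:C *: X2 in
  let H := (1 + d)%:C *: X1 - (1 + d)%:C *: X2 in
  0 < d ->
  [/\ (2 : R)%:C *: A + H = (2 + d)%:C *: X1 - d%:C *: X2,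
      (2 : R)%:C *: A - H = (2 + d)%:C *: X2 - d%:C *: X1 &
      A + ((2 * t - 1) / (2 * (1 + d)))%:C *: H = t%:C *: X1 + (1 - t)%:C *: X2].
Proof.
move=> A H d0; have dn : 1 + d != 0 by rewrite gt_eqF //; lra.
have comb a b a' b' : a = a' -> b = b' ->
   a%:C *: X1 + b%:C *: X2 = a'%:C *: X1 + b'%:C *: X2 by move=> -> ->.
have lin (c e a b a' b' : R) : c%:C *: (a%:C *: X1 + b%:C *: X2) +
    e%:C *: (a'%:C *: X1 + b'%:C *: X2) =
    (c * a + e * a')%:C *: X1 + (c * b + e * b')%:C *: X2.
  by rewrite !scalerDr !scalerA addrACA -!scalerDl -!rmorphM -!rmorphD.
have HE : H = (1 + d)%:C *: X1 + (- (1 + d))%:C *: X2 by rewrite /H rmorphN scaleNr.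
split.
- have -> : (2 : R)%:C *: A + H = (2 : R)%:C *: A + 1%:C *: H by rewrite scale1r.
  by rewrite HE lin -scaleNr -rmorphN; apply: comb; field.
- have -> : (2 : R)%:C *: A - H = (2 : R)%:C *: A + (-1)%:C *: H.
    by rewrite rmorphN scaleN1r.
  by rewrite HE lin [RHS]addrC -scaleNr -rmorphN; apply: comb; field.
- have -> : A = 1%:C *: A by rewrite scale1r.
  by rewrite HE lin; apply: comb; field.
Qed.

Lemma tau_bound (s d : R) : 0 < d -> 0 <= s <= 1 -> `|(2 * s - 1) / (2 * (1 + d))| < 2^-1.
Proof.
move=> d0 /andP[s0 s1]; have p0 : 0 < 2 * (1 + d) by lra.
rewrite normrM normfV (gtr0_norm p0) ltr_pdivrMr //.
by rewrite (@le_lt_trans _ _ 1) ?ler_norml //; [apply/andP; split; lra | lra].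
Qed.

Lemma div_1D_sqr_le (a x : R) : 0 < a -> 0 <= a / (1 + x ^+ 2) <= a.
Proof.
move=> a0; have x20 : 0 < 1 + x ^+ 2 by rewrite ltr_pwDl // sqr_ge0.
apply/andP; split; first exact/ltW/divr_gt0.
rewrite ler_pdivrMr // mulrDr mulr1 lerDl; apply: mulr_ge0; first exact: ltW.
exact: sqr_ge0.
Qed.

Lemma perturb_arith (t h e l1 l2 l3 g1 g2 g3 : R) : 0 <= t <= 1 -> 0 < h -> h <= 1 ->
  h <= e -> 0 <= l3 -> (1 + h)^-1 ^+ 2 * l1 <= g1 -> (1 + h)^-1 ^+ 2 * l2 <= g2 ->
  g3 <= (1 + h) ^+ 2 * l3 -> t * g1 + (1 - t) * g2 <= g3 ->
  t * l1 + (1 - t) * l2 <= l3 + 15 * l3 * e.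
Proof.
move=> /andP[t0 t1] h0 h1 he l30 G1 G2 G3 main; set kap := 1 + h in G1 G2 G3 *.
have k0 : 0 < kap ^+ 2 by rewrite exprn_gt0 // /kap; lra.
have s1 : t * (kap^-1 ^+ 2 * l1) <= t * g1 by rewrite ler_wpM2l.
have s2 : (1 - t) * (kap^-1 ^+ 2 * l2) <= (1 - t) * g2 by rewrite ler_wpM2l // subr_ge0.
have s3 : kap^-1 ^+ 2 * (t * l1 + (1 - t) * l2) <= kap ^+ 2 * l3.
  have -> : kap^-1 ^+ 2 * (t * l1 + (1 - t) * l2) =
    t * (kap^-1 ^+ 2 * l1) + (1 - t) * (kap^-1 ^+ 2 * l2) by ring.
  exact: le_trans (lerD s1 s2) (le_trans main G3).
rewrite exprVn ler_pdivrMl // in s3; apply: le_trans s3 _.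
(* Two factors [kap ^+ 2] give [(1 + h)^4], and [15 = 4 + 6 + 4 + 1] since powers of [h <= 1] are at
   most [h]. *)
have hk : kap ^+ 2 * kap ^+ 2 <= 1 + 15 * h.
  have h2 : h ^+ 2 <= h by nra.
  have h3 : h ^+ 3 <= h by rewrite exprS; nra.
  have h4 : h ^+ 4 <= h by rewrite exprS; nra.
  have -> : kap ^+ 2 * kap ^+ 2 = 1 + 4 * h + 6 * h ^+ 2 + 4 * h ^+ 3 + h ^+ 4.
    by rewrite /kap; ring.
  by lra.
rewrite mulrA (@le_trans _ _ ((1 + 15 * h) * l3)) // ?ler_wpM2r //.
by rewrite mulrDl mul1r lerD2l -!mulrA ler_pM2l // mulrC ler_wpM2l.
Qed.

Lemma lieb_concave b (p : R) (A1 A2 : 'M[C]_n) (W1 W2 : 'M[C]_k) (t : R) :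
  0 <= p <= 1 -> pdmx A1 -> pdmx A2 -> pdmx W1 -> pdmx W2 -> 0 <= t <= 1 ->
  t * lieb_fun Phi J b p A1 W1 + (1 - t) * lieb_fun Phi J b p A2 W2 <=
  lieb_fun Phi J b p (t%:C *: A1 + (1 - t)%:C *: A2) (t%:C *: W1 + (1 - t)%:C *: W2).
Proof.
move=> hp hA1 hA2 hW1 hW2 ht; have /andP[t0 t1] := ht.
have hA3 := pd_convex hA1 hA2 ht; have hW3 := pd_convex hW1 hW2 ht.
set A3 := _ + _ in hA3 *; set W3 := _ + _ in hW3 *.
have L1 := lieb_fun_ge0 sp J b p hA1 hW1; have L2 := lieb_fun_ge0 sp J b p hA2 hW2.
have L3 := lieb_fun_ge0 sp J b p hA3 hW3.
have [dA1 dA10 pA1] := pd_extrapolate hA1 hA2; have [dA2 dA20 pA2] := pd_extrapolate hA2 hA1.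
have [dW1 dW10 pW1] := pd_extrapolate hW1 hW2; have [dW2 dW20 pW2] := pd_extrapolate hW2 hW1.
pose d := Num.min (Num.min dA1 dA2) (Num.min dW1 dW2).
have d0 : 0 < d by rewrite !lt_min dA10 dA20 dW10 dW20.
have dlA1 : d <= dA1 by rewrite /d !ge_min lexx.
have dlA2 : d <= dA2 by rewrite /d !ge_min lexx orbT.
have dlW1 : d <= dW1 by rewrite /d !ge_min lexx !orbT.
have dlW2 : d <= dW2 by rewrite /d !ge_min lexx !orbT.
pose A := 2^-1%:C *: A1 + 2^-1%:C *: A2.
pose H := (1 + d)%:C *: A1 - (1 + d)%:C *: A2.
pose B := 2^-1%:C *: W1 + 2^-1%:C *: W2.
pose D := (1 + d)%:C *: W1 - (1 + d)%:C *: W2.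
have [EA1 EA2 _] := segment_path A1 A2 0 d0; rewrite -/A -/H in EA1 EA2.
have [EW1 EW2 _] := segment_path W1 W2 0 d0; rewrite -/B -/D in EW1 EW2.
have EA s : A + ((2 * s - 1) / (2 * (1 + d)))%:C *: H = s%:C *: A1 + (1 - s)%:C *: A2.
  by have [] := segment_path A1 A2 s d0.
have EW s : B + ((2 * s - 1) / (2 * (1 + d)))%:C *: D = s%:C *: W1 + (1 - s)%:C *: W2.
  by have [] := segment_path W1 W2 s d0.
have tau s : 0 <= s <= 1 -> `|(2 * s - 1) / (2 * (1 + d))| < 2^-1 by exact: tau_bound.
have i0 : 0 <= (0 : R) <= 1 by rewrite lexx ler01.
have i1 : 0 <= (1 : R) <= 1 by rewrite lexx ler01.
have [x1 hx1 Ex1] := exists_tau (tau 1 i1).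
have [x2 hx2 Ex2] := exists_tau (tau 0 i0).
have [x3 hx3 Ex3] := exists_tau (tau t ht).
have Etau : t * (x1 / (1 + x1 ^+ 2)) + (1 - t) * (x2 / (1 + x2 ^+ 2)) = x3 / (1 + x3 ^+ 2).
  by rewrite Ex1 Ex2 Ex3 !mulrA -mulrDl; congr (_ / _); ring.
have [hhA1 _] := hA1; have [hhA2 _] := hA2; have [hhW1 _] := hW1; have [hhW2 _] := hW2.
have hA : hermitian_mx A by apply: hermD; exact: hermZ.
have hB : hermitian_mx B by apply: hermD; exact: hermZ.
have hH : hermitian_mx H.
  by apply: hermD; [exact: hermZ | rewrite -scaleNr -rmorphN; exact: hermZ].
have hD : hermitian_mx D.
  by apply: hermD; [exact: hermZ | rewrite -scaleNr -rmorphN; exact: hermZ].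
apply: (@le_of_small R _ _ (15 * lieb_fun Phi J b p A3 W3)); first exact: mulr_ge0.
move=> e e0; pose h := Num.min 1 e; have h0 : 0 < h by rewrite lt_min ltr01.
have h1 : h <= 1 by rewrite ge_min lexx.
have he : h <= e by rewrite ge_min lexx orbT.
pose kap := 1 + h; have k1 : 1 < kap by rewrite ltrDl.
have [eta1 eta10 P1] := lieb_fun_perturb sp J b hA1 hW1 hp k1.
have [eta2 eta20 P2] := lieb_fun_perturb sp J b hA2 hW2 hp k1.
have [eta3 eta30 P3] := lieb_fun_perturb sp J b hA3 hW3 hp k1.
(* [eta] is at once the accuracy of the dyadic exponent and the shift in [Gam]; homogeneity turns
   the shift into [eta / (1 + x ^+ 2) <= eta]. *)
pose eta := Num.min (Num.min eta1 eta2) eta3.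
have eta0 : 0 < eta by rewrite !lt_min eta10 eta20 eta30.
have etl1 : eta <= eta1 by rewrite /eta !ge_min lexx.
have etl2 : eta <= eta2 by rewrite /eta !ge_min lexx orbT.
have etl3 : eta <= eta3 by rewrite /eta !ge_min lexx !orbT.
have [j [K [jK hjK]]] := dyadic_dense hp eta0.
pose p' := j%:R * 2^-1 ^+ K.+1 : R; rewrite -/p' in hjK.
have hp' : 0 <= p' <= 1 by exact: dyadic_01.
pose G x := lieb_fun Phi J b p' (Gam A H eta x%:C) (Gam B D eta x%:C) / (1 + x ^+ 2).
have main : t * G x1 + (1 - t) * G x2 <= G x3.
  have q1 : pdmx ((2 : R)%:C *: A + H) by rewrite EA1; exact: pA1.
  have q2 : pdmx ((2 : R)%:C *: A - H) by rewrite EA2; exact: pA2.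
  have q3 : pdmx ((2 : R)%:C *: B + D) by rewrite EW1; exact: pW1.
  have q4 : pdmx ((2 : R)%:C *: B - D) by rewrite EW2; exact: pW2.
  have t1' : 0 <= 1 - t by rewrite subr_ge0.
  have c12 : t + (1 - t) = 1 by rewrite addrC subrK.
  exact: (lieb_dyadic sp J b jK hA hH hB hD q1 q2 q3 q4 eta0 hx1 hx2 hx3 t0 t1' c12 Etau).
have GE x s : x / (1 + x ^+ 2) = (2 * s - 1) / (2 * (1 + d)) -> 0 <= s <= 1 ->
   G x = lieb_fun Phi J b p' (s%:C *: A1 + (1 - s)%:C *: A2 + (eta / (1 + x ^+ 2))%:C%:M)
     (s%:C *: W1 + (1 - s)%:C *: W2 + (eta / (1 + x ^+ 2))%:C%:M).
  move=> Ex hs; have x20 : 0 < 1 + x ^+ 2 by rewrite ltr_pwDl // sqr_ge0.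
  have ps m : psdmx ((eta / (1 + x ^+ 2))%:C%:M : 'M[C]_m).
    by apply: psd_scalar; rewrite divr_ge0 // ltW.
  rewrite /G !Gam_scale Ex EA EW (lieb_fun_scale sp J _ _ _ _ x20).
  - by rewrite mulrC mulKf // gt_eqF.
  - exact: pdD (pd_convex hA1 hA2 hs) (ps n).
  - exact: pdD (pd_convex hW1 hW2 hs) (ps k).
have ee x : 0 <= eta / (1 + x ^+ 2) <= eta by exact: div_1D_sqr_le.
have up x etx : eta <= etx -> 0 <= eta / (1 + x ^+ 2) <= etx.
  by move=> hx; have /andP[-> h2] := ee x; exact: le_trans hx.
have G1 : kap^-1 ^+ 2 * lieb_fun Phi J b p A1 W1 <= G x1.
  rewrite (GE x1 1 Ex1 i1) subrr scale1r scale0r addr0 scale1r scale0r addr0.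
  by have /andP[] := P1 p' _ hp' (le_trans hjK etl1) (up x1 _ etl1).
have G2 : kap^-1 ^+ 2 * lieb_fun Phi J b p A2 W2 <= G x2.
  rewrite (GE x2 0 Ex2 i0) subr0 scale1r scale0r add0r scale1r scale0r add0r.
  by have /andP[] := P2 p' _ hp' (le_trans hjK etl2) (up x2 _ etl2).
have G3 : G x3 <= kap ^+ 2 * lieb_fun Phi J b p A3 W3.
  rewrite (GE x3 t Ex3 ht).
  by have /andP[] := P3 p' _ hp' (le_trans hjK etl3) (up x3 _ etl3).
exact: perturb_arith ht h0 h1 he L3 G1 G2 G3 main.
Qed.

End Lieb.

End LiebConcavity.

(** * Trace Young inequality and concavity of trace powers *)

Section TracePower.
Variable R : realType.
Local Notation C := R[i].
Local Notation Re := (@complex.Re R).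

Definition trpow (e : R) k (N : 'M[C]_k) : R := Re (\tr (mpow e N)).

Lemma trpow_specmx e k (U : 'M[C]_k) (d : 'I_k -> R) : U \is unitarymx ->
  trpow e (specmx U (fun i => (d i)%:C)) = \sum_i d i `^ e.
Proof. by move=> hU; rewrite /trpow (mpow_specmx _ _ hU) (tr_specmx _ hU) Re_sum. Qed.

Lemma young_powR (a w p : R) : 0 <= a -> 0 <= w -> 0 < p <= 1 ->
  a * w `^ (1 - p) <= p * a `^ p^-1 + (1 - p) * w.
Proof.
move=> a0 w0 /andP[p0 p1]; have [->|pn] := eqVneq p 1.
  by rewrite subrr powRr0 mulr1 invr1 powRr1 // mul1r mul0r addr0.
have q0 : 0 < 1 - p by rewrite subr_gt0 lt_neqAle pn.
have hP : 0 < p^-1 by rewrite invr_gt0.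
have hQ : 0 < (1 - p)^-1 by rewrite invr_gt0.
have hpq : p^-1^-1 + (1 - p)^-1^-1 = 1 by rewrite !invrK addrC subrK.
have := conjugate_powR a0 (powR_ge0 w (1 - p)) hP hQ hpq.
rewrite !invrK -powRrM mulfV ?gt_eqF // powRr1 //.
by rewrite [_ * p]mulrC [w * _]mulrC.
Qed.

(** The squared inner products of two eigenbases form a doubly stochastic matrix; averaging with it
    reduces the trace inequality to the scalar one. *)
Definition overlap k (U V : 'M[C]_k) (i j : 'I_k) : R :=
  normc ((row j V *m U^t*) 0 i) ^+ 2.

Lemma overlap_sum_l k (U V : 'M[C]_k) j : U \is unitarymx -> V \is unitarymx ->
  \sum_i overlap U V i j = 1.
Proof.
move=> hU hV; rewrite -(sqnorm_row_unitary j hV) -(sqnorm_unitary (row j V) hU).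
by [].
Qed.

Lemma overlap_sum_r k (U V : 'M[C]_k) i : U \is unitarymx -> V \is unitarymx ->
  \sum_j overlap U V i j = 1.
Proof.
move=> hU hV; rewrite -(sqnorm_row_unitary i hU) -(sqnorm_unitary (row i U) hV) /sqnorm.
apply: eq_bigr => j _; rewrite /overlap -normcJ'; congr (normc _ ^+ 2).
rewrite -[LHS]/(Num.conj _) conj_mxE adjM trmxCK -!row_mul !mxE.
by apply: eq_bigr => a _; rewrite !mxE.
Qed.

Lemma young_trace k (N W : 'M[C]_k) (p : R) : pdmx N -> pdmx W -> 0 < p <= 1 ->
  Re (\tr (N *m mpow (1 - p) W)) <= p * trpow p^-1 N + (1 - p) * Re (\tr W).
Proof.
move=> /pd_spec[U [d [hU -> d0]]] /pd_spec[V [w [hV -> w0]]] hp.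
rewrite (mpow_specmx _ _ hV) hf_specmx_rows Re_sum (trpow_specmx _ _ hU).
rewrite (tr_specmx _ hV) Re_sum.
have -> : p * \sum_i d i `^ p^-1 = \sum_j \sum_i overlap U V i j * (p * d i `^ p^-1).
  rewrite exchange_big mulr_sumr; apply: eq_bigr => i _.
  by rewrite -mulr_suml (overlap_sum_r i hU hV) mul1r.
have -> : (1 - p) * \sum_j Re (w j)%:C = \sum_j \sum_i overlap U V i j * ((1 - p) * w j).
  rewrite mulr_sumr; apply: eq_bigr => j _.
  by rewrite -mulr_suml (overlap_sum_l j hU hV) mul1r.
rewrite -big_split; apply: ler_sum => j _ /=; rewrite -big_split ReZ -/(qf _ _) qf_specmx.
rewrite mulr_sumr; apply: ler_sum => i _ /=; rewrite -/(overlap U V i j) -mulrDr.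
rewrite mulrA [leLHS]mulrC ler_wpM2l ?sqr_ge0 // mulrC.
by apply: young_powR => //; exact: ltW.
Qed.

(** [W = N ^ (1 / p)] is the equality case of [young_trace]. *)
Lemma trpow_equality k (N : 'M[C]_k) (p : R) : pdmx N -> 0 < p <= 1 ->
  Re (\tr (N *m mpow (1 - p) (mpow p^-1 N))) = trpow p^-1 N.
Proof.
move=> /pd_spec[U [d [hU -> d0]]] /andP[p0 p1].
rewrite !(mpow_specmx _ _ hU) (specmxM _ _ hU) (tr_specmx _ hU) (trpow_specmx _ _ hU) Re_sum.
apply: eq_bigr => i _; rewrite -rmorphM /= -powRrM.
rewrite -{1}[d i]powRr1 ?ltW // -powRD ?(gt_eqF (d0 i)) ?implybT //.
by congr (_ `^ _); field; rewrite gt_eqF.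
Qed.

Lemma congr_pd k l (J : 'M[C]_(k, l)) (Z : 'M[C]_l) : pdmx Z ->
  (forall v : 'rV_k, v *m J = 0 -> v = 0) -> pdmx (J *m Z *m J^t*).
Proof.
move=> /pdmxP[hZ h] hJ; apply/pdmxP; split=> [|v v0]; first exact: herm_congr.
by rewrite /qf hf_congr; apply: h; apply: contra v0 => /eqP/hJ ->.
Qed.

Lemma tr_convex k (t : R) (X Y : 'M[C]_k) :
  Re (\tr (t%:C *: X + (1 - t)%:C *: Y)) = t * Re (\tr X) + (1 - t) * Re (\tr Y).
Proof. by rewrite mxtraceD !mxtraceZ ReD !ReZ. Qed.

Lemma convex_absorb (p t a b a' b' c d : R) : 0 < p -> a = a' -> b = b' ->
  t * a + (1 - t) * b <= c -> c <= p * d + (1 - p) * (t * a' + (1 - t) * b') ->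
  t * a' + (1 - t) * b' <= d.
Proof.
move=> p0 -> -> h h'; have {h h'} hh := le_trans h h'.
have : p * (t * a' + (1 - t) * b') <= p * d by clear -hh; lra.
by rewrite ler_pM2l.
Qed.

(** [trpow p^-1 N] is the maximum over [W] of [(tr (N W^(1 - p)) - (1 - p) tr W) / p]. The
    maximisers for [N1] and [N2] are inserted, and their convex combination is a competitor for
    [N3]. *)
Lemma carlen_lieb k (N1 N2 N3 : 'M[C]_k) (p t : R) : 0 < p <= 1 -> 0 <= t <= 1 ->
  pdmx N1 -> pdmx N2 -> pdmx N3 ->
  (forall W1 W2, pdmx W1 -> pdmx W2 ->
    t * Re (\tr (N1 *m mpow (1 - p) W1)) + (1 - t) * Re (\tr (N2 *m mpow (1 - p) W2)) <=
    Re (\tr (N3 *m mpow (1 - p) (t%:C *: W1 + (1 - t)%:C *: W2)))) ->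
  t * trpow p^-1 N1 + (1 - t) * trpow p^-1 N2 <= trpow p^-1 N3.
Proof.
move=> hp ht h1 h2 h3 H; have /andP[p0 _] := hp.
have W1 := mpow_pd p^-1 h1; have W2 := mpow_pd p^-1 h2.
have h' := young_trace h3 (pd_convex W1 W2 ht) hp; rewrite tr_convex in h'.
exact: (convex_absorb p0 (trpow_equality h1 hp) (trpow_equality h2 hp) (H _ _ W1 W2) h').
Qed.

Lemma trpow_concave n l (Phi : {linear 'M[C]_n -> 'M[C]_l}) k (J : 'M[C]_(k, l))
  b (p : R) (A1 A2 : 'M[C]_n) (t : R) : strictly_positive Phi ->
  (forall v : 'rV_k, v *m J = 0 -> v = 0) -> 0 < p <= 1 -> pdmx A1 -> pdmx A2 -> 0 <= t <= 1 ->
  t * trpow p^-1 (J *m Zmap Phi b p A1 *m J^t*) + (1 - t) * trpow p^-1 (J *m Zmap Phi b p A2 *m J^t*) <=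
  trpow p^-1 (J *m Zmap Phi b p (t%:C *: A1 + (1 - t)%:C *: A2) *m J^t*).
Proof.
move=> sp hJ hp hA1 hA2 ht; have /andP[p0 p1] := hp.
have hA3 := pd_convex hA1 hA2 ht.
have hN A : pdmx A -> pdmx (J *m Zmap Phi b p A *m J^t*).
  by move=> hA; apply: congr_pd hJ; exact: Zmap_pd.
apply: (carlen_lieb hp ht (hN _ hA1) (hN _ hA2) (hN _ hA3)) => W1 W2 hW1 hW2.
have hp' : 0 <= p <= 1 by rewrite ltW.
exact: (lieb_concave sp J b hp' hA1 hA2 hW1 hW2 ht).
Qed.

End TracePower.

(** * Simultaneous diagonalisation by dual bases and interlacing *)

Section KyFan.
Variable R : realType.
Local Notation C := R[i].
Local Notation Re := (@complex.Re R).

Definition rdiag k (x : 'I_k -> R) : 'M[C]_k := diag_mx (\row_i (x i)%:C).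

(* the [mu i] are the eigenvalues of [X^(1/2) Y X^(1/2)] *)
Definition simdiag l (X Y : 'M[C]_l) (mu : 'I_l -> R) (L J : 'M[C]_l) : Prop :=
  [/\ J *m L^t* = 1%:M, J *m X *m J^t* = 1%:M & L *m Y *m L^t* = rdiag mu].

(** With [S = X ^ (1/2)] and [U] a matrix of eigenvectors of [S Y S], take [L = U S] and
    [J = U S^-1]. Dual bases remove the square root and make the roles of [X] and [Y]
    exchangeable. *)
Lemma simdiag_exists l (X Y : 'M[C]_l) : pdmx X -> pdmx Y -> exists mu L J,
  [/\ simdiag X Y mu L J, forall i, 0 < mu i &
   forall f, \tr (mxfun f (mpow (1 / 2) X *m Y *m mpow (1 / 2) X)) = (\sum_i f (mu i))%:C].
Proof.
move=> hX hY; have hS := mpow_pd (1 / 2) hX; have [hhS _] := hS.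
have SS : mpow (1 / 2) X *m mpow (1 / 2) X = X.
  have [U [d [hU -> d0]]] := pd_spec hX; rewrite (mpow_specmx _ _ hU) (specmxM _ _ hU).
  apply: eq_specmx => i; rewrite -rmorphM -powRD ?(gt_eqF (d0 i)) ?implybT //.
  by rewrite -splitr powRr1 // ltW.
move: (mpow _ X) hS hhS SS => S hS hhS SS.
have uS := pd_unit hS.
have hM : pdmx (S *m Y *m S).
  rewrite -{2}hhS; apply: congr_pd => // v E.
  by rewrite -[v]mulmx1 -(mulmxV uS) mulmxA E mul0mx.
have [U [mu [hU EM mu0]]] := pd_spec hM; exists mu, (U *m S), (U *m invmx S); split=> //.
  have iS := invmx_herm uS hhS; split.
  - rewrite adjM hhS !mulmxA -(mulmxA U (invmx S) S) (mulVmx uS) mulmx1.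
    exact: unitary_right.
  - rewrite adjM iS -SS !mulmxA -(mulmxA U (invmx S) S) (mulVmx uS) mulmx1.
    by rewrite -(mulmxA U S (invmx S)) (mulmxV uS) mulmx1 unitary_right.
  - rewrite adjM hhS !mulmxA -(mulmxA U S Y) -(mulmxA U (S *m Y) S) EM /specmx !mulmxA.
    by rewrite (unitary_right hU) mul1mx -mulmxA (unitary_right hU) mulmx1.
by move=> f; rewrite EM (mxfun_specmx _ _ hU) (tr_specmx _ hU) rmorph_sum.
Qed.

Lemma rdiagM k (x y : 'I_k -> R) : rdiag x *m rdiag y = rdiag (fun i => x i * y i).
Proof.
rewrite /rdiag mulmx_diag; set a := \row__ _; set b := \row__ _.
by have -> // : a = b; apply/rowP => i; rewrite !mxE rmorphM.
Qed.

Lemma rdiag1 k (x : 'I_k -> R) : (forall i, x i = 1) -> rdiag x = 1%:M.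
Proof.
move=> h; rewrite /rdiag; have -> : \row_i (x i)%:C = const_mx 1.
  by apply/rowP => i; rewrite !mxE h.
by rewrite diag_const_mx.
Qed.

Lemma adj_rdiag k (x : 'I_k -> R) : (rdiag x)^t* = rdiag x.
Proof.
apply/matrixP => i j; rewrite !mxE; case: (eqVneq i j) => [->|ij].
  by rewrite !mulr1n; exact: conjcR.
by rewrite !mulr0n conjC0.
Qed.

Lemma rdiag_specmx k (x : 'I_k -> R) : rdiag x = specmx 1%:M (fun i => (x i)%:C).
Proof. by rewrite /specmx adj1 mul1mx mulmx1. Qed.

Lemma unitary1 k : (1%:M : 'M[C]_k) \is unitarymx.
Proof. by apply/unitarymxP; rewrite adj1 mulmx1. Qed.

Lemma trpow_rdiag e k (x : 'I_k -> R) : trpow e (rdiag x) = \sum_i x i `^ e.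
Proof. by rewrite rdiag_specmx (trpow_specmx _ _ (unitary1 k)). Qed.

(** The relations amount to [X = L^t* *m L] and [Y = J^t* *m rdiag mu *m J]; their inverses have the
    same shape with [L] and [J] exchanged. *)
Lemma simdiag_inv l (X Y : 'M[C]_l) mu L J : pdmx X -> pdmx Y -> (forall i, 0 < mu i) ->
  simdiag X Y mu L J -> simdiag (invmx X) (invmx Y) (fun i => (mu i)^-1) J L.
Proof.
move=> hX hY mu0 [h1 h2 h3].
have LJ : L *m J^t* = 1%:M by rewrite -[L]trmxCK -adjM h1 adj1.
have JL := mulmx1C h1; have JL' := mulmx1C LJ.
have uX := pd_unit hX; have uY := pd_unit hY.
split=> //.
- have -> : invmx X = J^t* *m J.
    apply: (can_inj (mulKmx uX)); rewrite (mulmxV uX).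
    have -> : X = L^t* *m L.
      rewrite -[X]mul1mx -[X]mulmx1 -{1}JL -JL' !mulmxA -(mulmxA _ J X).
      by rewrite -(mulmxA _ (J *m X)) h2 mulmx1.
    by rewrite !mulmxA -(mulmxA _ L) LJ mulmx1 JL.
  by rewrite !mulmxA LJ mul1mx h1.
- have YE : Y = J^t* *m rdiag mu *m J.
    by rewrite -h3 !mulmxA JL' mul1mx -mulmxA JL mulmx1.
  have -> : invmx Y = L^t* *m rdiag (fun i => (mu i)^-1) *m L.
    apply: (can_inj (mulKmx uY)); rewrite (mulmxV uY) {1}YE !mulmxA.
    rewrite -(mulmxA _ J) h1 mulmx1 -(mulmxA _ (rdiag mu)) rdiagM rdiag1; last first.
      by move=> i; rewrite divff // gt_eqF.
    by rewrite mulmx1 JL'.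
  by rewrite !mulmxA h1 mul1mx -mulmxA LJ mulmx1.
Qed.

Lemma rowsub_congr k l m (f : 'I_k -> 'I_l) (A : 'M[C]_(l, m)) (X : 'M[C]_m) (B : 'M[C]_(l, m)) i j :
  (rowsub f A *m X *m (rowsub f B)^t*) i j = (A *m X *m B^t*) (f i) (f j).
Proof.
have -> : rowsub f A *m X = rowsub f (A *m X).
  by apply/matrixP => a b; rewrite !mxE; apply: eq_bigr => c _; rewrite !mxE.
move: (A *m X) => Z; rewrite !mxE; apply: eq_bigr => a _; by rewrite !mxE.
Qed.

Lemma row_sqnorm_mul k l (A : 'M[C]_(k, l)) i : (A *m A^t*) i i = (sqnorm (row i A))%:C.
Proof.
rewrite mxE /sqnorm rmorph_sum; apply: eq_bigr => a _.
by rewrite !mxE mulcJ.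
Qed.

Lemma cauchy_schwarz l (u v : 'rV[C]_l) :
  Re ((u *m v^t*) 0 0) ^+ 2 <= sqnorm u * sqnorm v.
Proof.
have [->|v0] := eqVneq v 0.
  by rewrite trmx0 map_mx0 mulmx0 mxE /= expr0n mulr_ge0 // ?sqnorm_ge0.
have nv : 0 < sqnorm v by rewrite sqnorm_gt0.
pose t := Re ((u *m v^t*) 0 0) / sqnorm v.
have := sqnorm_ge0 (u - t%:C *: v).
rewrite -qf1 /qf hfB_vec !hf1 !mulmx1 ReD !ReB.
have -> : (t%:C *: v)^t* = t%:C *: v^t*.
  by rewrite adjZ; congr (_ *: _); exact: conjcR.
rewrite -!scalemxAl -!scalemxAr scalerA.
have vu := Re_form_sym u v.
have vv : Re ((v *m v^t*) 0 0) = sqnorm v.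
  by rewrite -qf1 /qf /hf mulmx1.
have sc (c : R) (M : 'M[C]_1) : Re ((c%:C *: M) 0 0) = c * Re (M 0 0).
  by rewrite mxE ReZ.
rewrite -rmorphM !sc vu vv /t.
move: (Re ((u *m _) 0 0)) (sqnorm u) (sqnorm v) nv; clear=> a b c c0; rewrite [Re b%:C]/= => h.
rewrite -ler_pdivrMr //; have c1 : c != 0 by rewrite gt_eqF.
have E : a / c * (a / c) * c = a ^+ 2 / c by field.
have E2 : a / c * a = a ^+ 2 / c by field.
by move: h; rewrite E E2; lra.
Qed.

(* a nontrivial combination of the [r > i] rows of [D] vanishes on the [i] columns in the
   image of [f] *)
Lemma interlace (r l i : nat) (D E : 'M[C]_(r, l)) (z : 'I_r -> R) (mu : 'I_l -> R)
  (f : 'I_i -> 'I_l) (Z m0 : R) : (i < r)%N ->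
  E *m D^t* = 1%:M -> E *m E^t* = 1%:M -> D *m rdiag mu *m D^t* = rdiag z ->
  (forall a, z a <= Z) -> 0 <= m0 -> (forall m, 0 <= mu m) ->
  (forall m, m0 <= mu m \/ exists a, f a = m) -> m0 <= Z.
Proof.
move=> ir ED EE DD hz hm0 mu0 hm.
pose Mx : 'M[C]_(r, i) := colsub f D.
have [b b0 bM] : exists2 b : 'rV[C]_r, b != 0 & b *m Mx = 0.
  have : kermx Mx != 0.
    rewrite kermx_eq0; apply/negP => /eqP hr.
    have := rank_leq_col Mx; rewrite hr; move: ir; rewrite ltnNge => /negP h h'.
    exact: h.
  by move=> /rowV0Pn[b bk b0]; exists b => //; exact/sub_kermxP.
pose v := b *m D.
have vf a : v 0 (f a) = 0.
  have /rowP/(_ a) := bM; rewrite mxE [RHS]mxE => <-; rewrite /v mxE.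
  by apply: eq_bigr => c _; rewrite [Mx c a]mxE.
have nb : 0 < sqnorm b by rewrite sqnorm_gt0.
have nv : sqnorm b <= sqnorm v.
  have E1 : ((b *m E) *m v^t*) 0 0 = (sqnorm b)%:C.
    rewrite /v adjM mulmxA -(mulmxA b E) ED mulmx1 -hf1 /hf mulmx1 //.
  have E2 : sqnorm (b *m E) = sqnorm b.
    by rewrite -!qf1 /qf -hf_congr mulmx1 EE.
  have := cauchy_schwarz (b *m E) v; rewrite E1 E2 /= expr2 ler_pM2l //.
have q1 : qf (rdiag mu) v = \sum_m mu m * normc (v 0 m) ^+ 2.
  by rewrite rdiag_specmx qf_specmx adj1 mulmx1.
have q2 : qf (rdiag mu) v = \sum_a z a * normc (b 0 a) ^+ 2.
  by rewrite /qf /v -hf_congr DD -/(qf _ _) rdiag_specmx qf_specmx adj1 mulmx1.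
have lo : m0 * sqnorm v <= qf (rdiag mu) v.
  rewrite q1 /sqnorm mulr_sumr; apply: ler_sum => m _.
  case: (hm m) => [h|[a <-]]; first by rewrite ler_wpM2r ?sqr_ge0.
  by rewrite vf normc0 expr0n !mulr0.
have hi : qf (rdiag mu) v <= Z * sqnorm b.
  rewrite q2 /sqnorm mulr_sumr; apply: ler_sum => a _.
  by rewrite ler_wpM2r ?sqr_ge0.
have : m0 * sqnorm b <= Z * sqnorm b.
  by apply: le_trans (le_trans lo hi); rewrite ler_wpM2l.
by rewrite ler_pM2r.
Qed.

End KyFan.

(** * The lower bound in the variational formula for sums of smallest eigenvalues *)

Section KyFanLower.
Variable R : realType.
Local Notation C := R[i].
Local Notation Re := (@complex.Re R).

Lemma sort_injection l (mu : 'I_l -> R) : exists2 s : 'I_l -> 'I_l, injective s &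
  forall i j : 'I_l, (i <= j)%N -> mu (s i) <= mu (s j).
Proof.
case: l mu => [|l] mu; first by exists id => // -[].
pose r := relpre mu <=%O; pose e := sort r (enum 'I_l.+1).
have se : size e = l.+1 by rewrite size_sort size_enum_ord.
have tr : transitive r by move=> y x z; exact: le_trans.
have rr : reflexive r by move=> x; exact: lexx.
have tot : total r by move=> x y; exact: le_total.
exists (fun i => nth ord0 e i) => [i j /eqP|i j ij].
  by rewrite nth_uniq ?se ?sort_uniq ?enum_uniq // => /eqP; exact: val_inj.
have := sorted_leq_nth tr rr ord0 (sort_sorted tot (enum 'I_l.+1)).
by move=> /(_ i j); rewrite !inE -/e se; apply.
Qed.

Lemma simdiag_sort l (X Y : 'M[C]_l) mu L J : simdiag X Y mu L J ->
  exists2 s : 'I_l -> 'I_l, injective s &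
    simdiag X Y (mu \o s) (rowsub s L) (rowsub s J) /\
    forall i j : 'I_l, (i <= j)%N -> mu (s i) <= mu (s j).
Proof.
move=> [h1 h2 h3]; have [s si hs] := sort_injection mu; exists s => //; split=> //; split.
- rewrite -[rowsub s J]mulmx1; apply/matrixP => i j.
  by rewrite rowsub_congr mulmx1 h1 !mxE (inj_eq si).
- by apply/matrixP => i j; rewrite rowsub_congr h2 !mxE (inj_eq si).
- by apply/matrixP => i j; rewrite rowsub_congr h3 !mxE (inj_eq si).
Qed.

Lemma sqr_inv_mpow k (N : 'M[C]_k) : pdmx N -> exists2 S, S^t* = S &
  S *m N *m S = 1%:M.
Proof.
move=> /pd_spec[U [d [hU -> d0]]]; exists (specmx U (fun i => (d i `^ (- (1 / 2)))%:C)).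
  exact: herm_specmx.
rewrite !(specmxM _ _ hU) -(specmx_const 1 hU); apply: eq_specmx => i.
rewrite -!rmorphM -{2}[d i]powRr1 ?(ltW (d0 i)) // -!powRD ?(gt_eqF (d0 i)) ?implybT //.
have -> : - (1 / 2) + 1 + - (1 / 2) = 0 :> R by field.
by rewrite powRr0.
Qed.

Lemma row_mul_diag k l (A : 'M[C]_(k, l)) (B : 'M[C]_l) i :
  hf B (row i A) = (A *m B *m A^t*) i i.
Proof.
rewrite /hf -row_mul !mxE; apply: eq_bigr => a _; by rewrite !mxE.
Qed.

(* the squared norms of the rows are the diagonal entries of [Q *m Q^t*], which is unitarily
   similar to [Q^t* *m Q] by the polar decomposition of [Q] *)
Lemma row_power_sum k (Q N : 'M[C]_k) (p : R) : 0 < p <= 1 -> pdmx N -> Q^t* *m Q = N ->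
  \sum_i sqnorm (row i Q) `^ p^-1 <= trpow p^-1 N.
Proof.
move=> hp hN QN; have /andP[p0 p1] := hp; have [S hS SNS] := sqr_inv_mpow hN.
pose V := Q *m S.
have V1 : V^t* *m V = 1%:M by rewrite /V adjM hS !mulmxA -(mulmxA S) QN.
have V2 : V *m V^t* = 1%:M by exact: mulmx1C.
have hV : V \is unitarymx by apply/unitarymxP.
have VNV : V *m N *m V^t* = Q *m Q^t*.
  rewrite /V adjM hS !mulmxA -(mulmxA Q S N) -(mulmxA Q _ S) SNS mulmx1 //.
pose m i := sqnorm (row i Q).
have hm i : hf N (row i V) = (m i)%:C by rewrite row_mul_diag VNV row_sqnorm_mul.
have m0 i : 0 < m i.
  have /pdmxP[_ /(_ _ (row_unitary_neq0 i hV))] := hN.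
  by rewrite /qf hm.
(* For this [W] both [tr (N W^(1 - p))] and [tr W] equal the sum of the [m i ^ (1 / p)], so Young's
   trace inequality leaves [p] times the claim. *)
have hW : pdmx (specmx V (fun i => (m i `^ p^-1)%:C)).
  by apply: pd_specmx => // i; exact: powR_gt0.
have := young_trace hN hW hp.
rewrite (mpow_specmx _ _ hV) hf_specmx_rows Re_sum (tr_specmx _ hV) Re_sum.
have -> : \sum_j Re (((m j `^ p^-1) `^ (1 - p))%:C * hf N (row j V)) = \sum_j m j `^ p^-1.
  apply: eq_bigr => j _; rewrite hm -rmorphM /= -powRrM -{2}[m j]powRr1 ?(ltW (m0 j)) //.
  rewrite -powRD ?(gt_eqF (m0 j)) ?implybT //; congr (_ `^ _).
  by field; rewrite gt_eqF.
rewrite -[\sum_j Re _]/(\sum_j m j `^ p^-1) -/(trpow p^-1 N).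
move: (\sum_j _) (trpow _ _) => a b h.
have : p * a <= p * b by clear -h; lra.
by rewrite ler_pM2l.
Qed.

Lemma sqnormZ k (c : R) (v : 'rV[C]_k) : sqnorm (c%:C *: v) = c ^+ 2 * sqnorm v.
Proof.
rewrite /sqnorm mulr_sumr; apply: eq_bigr => i _.
by rewrite mxE normcM exprMn normcR real_normK ?num_real.
Qed.

(** Young's inequality with weights [q / (p + q)] and [p / (p + q)]. A zero exponent kills its own
    term, the inverse of [0] being [0]; the matching factor must then be normalised to [1]. *)
Lemma young_split (a v z p q : R) : 0 <= p <= 1 -> 0 <= q <= 1 -> 0 < p + q ->
  0 < z -> 0 < a -> 0 < v -> z <= a * v -> (p = 0 -> v = 1) -> (q = 0 -> a = 1) ->
  z `^ (p + q)^-1 <= (p + q)^-1 * (q * a `^ q^-1 + p * v `^ p^-1).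
Proof.
move=> /andP[p0 p1] /andP[q0 q1] pq0 z0 a0 v0 zav hp hq.
have s0 : 0 < (p + q)^-1 by rewrite invr_gt0.
have zle (b : R) : z <= b -> z `^ (p + q)^-1 <= b `^ (p + q)^-1.
  move=> zb; apply: ge0_ler_powR => //; rewrite ?nnegrE ?(ltW s0) ?(ltW z0) //.
  by apply: le_trans zb; exact: ltW.
case: (ltgtP 0 p) p0 => // [pp _|pE _]; last first.
  subst p; rewrite mul0r addr0 add0r mulrA mulVf ?mul1r; last by rewrite -[q]add0r gt_eqF.
  by move: (zle a); rewrite add0r; apply; rewrite -[a]mulr1 -[X in _ <= _ * X]hp.
case: (ltgtP 0 q) q0 => // [qq _|qE _]; last first.
  subst q; rewrite mul0r add0r addr0 mulrA mulVf ?mul1r ?gt_eqF //.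
  by move: (zle v); rewrite addr0; apply; rewrite -[v]mul1r -[X in _ <= X * _]hq.
apply: le_trans (zle _ zav) _; rewrite powRM ?(ltW a0) ?(ltW v0) //.
have hs : 0 < q * (p + q)^-1 <= 1.
  by rewrite mulr_gt0 //= ler_pdivrMr // mul1r lerDr ltW.
have := @young_powR R (a `^ (p + q)^-1) (v `^ p^-1) _ (powR_ge0 _ _) (powR_ge0 _ _) hs.
rewrite -!powRrM.
have n1 : p + q != 0 by rewrite gt_eqF.
have n2 : q != 0 by rewrite gt_eqF.
have n3 : p != 0 by rewrite gt_eqF.
have -> : p^-1 * (1 - q / (p + q)) = (p + q)^-1 by field; rewrite n3 n1.
have -> : (p + q)^-1 * (q / (p + q))^-1 = q^-1 by field; rewrite n2 n1.
have -> : 1 - q / (p + q) = p / (p + q) by field.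
move: (a `^ q^-1) (v `^ p^-1) => u w h; apply: le_trans h _.
by rewrite mulrDr !mulrA ![_^-1 * _]mulrC.
Qed.

(** Compress to [N = J X J^t*] and [M = L Y L^t*], with dual bases [Jz], [Lz] and eigenvalues [z].
    Interlacing gives [mu i <= z i]. The squared row norms [u], [v] of [Jz], [Lz] satisfy
    [u i * v i >= 1] by Cauchy-Schwarz, so [z i <= (z i * u i) * v i], and [young_split] separates
    the factors. The two resulting power sums are bounded by traces of powers of [M] and [N] through
    [row_power_sum]. *)
Lemma kyfan_lower l k (hk : (k <= l)%N) (X Y : 'M[C]_l) mu L0 J0 (L J : 'M[C]_(k, l)) p q :
  simdiag X Y mu L0 J0 -> (forall i, 0 < mu i) ->
  (forall i j : 'I_l, (i <= j)%N -> mu i <= mu j) -> pdmx X -> pdmx Y ->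
  J *m L^t* = 1%:M -> 0 <= p <= 1 -> 0 <= q <= 1 -> 0 < p + q ->
  (p = 0 -> J *m X *m J^t* = 1%:M) -> (q = 0 -> L *m Y *m L^t* = 1%:M) ->
  \sum_(i < k) mu (widen_ord hk i) `^ (p + q)^-1 <= (p + q)^-1 *
    (q * trpow q^-1 (L *m Y *m L^t*) + p * trpow p^-1 (J *m X *m J^t*)).
Proof.
move=> [JL0 JX0 LY0] mu0 smu hX hY JL hp hq pq0 hp0 hq0.
have LJ : L *m J^t* = 1%:M by rewrite -[L]trmxCK -adjM JL adj1.
have LJ0 : L0 *m J0^t* = 1%:M by rewrite -[L0]trmxCK -adjM JL0 adj1.
have JL0' := mulmx1C JL0; have LJ0' := mulmx1C LJ0.
have injJ (v : 'rV_k) : v *m J = 0 -> v = 0.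
  by move=> h; rewrite -[v]mulmx1 -JL mulmxA h mul0mx.
have injL (v : 'rV_k) : v *m L = 0 -> v = 0.
  by move=> h; rewrite -[v]mulmx1 -LJ mulmxA h mul0mx.
have hN := congr_pd hX injJ; have hM := congr_pd hY injL.
have [z0 [Lz0 [Jz0 [sd0 z0pos _]]]] := simdiag_exists hN hM.
have [s si [sd sz]] := simdiag_sort sd0.
move: (rowsub s Lz0) (rowsub s Jz0) sd => Lz Jz [].
pose z := z0 \o s; have zpos i : 0 < z i by exact: z0pos.
rewrite -/z => JLz JNz LMz {sd0}.
have LJz : Lz *m Jz^t* = 1%:M by rewrite -[Lz]trmxCK -adjM JLz adj1.
have JLz' := mulmx1C JLz; have LJz' := mulmx1C LJz.
(* [D] and [E] are the coordinates of the compressed dual bases in the original ones. The first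
   [i.+1] rows of [D] are tested against the first [i] coordinates; outside these [mu] is at least
   its [i]-th value. *)
have zmu i : mu (widen_ord hk i) <= z i.
  pose D := Lz *m (L *m J0^t*); pose E := Jz *m (J *m L0^t*).
  have DL : D *m L0 = Lz *m L by rewrite /D -!mulmxA LJ0' mulmx1.
  have EJ : E *m J0 = Jz *m J by rewrite /E -!mulmxA JL0' mulmx1.
  have ED : E *m D^t* = 1%:M.
    have -> : E *m D^t* = (E *m J0) *m (D *m L0)^t*.
      by rewrite adjM mulmxA -(mulmxA E) JL0 mulmx1.
    by rewrite EJ DL adjM mulmxA -(mulmxA Jz) JL mulmx1.
  have EE : E *m E^t* = 1%:M.
    have -> : E *m E^t* = (E *m J0) *m X *m (E *m J0)^t*.
      by rewrite -[X in X *m _ = _]mulmx1 -JX0 adjM !mulmxA.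
    by rewrite EJ adjM -JNz !mulmxA.
  have DD : D *m rdiag mu *m D^t* = rdiag z.
    rewrite -LY0.
    have -> : D *m (L0 *m Y *m L0^t*) *m D^t* = (D *m L0) *m Y *m (D *m L0)^t*.
      by rewrite adjM !mulmxA.
    by rewrite DL adjM -LMz !mulmxA.
  pose f (a : 'I_i.+1) : 'I_k := widen_ord (ltn_ord i) a.
  pose f' (a : 'I_i) : 'I_l := widen_ord (leq_trans (ltnW (ltn_ord i)) hk) a.
  have fi : injective f by move=> a b /(congr1 val) /= h; exact: val_inj.
  apply: (@interlace R i.+1 l i (rowsub f D) (rowsub f E) (z \o f) mu f') => //.
  - apply/matrixP => a b; rewrite -[rowsub f E]mulmx1 rowsub_congr mulmx1 ED !mxE.
    by rewrite (inj_eq fi).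
  - apply/matrixP => a b; rewrite -{1}[rowsub f E]mulmx1 rowsub_congr mulmx1 EE !mxE.
    by rewrite (inj_eq fi).
  - by apply/matrixP => a b; rewrite rowsub_congr DD !mxE (inj_eq fi).
  - by move=> a; apply: sz; rewrite /= -ltnS.
  - exact: ltW.
  - by move=> m; exact: ltW.
  - move=> m; case: (leqP i m) => im; first by left; exact: smu.
    by right; exists (Ordinal im); exact: val_inj.
pose v i := sqnorm (row i Lz); pose u i := sqnorm (row i Jz).
have LLN : Lz^t* *m Lz = J *m X *m J^t*.
  move: (J *m X *m J^t*) JNz => N h.
  transitivity (Lz^t* *m (Jz *m N *m Jz^t*) *m Lz); first by rewrite h mulmx1.
  by rewrite !mulmxA JLz' mul1mx -mulmxA LJz' mulmx1.
(* A factor of [L Y L^t*] whose rows have squared norms [z i * u i], as needed for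
   [row_power_sum]. *)
pose Q := rdiag (fun i => Num.sqrt (z i)) *m Jz.
have QQM : Q^t* *m Q = L *m Y *m L^t*.
  have -> : Q^t* *m Q = Jz^t* *m rdiag z *m Jz.
    have -> : rdiag z = rdiag (fun i => Num.sqrt (z i) * Num.sqrt (z i)).
      by apply: f_equal; apply: funext => i; rewrite -expr2 sqr_sqrtr // ltW.
    by rewrite /Q adjM adj_rdiag -rdiagM !mulmxA.
  move: (L *m Y *m L^t*) LMz => M <-.
  by rewrite !mulmxA LJz' mul1mx -mulmxA JLz' mulmx1.
have Qu i : sqnorm (row i Q) = z i * u i.
  have -> : row i Q = (Num.sqrt (z i))%:C *: row i Jz.
    by rewrite /Q /rdiag mul_diag_mx; apply/rowP => j; rewrite !mxE.
  by rewrite sqnormZ sqr_sqrtr // ltW.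
have u0 i : 0 < u i.
  rewrite sqnorm_gt0; apply/eqP => h; have := congr1 (fun v => v *m Lz^t*) h.
  rewrite -row_mul JLz mul0mx => /rowP/(_ i); rewrite !mxE eqxx => /eqP.
  by rewrite oner_eq0.
have v0 i : 0 < v i.
  rewrite sqnorm_gt0; apply/eqP => h; have := congr1 (fun v => v *m Jz^t*) h.
  rewrite -row_mul LJz mul0mx => /rowP/(_ i); rewrite !mxE eqxx => /eqP.
  by rewrite oner_eq0.
have uv i : 1 <= u i * v i.
  have := cauchy_schwarz (row i Jz) (row i Lz).
  have -> : (row i Jz *m (row i Lz)^t*) 0 0 = (Jz *m Lz^t*) i i.
    by rewrite -row_mul !mxE; apply: eq_bigr => a _; rewrite !mxE.
  by rewrite JLz mxE eqxx /= expr1n.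
have row1 (A : 'M[C]_k) i : A^t* *m A = 1%:M -> sqnorm (row i A) = 1.
  by move=> h; apply: sqnorm_row_unitary; apply/unitarymxP; exact: mulmx1C.
apply: (@le_trans _ _ (\sum_(i < k) (p + q)^-1 * (q * (z i * u i) `^ q^-1 + p * v i `^ p^-1))).
  apply: ler_sum => i _; apply: young_split => //; rewrite ?mulr_gt0 //.
  - apply: le_trans (zmu i) _; rewrite -mulrA -[leLHS]mulr1 ler_pM2l //.
  - by move=> E; apply: row1; rewrite LLN hp0.
  - by move=> E; rewrite -Qu; apply: row1; rewrite QQM hq0.
rewrite -mulr_sumr ler_pM2l ?invr_gt0 // big_split -!mulr_sumr; apply: lerD.
  have /andP[q0 q1] := hq; case: (ltgtP 0 q) q0 => // [qq _|<- _]; last by rewrite !mul0r.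
  rewrite ler_pM2l //; under eq_bigr do rewrite -Qu.
  by apply: row_power_sum QQM => //; rewrite qq.
have /andP[p0 p1] := hp; case: (ltgtP 0 p) p0 => // [pp _|<- _]; last by rewrite !mul0r.
rewrite ler_pM2l //.
by apply: row_power_sum LLN => //; rewrite pp.
Qed.

End KyFanLower.

(** * Weak majorization and concave nondecreasing functions *)

Section Majorization.
Variable R : realType.
Local Open Scope classical_set_scope.

Definition concave_pos (g : R -> R) : Prop := forall x y t : R, 0 < x -> 0 < y -> 0 <= t <= 1 ->
  t * g x + (1 - t) * g y <= g (t * x + (1 - t) * y).

Definition nondecr_pos (g : R -> R) : Prop := forall x y : R, 0 < x -> x <= y -> g x <= g y.

Lemma concave_slopes g (x y z : R) : concave_pos g -> 0 < x -> x < y -> y < z ->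
  (g z - g y) / (z - y) <= (g y - g x) / (y - x).
Proof.
move=> cg x0 xy yz; have xz := lt_trans xy yz.
have d1 : 0 < z - y by rewrite subr_gt0.
have d2 : 0 < y - x by rewrite subr_gt0.
have d3 : 0 < z - x by rewrite subr_gt0.
rewrite ler_pdivrMr // mulrAC ler_pdivlMr //.
have ht : 0 <= ((z - y) / (z - x) : R) <= 1.
  by rewrite divr_ge0 ?(ltW d1) ?(ltW d3) //= ler_pdivrMr // mul1r lerD2l lerN2 ltW.
have := cg x z _ x0 (lt_trans x0 xz) ht.
have d3' : z - x != 0 by rewrite gt_eqF.
have -> : (z - y) / (z - x) * x + (1 - (z - y) / (z - x)) * z = y by field.
have -> : (z - y) / (z - x) * g x + (1 - (z - y) / (z - x)) * g z =
  ((z - y) * g x + (y - x) * g z) / (z - x) by field.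
rewrite ler_pdivrMr // => h; clear -h; lra.
Qed.

(** [w] is the supremum of the slopes to the right of [x]: finite because each slope to the left
    bounds them, nonnegative because [g] is nondecreasing. *)
Lemma supergradient g (x : R) : concave_pos g -> nondecr_pos g -> 0 < x ->
  exists2 w, 0 <= w & forall y, 0 < y -> g y <= g x + w * (y - x).
Proof.
move=> cg ng x0.
pose S := [set (g z - g x) / (z - x) | z in [set z | x < z]].
have S0 : S !=set0 by exists ((g (x + 1) - g x) / (x + 1 - x)), (x + 1) => //=; rewrite ltrDl.
have ubl y : 0 < y -> y < x -> ubound S ((g x - g y) / (x - y)).
  by move=> y0 yx _ [z /= xz <-]; exact: concave_slopes.
have hS : has_sup S.
  split=> //; exists ((g x - g (x / 2)) / (x - x / 2)).
  by apply: ubl; [rewrite divr_gt0 | rewrite ltr_pdivrMr // ltr_pMr // ltr1n].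
have inS z : x < z -> (g z - g x) / (z - x) <= sup S.
  by move=> xz; apply: ub_le_sup; [case: hS | exists z].
exists (sup S).
  apply: le_trans (inS (x + 1) _); last by rewrite ltrDl.
  by rewrite divr_ge0 // subr_ge0 ?lerDl //; apply: ng; rewrite ?lerDl.
move=> y y0; case: (ltgtP x y) => [xy|yx|->]; last by rewrite subrr mulr0 addr0.
- by have := inS y xy; rewrite ler_pdivrMr ?subr_gt0 // => h; clear -h; lra.
- have : sup S <= (g x - g y) / (x - y) by apply: ge_sup => //; exact: ubl.
  by rewrite ler_pdivlMr ?subr_gt0 // => h; clear -h; lra.
Qed.

Lemma abel_sum_ge0 l (w c : nat -> R) : (forall i, 0 <= w i) ->
  (forall i, (i.+1 < l)%N -> w i.+1 <= w i) ->
  (forall k, (k <= l)%N -> 0 <= \sum_(i < k) c i) -> 0 <= \sum_(i < l) w i * c i.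
Proof.
move=> w0; case: l => [|l] wd hc; first by rewrite big_ord0.
suff H k : (k <= l)%N -> w k * \sum_(i < k.+1) c i <= \sum_(i < k.+1) w i * c i.
  by apply: le_trans (H l (leqnn _)); rewrite mulr_ge0 // hc.
elim: k => [|k IH] kl; first by rewrite !big_ord1.
rewrite big_ord_recr [leRHS]big_ord_recr /= mulrDr lerD2r.
apply: le_trans (IH (ltnW kl)); apply: ler_wpM2r; last exact: wd.
by apply: hc; rewrite ltnS ltnW.
Qed.

(** The supergradients at the increasing [x i] are nonnegative and decrease with [i]. Abel summation
    against the partial sums gives a nonnegative total, and the supergradient inequalities at [x1 i]
    and [x2 i] do the rest. *)
Lemma weak_majorization_concave l g (x x1 x2 : 'I_l -> R) (t : R) :
  concave_pos g -> nondecr_pos g -> 0 <= t <= 1 ->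
  (forall i, 0 < x i) -> (forall i, 0 < x1 i) -> (forall i, 0 < x2 i) ->
  (forall i j : 'I_l, (i <= j)%N -> x i <= x j) ->
  (forall k (hk : (k <= l)%N), t * \sum_(i < k) x1 (widen_ord hk i) +
     (1 - t) * \sum_(i < k) x2 (widen_ord hk i) <= \sum_(i < k) x (widen_ord hk i)) ->
  t * \sum_i g (x1 i) + (1 - t) * \sum_i g (x2 i) <= \sum_i g (x i).
Proof.
move=> cg ng /andP[t0 t1] px px1 px2 sx hmaj.
case: l x x1 x2 px px1 px2 sx hmaj => [|l] x x1 x2 px px1 px2 sx hmaj.
  by rewrite !big_ord0 !mulr0 addr0.
(* The value [0] at nonpositive [y] is a dummy; all points used are positive. *)
have /boolp.choice[w hw] : forall y, exists w, 0 < y ->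
    0 <= w /\ forall z, 0 < z -> g z <= g y + w * (z - y).
  move=> y; case: (ltP 0 y) => [y0|_]; last by exists 0.
  by have [w w0 h] := supergradient cg ng y0; exists w.
pose c i := x i - (t * x1 i + (1 - t) * x2 i).
have wle y z : 0 < y -> y <= z -> w z <= w y.
  move=> y0; rewrite le_eqVlt => /orP[/eqP-> //|yz]; have z0 := lt_trans y0 yz.
  have h1 := (hw y y0).2 _ z0; have h2 := (hw z z0).2 _ y0.
  have d : 0 < z - y by rewrite subr_gt0.
  by rewrite -(ler_pM2r d); clear -h1 h2; lra.
have key : 0 <= \sum_i w (x i) * c i.
  have := @abel_sum_ge0 l.+1 (fun i => w (x (inord i))) (fun i => c (inord i)) _ _ _.
  have -> : \sum_(i < l.+1) w (x (inord i)) * c (inord i) = \sum_i w (x i) * c i.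
    by apply: eq_bigr => i _; rewrite inord_val.
  apply=> [i|i il|k kl]; first by case: (hw _ (px (inord i))).
    by apply: wle => //; apply: sx; rewrite !inordK // ltnW.
  have E (i : 'I_k) : inord i = widen_ord kl i.
    by apply: val_inj; rewrite /= inordK //; apply: leq_trans kl.
  under eq_bigr do rewrite E.
  rewrite sumrB subr_ge0 big_split -!mulr_sumr; exact: hmaj.
rewrite !mulr_sumr -big_split -subr_ge0 -sumrB; apply: le_trans key _.
apply: ler_sum => i _ /=; have [_ h] := hw _ (px i).
have h1 := h _ (px1 i); have h2 := h _ (px2 i).
have h1' := ler_wpM2l t0 h1; have h2' : (1 - t) * g (x2 i) <= (1 - t) * (g (x i) + w (x i) * (x2 i - x i)).
  by rewrite ler_wpM2l // subr_ge0.
rewrite /c; clear -h1' h2'; lra.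
Qed.

End Majorization.

(** * Operator monotone functions are nondecreasing and concave *)

Section OpMonotone.
Variable R : realType.
Local Notation C := R[i].
Local Notation Re := (@complex.Re R).

Lemma pd_rdiag k (x : 'I_k -> R) : (forall i, 0 < x i) -> pdmx (rdiag x).
Proof. by move=> h; rewrite rdiag_specmx; apply: pd_specmx => //; exact: unitary1. Qed.

Lemma qf_rdiag k (x : 'I_k -> R) v : qf (rdiag x) v = \sum_i x i * normc (v 0 i) ^+ 2.
Proof. by rewrite rdiag_specmx qf_specmx adj1 mulmx1. Qed.

Lemma herm_rdiag k (x : 'I_k -> R) : hermitian_mx (rdiag x).
Proof. exact: adj_rdiag. Qed.

Lemma rdiagB k (x y : 'I_k -> R) : rdiag x - rdiag y = rdiag (fun i => x i - y i).
Proof. by rewrite /rdiag -raddfB; congr diag_mx; apply/rowP => i; rewrite !mxE rmorphB. Qed.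

Lemma mxfun_rdiag (h : R -> R) k (x : 'I_k -> R) : mxfun h (rdiag x) = rdiag (fun i => h (x i)).
Proof. by rewrite !rdiag_specmx (mxfun_specmx _ _ (unitary1 _ k)). Qed.

Lemma qf_delta k (A : 'M[C]_k) i : qf A (delta_mx 0 i) = Re (A i i).
Proof.
rewrite /qf /hf -rowE; congr Re; rewrite mxE (bigD1 i) //= big1 ?addr0 => [|j ji].
  by rewrite !mxE !eqxx conjC1 mulr1.
by rewrite !mxE (negPf ji) ?andbF conjC0 mulr0.
Qed.

Lemma op_monotone_nondecr (g : R -> R) : op_monotone g -> nondecr_pos g.
Proof.
move=> mg x y x0 xy.
have hx : pdmx (rdiag (fun _ : 'I_1 => x)) by apply: pd_rdiag.
have hy : pdmx (rdiag (fun _ : 'I_1 => y)) by apply: pd_rdiag => _; exact: lt_le_trans xy.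
have P : loewner_le (rdiag (fun _ : 'I_1 => x)) (rdiag (fun _ => y)).
  rewrite /loewner_le rdiagB; apply/psdmxP; split=> [|v]; first exact: herm_rdiag.
  by rewrite qf_rdiag big_ord1 mulr_ge0 ?sqr_ge0 // subr_ge0.
have := mg _ _ _ hx hy P; rewrite /loewner_le !mxfun_rdiag rdiagB => /psdmxP[_ h].
by have := h (delta_mx 0 0); rewrite qf_delta !mxE eqxx mulr1n subr_ge0.
Qed.

Lemma sqr_normcD_le (e : R) (a b : C) : 0 < e ->
  normc (a + b) ^+ 2 <= (1 + e) * normc a ^+ 2 + (1 + e^-1) * normc b ^+ 2.
Proof.
move=> e0; apply: (@le_trans _ _ ((normc a + normc b) ^+ 2)).
  by rewrite ler_sqr ?nnegrE ?addr_ge0 ?normc_ge0 //; exact: ler_normcD.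
move: (normc a) (normc b) => x y; rewrite -subr_ge0.
have -> : (1 + e) * x ^+ 2 + (1 + e^-1) * y ^+ 2 - (x + y) ^+ 2 = e * (x - y / e) ^+ 2.
  by field; rewrite gt_eqF.
by rewrite mulr_ge0 ?sqr_ge0 // ltW.
Qed.

Definition rot (c s : R) : 'M[C]_2 :=
  \matrix_(i, j) (if i == j then c%:C else if i == 0 then s%:C else (- s)%:C).

Lemma rot_unitary (c s : R) : c ^+ 2 + s ^+ 2 = 1 -> rot c s \is unitarymx.
Proof.
move=> h; apply/unitarymxP/matrixP => i j; rewrite !mxE.
have cj (r : R) : (r%:C)^*%R = r%:C by exact: conjcR.
rewrite !big_ord_recl big_ord0 addr0 !mxE.
have E : c%:C * c%:C + s%:C * s%:C = 1 :> C.
  by rewrite -!rmorphM -rmorphD /= -!expr2 h.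
case: i => [[|[|//]] hi]; case: j => [[|[|//]] hj]; rewrite /= !cj ?rmorphN ?mulr1n ?mulr0n //.
- by rewrite mulrN mulrC addNr.
- by rewrite mulNr mulrC addNr.
- by rewrite mulrNN addrC.
Qed.

(** A rotation makes [t x + (1 - t) y] a diagonal entry of a matrix with eigenvalues [x] and [y]. By
    [sqr_normcD_le] a diagonal matrix dominates it, at the cost of the factor [1 + e] in that entry.
    After [g] is applied, the first diagonal entries are compared. *)
Lemma op_monotone_concave_lt (g : R -> R) (x y t e : R) : op_monotone g ->
  0 < x -> 0 < y -> 0 <= t <= 1 -> 0 < e ->
  t * g x + (1 - t) * g y <= g ((1 + e) * (t * x + (1 - t) * y)).
Proof.
move=> mg x0 y0 /andP[t0 t1] e0.
pose c := Num.sqrt t; pose s := Num.sqrt (1 - t).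
have c2 : c ^+ 2 = t by rewrite sqr_sqrtr.
have s2 : s ^+ 2 = 1 - t by rewrite sqr_sqrtr // subr_ge0.
have hU : rot c s \is unitarymx by apply: rot_unitary; rewrite c2 s2 addrC subrK.
pose d (i : 'I_2) := if i == 0 then x else y.
have d0 i : 0 < d i by rewrite /d; case: ifP.
have tp (a b : R) : 0 < a -> 0 < b -> 0 < t * a + (1 - t) * b.
  move=> a0 b0; case: (ltgtP 0 t) t0 => // [t0' _|<- _]; last by rewrite mul0r add0r subr0 mul1r.
  by rewrite ltr_pwDl ?mulr_gt0 // mulr_ge0 ?subr_ge0 // ltW.
have e1 : 0 < 1 + e by rewrite addr_gt0.
have e2 : 0 < 1 + e^-1 by rewrite addr_gt0 ?invr_gt0.
pose z (i : 'I_2) := if i == 0 then (1 + e) * (t * x + (1 - t) * y)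
                     else (1 + e^-1) * (t * y + (1 - t) * x).
have z0 i : 0 < z i by rewrite /z; case: ifP => _; rewrite mulr_gt0 // tp.
have E0 v : (v *m (rot c s)^t*) 0 ord0 = c%:C * v 0 ord0 + s%:C * v 0 (lift ord0 ord0).
  rewrite mxE !big_ord_recl big_ord0 addr0 !mxE /= mulrC [X in _ + X]mulrC.
  by congr (_ * _ + _ * _); exact: conjcR.
have E1 v : (v *m (rot c s)^t*) 0 (lift ord0 ord0) =
    (- s)%:C * v 0 ord0 + c%:C * v 0 (lift ord0 ord0).
  rewrite mxE !big_ord_recl big_ord0 addr0 !mxE /= mulrC [X in _ + X]mulrC.
  by congr (_ * _ + _ * _); exact: conjcR.
have nC (r : R) (u : C) : normc (r%:C * u) ^+ 2 = r ^+ 2 * normc u ^+ 2.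
  by rewrite normcM exprMn normcR real_normK ?num_real.
have P : loewner_le (specmx (rot c s) (fun i => (d i)%:C)) (rdiag z).
  apply/psdmxP; split=> [|v].
    by rewrite /hermitian_mx adjB herm_rdiag (herm_specmx (rot c s) d).
  rewrite qfB subr_ge0 qf_rdiag qf_specmx !big_ord_recl !big_ord0 !addr0 E0 E1.
  set v0 := v 0 ord0; set v1 := v 0 (lift ord0 ord0).
  have h1 := sqr_normcD_le (c%:C * v0) (s%:C * v1) e0.
  have h2 := sqr_normcD_le ((- s)%:C * v0) (c%:C * v1) e0.
  rewrite /d /z /=.
  have h1' := ler_wpM2l (ltW x0) h1; have h2' := ler_wpM2l (ltW y0) h2.
  apply: le_trans (lerD h1' h2') _; rewrite !nC sqrrN c2 s2.
  by move: (normc v0 ^+ 2) (normc v1 ^+ 2) (1 + e) (1 + e^-1) => a b k1 k2; clear; lra.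
have := mg _ _ _ (pd_specmx hU d0) (pd_rdiag z0) P.
rewrite /loewner_le (mxfun_specmx _ _ hU) mxfun_rdiag => /psdmxP[_ /(_ (delta_mx 0 ord0))].
rewrite qfB subr_ge0 qf_rdiag qf_specmx !big_ord_recl !big_ord0 !addr0 E0 E1.
have -> : (delta_mx 0 ord0 : 'rV[C]_2) 0 ord0 = 1%:C by rewrite mxE.
have -> : (delta_mx 0 ord0 : 'rV[C]_2) 0 (lift ord0 ord0) = 0 by rewrite mxE.
rewrite !mulr0 !addr0 !nC normc0 normcR normr1 expr1n expr0n sqrrN c2 s2.
by rewrite !mulr1 mulr0 addr0 /d /z /= mulrC [g y * _]mulrC.
Qed.

Lemma op_monotone_concave (g : R -> R) : op_monotone g -> concave_pos g.
Proof.
move=> mg.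
suff H x y t : 0 < x -> x < y -> 0 <= t <= 1 -> t * g x + (1 - t) * g y <= g (t * x + (1 - t) * y).
  move=> x y t x0 y0 ht; have /andP[t0 t1] := ht; case: (ltgtP x y) => [xy|yx|->]; first exact: H.
    have := H y x (1 - t) y0 yx; rewrite subKr [X in _ -> X <= _]addrC [X in _ -> _ <= g X]addrC; apply.
    by rewrite subr_ge0 t1 /= lerBlDr lerDl.
  by rewrite -!mulrDl addrC subrK !mul1r.
move=> x0 xy /andP[t0]; rewrite le_eqVlt => /orP[/eqP->|t1].
  by rewrite !mul1r subrr !mul0r !addr0.
have y0 := lt_trans x0 xy.
pose m := t * x + (1 - t) * y.
have gm : 0 <= g y - g x by rewrite subr_ge0; apply: op_monotone_nondecr => //; exact: ltW.
have m0 : 0 < m.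
  by rewrite /m ltr_wpDl ?mulr_gt0 ?subr_gt0 // mulr_ge0 // ltW.
(* lowering the mean slightly makes room for the factor [1 + e] *)
have small t' : t < t' -> t' <= 1 -> t' * g x + (1 - t') * g y <= g m.
  move=> tt' t'1.
  pose m' := t' * x + (1 - t') * y.
  have t'0 : 0 <= t' by apply: ltW; exact: le_lt_trans tt'.
  have m'0 : 0 < m'.
    rewrite /m' ltr_pwDl ?mulr_gt0 ?(le_lt_trans t0 tt') //.
    by rewrite mulr_ge0 ?subr_ge0 // ltW.
  have mm : m' < m.
    have d : 0 < (t' - t) * (y - x) by rewrite mulr_gt0 ?subr_gt0.
    by rewrite /m' /m; clear -d; lra.
  have := @op_monotone_concave_lt g x y t' (m / m' - 1) mg x0 y0.
  rewrite [1 + (_ - 1)]addrC subrK -/m' divfK ?gt_eqF //; apply; first by rewrite t'0.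
  by rewrite subr_gt0 ltr_pdivlMr // mul1r.
(* Only the left side, which is affine in the weight, passes to the limit, so continuity of [g] is
   never called upon. *)
apply: (@le_of_small _ _ _ (g y - g x) gm) => e e0.
case: (leP (t + e) 1) => [te|te].
  have := small (t + e) _ te; rewrite ltrDl => /(_ e0) h.
  by rewrite -/m; clear -h; lra.
have := small 1 t1 (lexx _) => h.
have : (1 - t) * (g y - g x) <= e * (g y - g x) by rewrite ler_wpM2r // lerBlDl ltW.
by rewrite -/m; clear -h; lra.
Qed.

Lemma mxfun_opp (h : R -> R) k (A : 'M[C]_k) : mxfun (fun x => - h x) A = - mxfun h A.
Proof.
rewrite /mxfun; set d := map_mx _ _; set d' := map_mx _ _.
have -> : d = - d' by apply/rowP => i; rewrite !mxE /RtoC;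
  apply/eqP; rewrite eq_complex /= oppr0 !eqxx.
by rewrite raddfN /= mulmxN mulNmx.
Qed.

Lemma op_monotone_opp (h : R -> R) : op_monotone_decr h -> op_monotone (fun x => - h x).
Proof.
move=> mh k A B hA hB AB; rewrite /loewner_le !mxfun_opp opprK addrC; exact: mh.
Qed.

End OpMonotone.

(** * Concavity of Ky Fan sums and the trace function *)

Section Main.
Variable R : realType.
Local Notation C := R[i].

Lemma mpow0 k (A : 'M[C]_k) : pdmx A -> mpow 0 A = 1%:M.
Proof.
move=> /pd_spec[U [d [hU -> d0]]]; rewrite (mpow_specmx _ _ hU) -(specmx_const 1 hU).
by apply: eq_specmx => i; rewrite powRr0.
Qed.

(** For a zero exponent the matrix is the same at all points, so the normalisation of [J] or [L]
    achieved at the averaged point holds at the end points too. *)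
Lemma Zmap0 n l (Phi : {linear 'M[C]_n -> 'M[C]_l}) b A1 A2 : pdmx A1 -> pdmx A2 ->
  Zmap Phi b 0 A1 = Zmap Phi b 0 A2.
Proof.
by move=> h1 h2; rewrite /Zmap oppr0 (mpow0 h1) (mpow0 h2).
Qed.

Lemma rdiag_rowsub_congr k l m (f : 'I_k -> 'I_l) (x y : 'I_k -> R) (A B : 'M[C]_(l, m))
    (Z : 'M[C]_m) (d : 'I_l -> R) : injective f -> A *m Z *m B^t* = rdiag d ->
  (rdiag x *m rowsub f A) *m Z *m (rdiag y *m rowsub f B)^t* =
  rdiag (fun i => x i * d (f i) * y i).
Proof.
move=> fi h; rewrite adjM adj_rdiag -!mulmxA.
have -> : rowsub f A *m (Z *m ((rowsub f B)^t* *m rdiag y)) = rdiag (d \o f) *m rdiag y.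
  rewrite !mulmxA; congr (_ *m _); apply/matrixP => i j.
  by rewrite rowsub_congr h !mxE (inj_eq fi).
by rewrite mulmxA !rdiagM.
Qed.

(** The equality case of Young: the rows of [J0] and [L0] are rescaled by opposite powers of [mu],
    chosen so that for nonzero [p], [q] the powers [1 / q] and [1 / p] of the two diagonals both
    equal [mu ^ (1 / (p + q))]. *)
Lemma kyfan_attained l k (hk : (k <= l)%N) (X Y : 'M[C]_l) mu L0 J0 (p q : R) :
  simdiag X Y mu L0 J0 -> (forall i, 0 < mu i) -> 0 < p + q ->
  exists L J : 'M[C]_(k, l), [/\ J *m L^t* = 1%:M,
    L *m Y *m L^t* = rdiag (fun i => mu (widen_ord hk i) `^ (q / (p + q))) &
    J *m X *m J^t* = rdiag (fun i => mu (widen_ord hk i) `^ (p / (p + q)))].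
Proof.
move=> [h1 h2 h3] mu0 pq0; pose f := widen_ord hk.
have fi : injective f by move=> a b /(congr1 val) /= h; exact: val_inj.
have n1 : p + q != 0 by rewrite gt_eqF.
have pD i (a b : R) : mu i `^ a * mu i `^ b = mu i `^ (a + b).
  by rewrite powRD // (gt_eqF (mu0 i)) implybT.
pose a i := mu (f i) `^ (- (p / (p + q) / 2)); pose b i := mu (f i) `^ (p / (p + q) / 2).
have h1' : J0 *m 1%:M *m L0^t* = rdiag (fun _ => 1) by rewrite mulmx1 h1 rdiag1.
have h2' : J0 *m X *m J0^t* = rdiag (fun _ => 1) by rewrite h2 rdiag1.
exists (rdiag a *m rowsub f L0), (rdiag b *m rowsub f J0); split.
- rewrite -[rdiag b *m _]mulmx1 (rdiag_rowsub_congr _ _ fi h1').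
  by apply: rdiag1 => i; rewrite /a /b mulr1 pD subrr powRr0.
- rewrite (rdiag_rowsub_congr _ _ fi h3); apply: f_equal; apply: funext => i.
  rewrite /a -[X in _ * X * _]powRr1 ?(ltW (mu0 _)) // !pD; congr (_ `^ _).
  by field.
- rewrite (rdiag_rowsub_congr _ _ fi h2'); apply: f_equal; apply: funext => i.
  by rewrite /b mulr1 pD; congr (_ `^ _); field.
Qed.

Lemma convex_scale (e t u1 u2 u3 : R) : 0 <= e ->
  (0 < e -> t * u1 + (1 - t) * u2 <= u3) ->
  t * (e * u1) + (1 - t) * (e * u2) <= e * u3.
Proof.
move=> e0 h; case: (ltgtP 0 e) e0 => // [ee _|<- _]; last by rewrite !mul0r !mulr0 addr0.
by rewrite ![_ * (e * _)]mulrCA -mulrDr ler_pM2l // h.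
Qed.

Lemma convex_combine (r t S S1 S2 a b a1 b1 a2 b2 : R) : 0 <= t <= 1 -> 0 < r ->
  S = r^-1 * (a + b) -> S1 <= r^-1 * (a1 + b1) -> S2 <= r^-1 * (a2 + b2) ->
  t * a1 + (1 - t) * a2 <= a -> t * b1 + (1 - t) * b2 <= b -> t * S1 + (1 - t) * S2 <= S.
Proof.
move=> /andP[t0 t1] r0 -> lo1 lo2 c1 c2.
have s0 : 0 <= r^-1 by rewrite invr_ge0 ltW.
have t1' : 0 <= 1 - t by rewrite subr_ge0.
apply: le_trans (lerD (ler_wpM2l t0 lo1) (ler_wpM2l t1' lo2)) _.
rewrite ![_ * (_^-1 * _)]mulrCA -mulrDr ler_wpM2l //.
by rewrite !mulrDr addrACA lerD.
Qed.

Section Concavity.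
Variables (n m l : nat) (Phi : {linear 'M[C]_n -> 'M[C]_l}) (Psi : {linear 'M[C]_m -> 'M[C]_l}).
Hypotheses (sPhi : strictly_positive Phi) (sPsi : strictly_positive Psi).
Variables (b : bool) (p q : R).
Hypotheses (hp : 0 <= p <= 1) (hq : 0 <= q <= 1) (pq0 : 0 < p + q).

Lemma trpow_term k (P : {linear 'M[C]_k -> 'M[C]_l}) r (J : 'M[C]_(r, l)) (e t : R) A1 A2 :
  strictly_positive P -> (forall v : 'rV_r, v *m J = 0 -> v = 0) -> 0 <= e <= 1 ->
  pdmx A1 -> pdmx A2 -> 0 <= t <= 1 ->
  t * (e * trpow e^-1 (J *m Zmap P b e A1 *m J^t*)) +
  (1 - t) * (e * trpow e^-1 (J *m Zmap P b e A2 *m J^t*)) <=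
  e * trpow e^-1 (J *m Zmap P b e (t%:C *: A1 + (1 - t)%:C *: A2) *m J^t*).
Proof.
move=> sP hJ /andP[e0 e1] h1 h2 ht; apply: convex_scale => // ee.
have he : 0 < e <= 1 by rewrite ee.
exact: (trpow_concave b sP hJ he h1 h2 ht).
Qed.

(** The minimising pair of the averaged point is admissible at both end points, where [kyfan_lower]
    bounds the sums from above by trace terms; for this fixed pair the trace terms are concave. *)
Lemma kyfan_concave k (hk : (k <= l)%N) A1 A2 B1 B2 (t : R)
    mu L J mu1 L1 J1 mu2 L2 J2 : pdmx A1 -> pdmx A2 -> pdmx B1 -> pdmx B2 -> 0 <= t <= 1 ->
  simdiag (Zmap Phi b p (t%:C *: A1 + (1 - t)%:C *: A2))
          (Zmap Psi b q (t%:C *: B1 + (1 - t)%:C *: B2)) mu L J ->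
  simdiag (Zmap Phi b p A1) (Zmap Psi b q B1) mu1 L1 J1 ->
  simdiag (Zmap Phi b p A2) (Zmap Psi b q B2) mu2 L2 J2 ->
  (forall i, 0 < mu i) -> (forall i, 0 < mu1 i) -> (forall i, 0 < mu2 i) ->
  (forall i j : 'I_l, (i <= j)%N -> mu1 i <= mu1 j) ->
  (forall i j : 'I_l, (i <= j)%N -> mu2 i <= mu2 j) ->
  t * \sum_(i < k) mu1 (widen_ord hk i) `^ (p + q)^-1 +
  (1 - t) * \sum_(i < k) mu2 (widen_ord hk i) `^ (p + q)^-1 <=
  \sum_(i < k) mu (widen_ord hk i) `^ (p + q)^-1.
Proof.
move=> hA1 hA2 hB1 hB2 ht sd sd1 sd2 mu0 mu10 mu20 so1 so2.
have hA := pd_convex hA1 hA2 ht; have hB := pd_convex hB1 hB2 ht.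
have [L' [J' [JL LY JX]]] := kyfan_attained hk sd mu0 pq0.
have LJ : L' *m J'^t* = 1%:M by rewrite -[L']trmxCK -adjM JL adj1.
have injJ (v : 'rV_k) : v *m J' = 0 -> v = 0.
  by move=> h; rewrite -[v]mulmx1 -JL mulmxA h mul0mx.
have injL (v : 'rV_k) : v *m L' = 0 -> v = 0.
  by move=> h; rewrite -[v]mulmx1 -LJ mulmxA h mul0mx.
have n1 : p + q != 0 by rewrite gt_eqF.
have pw (e : R) : e != 0 -> trpow e^-1 (rdiag (fun i => mu (widen_ord hk i) `^ (e / (p + q)))) =
    \sum_(i < k) mu (widen_ord hk i) `^ (p + q)^-1.
  move=> e0; rewrite trpow_rdiag; apply: eq_bigr => i _; rewrite -powRrM; congr (_ `^ _).
  by field; rewrite e0 n1.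
have val : \sum_(i < k) mu (widen_ord hk i) `^ (p + q)^-1 = (p + q)^-1 *
    (q * trpow q^-1 (L' *m Zmap Psi b q (t%:C *: B1 + (1 - t)%:C *: B2) *m L'^t*) +
     p * trpow p^-1 (J' *m Zmap Phi b p (t%:C *: A1 + (1 - t)%:C *: A2) *m J'^t*)).
  rewrite LY JX; set S := \sum_(i < k) _.
  have -> : q * trpow q^-1 (rdiag (fun i => mu (widen_ord hk i) `^ (q / (p + q)))) = q * S.
    by have [->|/pw->] := eqVneq q 0; rewrite ?mul0r.
  have -> : p * trpow p^-1 (rdiag (fun i => mu (widen_ord hk i) `^ (p / (p + q)))) = p * S.
    by have [->|/pw->] := eqVneq p 0; rewrite ?mul0r.
  by rewrite -mulrDl mulrA addrC mulVf ?mul1r // addrC.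
have hp0 A : pdmx A -> p = 0 -> J' *m Zmap Phi b p A *m J'^t* = 1%:M.
  move=> hA' E; move: JX; rewrite E (Zmap0 _ _ hA' hA) => ->.
  by apply: rdiag1 => i; rewrite mul0r powRr0.
have hq0 B : pdmx B -> q = 0 -> L' *m Zmap Psi b q B *m L'^t* = 1%:M.
  move=> hB' E; move: LY; rewrite E (Zmap0 _ _ hB' hB) => ->.
  by apply: rdiag1 => i; rewrite mul0r powRr0.
have lo1 := kyfan_lower hk sd1 mu10 so1 (Zmap_pd sPhi b p hA1) (Zmap_pd sPsi b q hB1)
  JL hp hq pq0 (hp0 _ hA1) (hq0 _ hB1).
have lo2 := kyfan_lower hk sd2 mu20 so2 (Zmap_pd sPhi b p hA2) (Zmap_pd sPsi b q hB2)
  JL hp hq pq0 (hp0 _ hA2) (hq0 _ hB2).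
have c1 := trpow_term sPhi injJ hp hA1 hA2 ht.
have c2 := trpow_term sPsi injL hq hB1 hB2 ht.
exact: (convex_combine ht pq0 val lo1 lo2 c2 c1).
Qed.

Lemma trace_concave (g : R -> R) A1 A2 B1 B2 (t : R) mu L J mu1 L1 J1 mu2 L2 J2 :
  concave_pos g -> nondecr_pos g ->
  pdmx A1 -> pdmx A2 -> pdmx B1 -> pdmx B2 -> 0 <= t <= 1 ->
  simdiag (Zmap Phi b p (t%:C *: A1 + (1 - t)%:C *: A2))
          (Zmap Psi b q (t%:C *: B1 + (1 - t)%:C *: B2)) mu L J ->
  simdiag (Zmap Phi b p A1) (Zmap Psi b q B1) mu1 L1 J1 ->
  simdiag (Zmap Phi b p A2) (Zmap Psi b q B2) mu2 L2 J2 ->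
  (forall i, 0 < mu i) -> (forall i, 0 < mu1 i) -> (forall i, 0 < mu2 i) ->
  t * \sum_i g (mu1 i `^ (p + q)^-1) + (1 - t) * \sum_i g (mu2 i `^ (p + q)^-1) <=
  \sum_i g (mu i `^ (p + q)^-1).
Proof.
move=> cg ng hA1 hA2 hB1 hB2 ht /simdiag_sort[s si [sd so]] /simdiag_sort[s1 si1 [sd1 so1]]
  /simdiag_sort[s2 si2 [sd2 so2]] mu0 mu10 mu20.
have rx (nu : 'I_l -> R) (u : 'I_l -> 'I_l) : injective u ->
    \sum_i g (nu i `^ (p + q)^-1) = \sum_i g (nu (u i) `^ (p + q)^-1).
  by move=> ui; rewrite (reindex_inj ui).
rewrite (rx mu s si) (rx mu1 s1 si1) (rx mu2 s2 si2).
apply: (@weak_majorization_concave R l g (fun i => mu (s i) `^ (p + q)^-1)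
  (fun i => mu1 (s1 i) `^ (p + q)^-1) (fun i => mu2 (s2 i) `^ (p + q)^-1)) => //.
- by move=> i; exact: powR_gt0.
- by move=> i; exact: powR_gt0.
- by move=> i; exact: powR_gt0.
- move=> i j ij; apply: ge0_ler_powR; rewrite ?nnegrE ?invr_ge0 ?(ltW pq0) ?(ltW (mu0 _)) //.
  exact: so.
- move=> k hk.
  exact: (kyfan_concave hk hA1 hA2 hB1 hB2 ht sd sd1 sd2 (fun i => mu0 _) (fun i => mu10 _)
    (fun i => mu20 _) so1 so2).
Qed.

End Concavity.

(** Here [p + q] is [p' + q'] or its opposite, so the inner power is [mu i] or its inverse. With [b]
    false the [mu i] belong to the inverted matrices, and inverting them recovers the eigenvalues
    inside the trace. *)
Lemma trace_repr n m l (Phi : {linear 'M[C]_n -> 'M[C]_l}) (Psi : {linear 'M[C]_m -> 'M[C]_l})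
    (b : bool) (p q p' q' : R) A B :
  strictly_positive Phi -> strictly_positive Psi -> p' + q' != 0 -> pdmx A -> pdmx B ->
  p = (if b then p' else - p') -> q = (if b then q' else - q') ->
  exists mu L J, [/\ simdiag (Zmap Phi b p' A) (Zmap Psi b q' B) mu L J,
    forall i, 0 < mu i &
    forall f, \tr (mxfun f (mpow (1 / 2) (Phi (mpow p A)) *m Psi (mpow q B) *m
                            mpow (1 / 2) (Phi (mpow p A)))) =
      (\sum_i f (mu i `^ (p' + q')^-1 `^ (p + q)))%:C].
Proof.
move=> sPhi sPsi pq0 hA hB Ep Eq.
have hX := sPhi _ (mpow_pd p hA); have hY := sPsi _ (mpow_pd q hB).
have [mu [L [J [sd mu0 tr]]]] := simdiag_exists hX hY.
case: b Ep Eq => Ep Eq.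
  exists mu, L, J; split; [by rewrite /Zmap -Ep -Eq; exact: sd | exact: mu0 | move=> f].
  apply: (etrans (tr f)); apply: f_equal; apply: eq_bigr => i _.
  by rewrite Ep Eq -powRrM mulVf // powRr1 // ltW.
exists (fun i => (mu i)^-1), J, L; split.
- rewrite /Zmap -Ep -Eq; exact: (simdiag_inv hX hY mu0 sd).
- by move=> i; rewrite invr_gt0.
- move=> f; apply: (etrans (tr f)); apply: f_equal; apply: eq_bigr => i _.
  rewrite Ep Eq -powR_inv1 ?(ltW (mu0 _)) // -!powRrM -opprD mulrN mulN1r ?mulNr opprK mulVf //.
  by rewrite powRr1 // ltW.
Qed.

Lemma complex_convexE (t : R) (z z1 z2 : C) (a a1 a2 : R) :
  z = a%:C -> z1 = a1%:C -> z2 = a2%:C -> t * a1 + (1 - t) * a2 <= a ->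
  RtoC t * z1 + RtoC (1 - t) * z2 <= z.
Proof.
move=> -> -> -> h.
by rewrite -[RtoC t]/(t%:C) -[RtoC (1 - t)]/((1 - t)%:C) -!rmorphM -rmorphD lecR.
Qed.

Lemma complex_convex_opp (t : R) (w w1 w2 z z1 z2 : C) :
  z = - w -> z1 = - w1 -> z2 = - w2 -> RtoC t * z1 + RtoC (1 - t) * z2 <= z ->
  w <= RtoC t * w1 + RtoC (1 - t) * w2.
Proof. by move=> -> -> ->; rewrite !mulrN -opprD lerN2. Qed.

Lemma tr_mxfun_opp (h : R -> R) k (M : 'M[C]_k) :
  \tr (mxfun (fun x => - h x) M) = - \tr (mxfun h M).
Proof. by rewrite mxfun_opp raddfN. Qed.

Lemma joint_concavity n m l (Phi : {linear 'M[C]_n -> 'M[C]_l}) (Psi : {linear 'M[C]_m -> 'M[C]_l})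
    (b : bool) (p q p' q' : R) (f : R -> R) :
  strictly_positive Phi -> strictly_positive Psi -> 0 < p' + q' ->
  0 <= p' <= 1 -> 0 <= q' <= 1 ->
  p = (if b then p' else - p') -> q = (if b then q' else - q') ->
  op_monotone (fun x => f (x `^ (p + q))) ->
  jointly_concave (fun (A : 'M[C]_n) (B : 'M[C]_m) =>
    \tr (mxfun f (mpow (1 / 2) (Phi (mpow p A)) *m Psi (mpow q B) *m
                  mpow (1 / 2) (Phi (mpow p A))))).
Proof.
move=> sPhi sPsi pq0 hp hq Ep Eq mf A1 A2 B1 B2 t hA1 hA2 hB1 hB2 ht.
have hA := pd_convex hA1 hA2 ht; have hB := pd_convex hB1 hB2 ht.
have pq1 : p' + q' != 0 by rewrite gt_eqF.
have [mu [L [J [sd mu0 tr]]]] := trace_repr sPhi sPsi pq1 hA hB Ep Eq.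
have [mu1 [L1 [J1 [sd1 mu10 tr1]]]] := trace_repr sPhi sPsi pq1 hA1 hB1 Ep Eq.
have [mu2 [L2 [J2 [sd2 mu20 tr2]]]] := trace_repr sPhi sPsi pq1 hA2 hB2 Ep Eq.
have H := trace_concave sPhi sPsi hp hq pq0 (op_monotone_concave mf) (op_monotone_nondecr mf)
  hA1 hA2 hB1 hB2 ht sd sd1 sd2 mu0 mu10 mu20.
exact: (complex_convexE (tr f) (tr1 f) (tr2 f) H).
Qed.

End Main.

Theorem theorem2p1 (R : realType) (n m l : nat)
  (Phi : {linear 'M[R[i]]_n -> 'M[R[i]]_l})
  (Psi : {linear 'M[R[i]]_m -> 'M[R[i]]_l})
  (p q : R) (f : R -> R) :
  strictly_positive Phi -> strictly_positive Psi ->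
  (p, q) <> (0, 0) ->
  ((0 <= p <= 1) /\ (0 <= q <= 1)) \/ ((-1 <= p <= 0) /\ (-1 <= q <= 0)) ->
  let F := fun (A : 'M[R[i]]_n) (B : 'M[R[i]]_m) =>
    let X := mxfun (fun x => x `^ (1 / 2)) (Phi (mxfun (fun x => x `^ p) A)) in
    \tr (mxfun f (X *m Psi (mxfun (fun x => x `^ q) B) *m X)) in
  (op_monotone (fun x => f (x `^ (p + q))) -> jointly_concave F) /\
  (op_monotone_decr (fun x => f (x `^ (p + q))) -> jointly_convex F).
Proof.
move=> sPhi sPsi pq hpq F.
(* [b] records the common sign of the exponents and [p'], [q'] are their absolute values. *)
have [b [p' [q' [Ep Eq [hp hq]]]]] : exists (b : bool) p' q',
    [/\ p = (if b then p' else - p'), q = (if b then q' else - q') &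
        (0 <= p' <= 1) /\ (0 <= q' <= 1)].
  case: hpq => -[hp hq]; [by exists true, p, q | exists false, (- p), (- q)].
  rewrite !opprK; split=> //; move: hp hq; rewrite !oppr_ge0 !(lerNl _ 1).
  by move=> /andP[-> ->] /andP[-> ->].
have pq0 : 0 < p' + q'.
  have /andP[p0 _] := hp; have /andP[q0 _] := hq; rewrite lt0r addr_ge0 // andbT.
  apply/eqP => E; apply: pq; have [p'0 q'0] : p' = 0 /\ q' = 0 by clear -E p0 q0; split; lra.
  by rewrite Ep Eq p'0 q'0 oppr0 !if_same.
split=> [mf|mf]; first exact: (joint_concavity sPhi sPsi pq0 hp hq Ep Eq mf).
move=> A1 A2 B1 B2 t hA1 hA2 hB1 hB2 ht.
apply: (complex_convex_opp (tr_mxfun_opp f _) (tr_mxfun_opp f _) (tr_mxfun_opp f _)).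
exact: (joint_concavity sPhi sPsi pq0 hp hq Ep Eq (op_monotone_opp mf) hA1 hA2 hB1 hB2 ht).
Qed.
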